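(* Let $(Z,d,\nu)$ be a complete doubling metric measure space, $p\ge1$ and $0<\theta<1$. Suppose that $\nu$ has relative lower volume decay of order $Q>0$ and that $\nu$ satisfies the reverse-doubling property. Assume further that $p\theta<Q$ and set $Q_*=Qp/(Q-p\theta)$. Then functions in $\tilde B^\theta_p(Z)$ belong to $L^{Q_*}_{\rm loc}(Z)$ and have representatives (functions agreeing with them $\nu$-a.e.) which have $L^{Q_*}(Z)$-Lebesgue points quasieverywhere with respect to the Besov capacity.
   Context: A metric measure space is a metric space with a Borel regular measure giving every ball positive finite measure; it is doubling if $\nu(B(z,2r))\le C_\nu\nu(B(z,r))$ for all $z,r$. Relative lower volume decay of order $Q$: there is $C_{\rm low}\ge1$ with $\frac{\nu(B(z,r'))}{\nu(B(z,r))}\ge C_{\rm low}^{-1}\left(\frac{r'}{r}\right)^Q$ for all $z\in Z$, $0<r'\le r$. Reverse-doubling property: there are $\eta>0$ and $C_{\rm rev}\ge1$ with $\frac{\nu(B(z,r'))}{\nu(B(z,r))}\le C_{\rm rev}\left(\frac{r'}{r}\right)^\eta$ for all $z\in Z$, $0<r'\le r$. $L^q_{\rm loc}(Z)$: measurable functions in $L^q(B)$ for every ball $B\subset Z$. $\|u\|_{B^\theta_p(Z)}^p=\int_Z\int_Z\frac{|u(x)-u(y)|^p}{d(x,y)^{p\theta}}\frac{d\nu(x)\,d\nu(y)}{\nu(B(x,d(x,y)))}$; $\tilde B^\theta_p(Z)=\{u\in L^p_{\rm loc}(Z):\|u\|_{B^\theta_p(Z)}<\infty\}$; $\check B^\theta_p(Z)=L^p(Z)\cap\tilde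 B^\theta_p(Z)$ with norm $\|u\|_{\check B^\theta_p(Z)}=\|u\|_{L^p(Z)}+\|u\|_{B^\theta_p(Z)}$. Besov capacity of $G\subset Z$: $C^Z_{\check B^\theta_p}(G)=\inf_u\|u\|^p_{\check B^\theta_p(Z)}$ over $u\in\check B^\theta_p(Z)$ with $u\ge1$ $\nu$-a.e. on a neighborhood of $G$. A property holds quasieverywhere if it fails only on a set of zero Besov capacity. A point $x$ is an $L^q(Z)$-Lebesgue point of $u$ if $\lim_{r\to0^+}\frac1{\nu(B(x,r))}\int_{B(x,r)}|u-u(x)|^q\,d\nu=0$. *)

(* Defs.v *)
From HB Require Import structures.
From mathcomp Require Import all_boot all_order all_algebra.
From mathcomp Require Import all_classical all_reals all_analysis.

Set Implicit Arguments.
Unset Strict Implicit.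
Unset Printing Implicit Defensive.
Import Order.TTheory GRing.Theory Num.Theory.
Import numFieldNormedType.Exports.

Local Open Scope classical_set_scope.
Local Open Scope ring_scope.

(* The two structures on [Z] are unrelated at this point; [borel_regular] below
   makes the sigma-algebra contain the Borel sets of the metric. *)
#[short(type="metricMeasurableType")]
HB.structure Definition MetricMeasurable (R : numDomainType)
    (d : measure_display) :=
  {Z of Metric R Z & Measurable d Z}.

#[short(type="completeMetricMeasurableType")]
HB.structure Definition CompleteMetricMeasurable (R : numDomainType)
    (d : measure_display) :=
  {Z of MetricMeasurable R d Z & Complete Z}.

Section metric_measure_space.
Context (R : realType) (d : measure_display) (Z : metricMeasurableType R d).
Variable nu : {measure set Z -> \bar R}.
Implicit Types (u v : Z -> R) (x y z : Z) (r p q Q theta : R).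

Definition borel_set (B : set Z) : Prop := <<s [set U : set Z | open U] >> B.

(* The domain of [nu] may be the Borel sigma-algebra, or the sigma-algebra of
   sets measurable for a Borel regular outer measure, or anything between. *)
Definition borel_regular : Prop :=
  (forall B : set Z, borel_set B -> measurable B) /\
  (forall A : set Z, measurable A ->
     exists B : set Z, [/\ borel_set B, A `<=` B & nu B = nu A]).

Definition metric_measure_space : Prop :=
  borel_regular /\ forall z r, 0 < r -> (0 < nu (ball z r) < +oo)%E.

Definition doubling : Prop :=
  exists C : R, forall z r, 0 < r ->
    (nu (ball z (2 * r)) <= C%:E * nu (ball z r))%E.

Definition lower_volume_decay Q : Prop :=
  exists2 C : R, 1 <= C & forall z r' r, 0 < r' -> r' <= r ->
    ((C^-1 * (r' / r) `^ Q)%:E <= nu (ball z r') / nu (ball z r))%E.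

Definition reverse_doubling : Prop :=
  exists eta C : R, [/\ 0 < eta, 1 <= C & forall z r' r, 0 < r' -> r' <= r ->
    (nu (ball z r') / nu (ball z r) <= (C * (r' / r) `^ eta)%:E)%E].

Definition Lloc q u : Prop :=
  measurable_fun setT u /\
  forall z r, (\int[nu]_(x in ball z r) (`|u x| `^ q)%:E < +oo)%E.

(* On the diagonal the integrand is [0 / 0 * +oo], which is [0] with the
   library's conventions. *)
Definition besov_seminorm theta p u : \bar R :=
  ((\int[nu]_y \int[nu]_x
      ((`|u x - u y| `^ p / mdist x y `^ (p * theta))%:E
        / nu (ball x (mdist x y)))) `^ p^-1)%E.

Definition besov_tilde theta p u : Prop :=
  Lloc p u /\ (besov_seminorm theta p u < +oo)%E.

Definition besov_check theta p u : Prop :=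
  finite_norm nu p%:E u /\ besov_tilde theta p u.

Definition besov_check_norm theta p u : \bar R :=
  ('N[nu]_p%:E[EFin \o u] + besov_seminorm theta p u)%E.

Definition besov_capacity theta p (G : set Z) : \bar R :=
  ereal_inf [set (besov_check_norm theta p u `^ p)%E | u in
    [set u | besov_check theta p u /\
       exists2 V, set_nbhs G V & {ae nu, forall x, V x -> 1 <= u x}]].

Definition quasieverywhere theta p (P : Z -> Prop) : Prop :=
  besov_capacity theta p [set x | ~ P x] = 0%E.

Definition Lq_lebesgue_pt q u x : Prop :=
  ((nu (ball x r))^-1 * \int[nu]_(y in ball x r) (`|u y - u x| `^ q)%:E)%E
    @[r --> 0^'+] --> 0%E.

Definition representative u v : Prop :=
  measurable_fun setT v /\ {ae nu, forall x, v x = u x}.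

End metric_measure_space.

(* Main.v *)
(* For a point [y] let [osc r y] be the mean of [|u(y) - u(z)|^p] over
   [z] in [B(y,r)], and let [osc_sum r y] be the sum of [s^(-p theta) osc s y]
   over the scales [s = 2^-j r]. By doubling, the integral of [osc_sum] is at
   most a constant times the Besov energy, and [osc_sum] controls the jumps of
   the averages of [u] between consecutive scales. Telescoping these averages,
   with the small scales bounded by [osc_sum] at the point and the large ones by
   its integral over the ball, and optimizing the splitting scale, gives a
   Sobolev inequality on balls with exponent [Q*]. Hence [u] is [L^Q*] on
   balls, and if the averages of [u] converge at [x] while the integral of
   [osc_sum r] over [B(x,r)] is [o(r^(-p theta) nu(B(x,r)))], then [x] is an
   [L^Q*]-Lebesgue point.

   For the capacity, whenever [sum_j f_j > 1] on [G] and [f_j <= A_j(x)] on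
   [B(x,2^(1-j))], truncating at 1 the sum of the [2^j]-Lipschitz bumps
   [sup_y (1 - 2^j d(x,y))_+ f_j(y)] yields a test function for [G] of energy
   [<= C sum_j 2^(j p theta) ||A_j||_p^p]. Taking for [f_j] the jumps of
   averages, plus indicators of the neighborhoods of a greedily selected family
   of balls carrying too much of a weight [h] that dominates every multiple of
   [osc_sum] at small scales, shows that the points outside the previous
   criterion have arbitrarily small capacity. *)

Require Import Defs.
From HB Require Import structures.
From mathcomp Require Import all_boot all_order all_algebra.
From mathcomp Require Import all_classical all_reals all_analysis.
From mathcomp Require Import measurable_realfun ring lra.
Import Order.TTheory GRing.Theory Num.Theory.
Import numFieldNormedType.Exports.
Set Implicit Arguments.
Unset Strict Implicit.
Unset Printing Implicit Defensive.
Local Open Scope classical_set_scope.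
Local Open Scope ring_scope.

(** Nothing pointwise has to be measurable in the capacity argument: the functions [f_j] and the
    selected sets are arbitrary, and only the dominants [A_j] and open fattenings are integrated.

    The range [0 < theta < 1] enters through one bound. A [2^j]-Lipschitz bump varies by at most a
    multiple of [min(1, 2^j d)] over distance [d]; divided by [(2^j d)^theta] this decays like a
    power of [2^j d] at 0, as [theta < 1], and at infinity, as [theta > 0]. So the scales decouple,
    and the [p]-th power of a sum over scales costs only a constant, also for [p = 1].

    The criterion for Lebesgue points asks for a little o, while a covering argument with [osc_sum]
    alone would give a big O. The gap closes because the [osc_sum] at dyadic radii are tails of one
    series with finite integral: radii whose tails have integral at most [2^-m] are chosen, and the
    tails are summed over [m >= K]. This weight has integral at most [2 * 2^-K] and counts the
    oscillation at small scales arbitrarily often. The representative does not depend on [K], so one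
    exceptional set has capacity at most a constant times [2^-K] for every [K]. *)

Section lower_integral.
Context d (T : measurableType d) (R : realType).
Variable mu : {measure set T -> \bar R}.
Local Open Scope ereal_scope.

(* The integral of a nonnegative function is a supremum over simple functions,
   hence monotone even without measurability. *)
Lemma ge0_le_integral_nomeas (D : set T) (f g : T -> \bar R) :
  (forall x, D x -> 0 <= f x) -> (forall x, D x -> f x <= g x) ->
  \int[mu]_(x in D) f x <= \int[mu]_(x in D) g x.
Proof.
move=> f0 fg; rewrite !ge0_integralE//; last first.
  by move=> x Dx; rewrite (le_trans (f0 x Dx))// fg.
apply: ge_ereal_sup => _ [h hf <-]; apply: ereal_sup_ubound; exists h => //.
move=> x; apply: (le_trans (hf x)); rewrite !patchE.
by case: ifPn => // /set_mem /fg.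
Qed.

(** In a piece [G n] of finite measure only finitely many disjoint sets can have mass at least
    [1/(k+1)], and a set of positive measure does so for some [n] and [k]. *)
Lemma sigma_finite_countable_disjoint (I : choiceType) (A : set I)
    (F : I -> set T) : sigma_finite setT mu ->
  trivIset A F -> (forall i, A i -> measurable (F i) /\ 0 < mu (F i)) ->
  countable A.
Proof.
move=> [G TG mG] tF F0.
pose S n k := [set i | A i /\ (k.+1%:R^-1)%:E <= mu (F i `&` G n)].
suff AS : A `<=` \bigcup_n \bigcup_k S n k.
  apply: (sub_countable (subset_card_le AS)); apply: bigcup_countable => // n _.
  apply: bigcup_countable => // k _; apply: finite_set_countable.
  have [mGn Gnoo] := mG n.
  apply: contrapT => /infiniteP/card_leP/unsquash f.
  pose f' m : I := val (f (SigSub (mem_set (Logic.I : [set: nat] m)))).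
  have Sf m : S n k (f' m) by exact: set_valP.
  have finj : injective f'.
    move=> a b /val_inj/(@inj _ _ _ f).
    by rewrite !inE => /(_ Logic.I Logic.I)/(congr1 val).
  pose g m := F (f' m) `&` G n.
  have mg m : measurable (g m).
    by apply: measurableI => //; have [/F0[]] := Sf m.
  have tg : trivIset setT g.
    apply/trivIsetP => a b _ _ ab; rewrite /g setIACA setIid.
    move/trivIsetP : tF => -> //; rewrite ?set0I//.
    - by have [] := Sf a.
    - by have [] := Sf b.
    - by apply: contra ab => /eqP/finj/eqP.
  have : mu (\bigcup_i g i) <= mu (G n).
    by apply: le_measure; rewrite ?inE//; [exact: bigcup_measurable|
      move=> x [m _] []].
  rewrite measure_bigcup// leNgt => /negP; apply.
  have Gfin : mu (G n) \is a fin_num by rewrite ge0_fin_numE.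
  rewrite -(fineK Gfin).
  (* [N] disjoint pieces of mass [1/(k+1)] already outweigh [G n]. *)
  pose N := Num.bound (fine (mu (G n)) * k.+1%:R).
  apply: (@lt_le_trans _ _ (\sum_(0 <= i < N) (k.+1%:R^-1)%:E)).
    rewrite sumEFin lte_fin sumr_const_nat subn0.
    by rewrite -[ltRHS]mulr_natl ltr_pdivlMr ?ltr0n// archi_boundP// mulr_ge0// fine_ge0.
  apply: (le_trans _ (@nneseries_lim_ge _ _ _ 0%N N _)) => //.
  rewrite big_mkcond [leRHS]big_mkcond/=; apply: lee_sum => i _.
  by rewrite in_setT; have [] := Sf i.
move=> i Ai; have [mFi Fi0] := F0 i Ai.
have [n Fn] : exists n, mu (F i `&` G n) != 0.
  apply: contrapT => /forallNP H.
  suff Fi : mu (F i) = 0 by rewrite Fi ltxx in Fi0.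
  rewrite -(setIT (F i)) TG setI_bigcupr.
  apply/eqP; rewrite eq_le measure_ge0 andbT.
  apply: (@le_trans _ _ (\sum_(0 <= n <oo) mu (F i `&` G n))).
    apply: measure_sigma_subadditive => //.
      by move=> n; apply: measurableI => //; have [] := mG n.
    by apply: bigcup_measurable => n _; apply: measurableI => //; have [] := mG n.
  by rewrite eseries0// => n _ _; have /negP := H n; rewrite negbK => /eqP.
have Ffin : mu (F i `&` G n) \is a fin_num.
  rewrite ge0_fin_numE//; have [mGn] := mG n; apply: le_lt_trans.
  by apply: le_measure; rewrite ?inE//; exact: measurableI.
have := Fn; rewrite -(fineK Ffin) eqe => F0'.
have /ltr_add_invr[k] : (0 < fine (mu (F i `&` G n)))%R.
  by rewrite lt_neqAle eq_sym F0' fine_ge0.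
rewrite add0r => kF; exists n => //; exists k => //; split => //.
by rewrite -(fineK Ffin) lee_fin ltW.
Qed.

End lower_integral.

(** * Balls and Tonelli's theorem *)

Section metric_measure.
Context (R : realType) (d : measure_display) (Z : metricMeasurableType R d).
Variable nu : {measure set Z -> \bar R}.
Implicit Types (x y z : Z) (r : R).

Lemma ball_mdist x r y : ball x r y <-> mdist x y < r.
Proof. by rewrite ballEmdist. Qed.

Lemma open_metric_ball x r : open (ball x r).
Proof.
rewrite openE => y /ball_mdist xy; rewrite /interior/=.
apply/nbhs_ballP; exists (r - mdist x y); first by rewrite /= subr_gt0.
move=> z /ball_mdist yz; apply/ball_mdist.
by rewrite (le_lt_trans (metric_triangle x y z))// -ltrBrDl.
Qed.

Lemma subset_metric_ball x y r s : mdist x y + r <= s -> ball y r `<=` ball x s.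
Proof.
move=> h z /ball_mdist yz; apply/ball_mdist.
by rewrite (le_lt_trans (metric_triangle x y z))// (lt_le_trans _ h)// ltrD2l.
Qed.

Hypothesis hZ : metric_measure_space nu.

Lemma measurable_open (U : set Z) : open U -> measurable U.
Proof. by move=> oU; apply: hZ.1.1; exact: sub_gen_smallest. Qed.

Lemma measurable_ballm x r : measurable (ball x r).
Proof. exact/measurable_open/open_metric_ball. Qed.

Definition vball x r : R := fine (nu (ball x r)).

Lemma nu_ballE x r : 0 < r -> nu (ball x r) = (vball x r)%:E.
Proof.
by move=> /(hZ.2 x)/andP[n0 noo]; rewrite fineK// ge0_fin_numE.
Qed.

Lemma vball_gt0 x r : 0 < r -> 0 < vball x r.
Proof. by move=> r0; apply: fine_gt0; exact: hZ.2. Qed.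

Lemma vball_ge0 x r : 0 <= vball x r.
Proof. exact: fine_ge0. Qed.

Lemma le_vball x y r s : 0 < r -> mdist x y + r <= s -> vball y r <= vball x s.
Proof.
move=> r0 h; have s0 : 0 < s.
  by apply: lt_le_trans h; rewrite ltr_wpDl// mdist_ge0.
rewrite -lee_fin -!nu_ballE//; apply: le_measure; rewrite ?inE.
- exact: measurable_ballm.
- exact: measurable_ballm.
- exact: subset_metric_ball.
Qed.

Lemma sigma_finite_metric_measure : sigma_finite setT nu.
Proof.
have [Z0|/set0P[z _]] := eqVneq [set: Z] set0.
  exists (fun=> set0); first by rewrite Z0 bigcup_const.
  by move=> _; rewrite measure0.
exists (fun n => ball z n.+1%:R).
  apply/seteqP; split => // x _; exists (Num.bound (mdist z x)) => //.
  apply/ball_mdist; rewrite (lt_trans (archi_boundP (mdist_ge0 _ _)))//.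
  by rewrite ltr_nat.
move=> n; split; first exact: measurable_ballm.
by have /andP[] := hZ.2 z n.+1%:R (ltr0Sn _ _).
Qed.

(** By maximality every ball of radius [r/2] meets one of a disjoint family of such balls, so its
    center is within [r] of a center of the family. The family is countable because balls have
    positive measure and [nu] is sigma-finite. *)
Lemma metric_measure_separable z r : 0 < r ->
  exists s : nat -> Z, forall x, exists n, mdist (s n) x < r.
Proof.
move=> r0; have r20 : 0 < r / 2 by rewrite divr_gt0.
have [A [_ tA maxA]] :=
  ex_maximal_disjoint_subcollection (fun x : Z => ball x (r / 2)) setT.
have : countable A.
  apply: (sigma_finite_countable_disjoint sigma_finite_metric_measure tA) => x _.
  by split; [exact: measurable_ballm|have /andP[] := hZ.2 x _ r20].
move=> /pcard_injP[f finj].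
exists (fun n => xget z [set x | A x /\ f x = n]) => x.
have [a [Aa ax]] : exists a, A a /\ ball a (r / 2) `&` ball x (r / 2) !=set0.
  have [Ax|nAx] := pselect (A x).
    exists x; split => //; exists x; split; apply/ball_mdist; rewrite mdistxx//.
  apply: contrapT => /forallNP H.
  apply: (maxA (x |` A)) => //.
    rewrite properEneq; split; last exact: subsetUr.
    by apply/eqP => AE; apply: nAx; rewrite AE; left.
  move=> i j [->|Ai] [->|Aj] //.
  - by rewrite setIC => h; exfalso; apply: (H j).
  - by move=> h; exfalso; apply: (H i).
  - exact: tA.
exists (f a); case: xgetP => [_ -> [Ab fba]|/(_ a)]; last by move=> /(_ (conj Aa erefl)).
move: ax; rewrite (finj _ _ _ _ fba) ?inE// => -[y [/ball_mdist ay /ball_mdist xy]].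
by rewrite (le_lt_trans (metric_triangle a y x))// [ltRHS]splitr ltrD// metric_sym.
Qed.

(** Openness in the product topology does not by itself give measurability for the product
    sigma-algebra. Countable nets at all scales exhibit the set as a countable union of
    rectangles. *)
Lemma measurable_near r : measurable [set xy : Z * Z | mdist xy.1 xy.2 < r].
Proof.
have [Z0|/set0P[z _]] := eqVneq [set: Z] set0.
  rewrite (_ : [set _ | _] = set0)//; apply/seteqP; split => // -[x y] _.
  by have : [set: Z] x by []; rewrite Z0.
have e0 n : 0 < n.+1%:R^-1 :> R by rewrite invr_gt0.
have /choice[s sP] n := metric_measure_separable z (e0 n).
rewrite (_ : [set _ | _] = \bigcup_n \bigcup_k
    (ball (s n k) n.+1%:R^-1 `*` ball (s n k) (r - n.+1%:R^-1))).
  apply: bigcupT_measurable => n; apply: bigcupT_measurable => k.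
  by apply: measurableX; exact: measurable_ballm.
apply/seteqP; split => [[x y]/= xy|[x y] [n _ [k _ []]]/=].
  have : 0 < (r - mdist x y) / 2 by rewrite divr_gt0// subr_gt0.
  move=> /ltr_add_invr[n]; rewrite add0r => nr.
  have [k kx] := sP n x; exists n => //; exists k => //; split; apply/ball_mdist => //=.
  rewrite (le_lt_trans (metric_triangle _ x _))//.
  have := nr; move: kx; set e := _^-1; set a := mdist _ _; set b := mdist _ _; lra.
move=> /ball_mdist sx /ball_mdist sy.
rewrite (le_lt_trans (metric_triangle _ (s n k) _))// metric_sym.
by move: sx sy; set e := _^-1; set a := mdist _ _; set b := mdist _ _; lra.
Qed.

Section tonelli.
Local Open Scope ereal_scope.
Variable f : Z * Z -> \bar R.
Hypotheses (mf : measurable_fun [set: Z * Z] f) (f0 : forall xy, 0 <= f xy).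

(** Sigma-finiteness follows from [hZ] and is not part of the type of [nu], so the structure that
    Tonelli's theorem expects is packed locally. *)
Let sf_sfinite := isSFinite.Build _ _ _ (nu : set Z -> \bar R)
  (sfinite_measure_sigma_finite sigma_finite_metric_measure).

Let sf_sigma_finite := isSigmaFinite.Build _ _ _ (nu : set Z -> \bar R)
  sigma_finite_metric_measure.

Let sf : {sigma_finite_measure set Z -> \bar R} :=
  HB.pack_for (SigmaFiniteMeasure.type Z R) (Measure.sort nu)
    sf_sfinite sf_sigma_finite.

Lemma tonelli_nu : \int[nu]_x \int[nu]_y f (x, y) = \int[nu]_y \int[nu]_x f (x, y).
Proof. exact: (@fubini_tonelli _ _ _ _ _ sf sf). Qed.

Lemma measurable_int_snd : measurable_fun setT (fun x => \int[nu]_y f (x, y)).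
Proof. exact: (@measurable_fun_fubini_tonelli_F _ _ _ _ _ sf). Qed.

Lemma measurable_int_fst : measurable_fun setT (fun y => \int[nu]_x f (x, y)).
Proof. exact: (@measurable_fun_fubini_tonelli_G _ _ _ _ _ sf). Qed.

End tonelli.

End metric_measure.

(** * Integrals over moving balls and consequences of doubling *)

Section ball_kernel.
Context (R : realType) (d : measure_display) (Z : metricMeasurableType R d).
Variable nu : {measure set Z -> \bar R}.
Implicit Types (x y z : Z) (r s : R).
Hypothesis hZ : metric_measure_space nu.

Section tonelli_ball.
Local Open Scope ereal_scope.
Variable g : Z * Z -> \bar R.
Hypotheses (mg : measurable_fun setT g) (g0 : forall xy, 0 <= g xy).

Let near_set r : set (Z * Z) := [set xy | (mdist xy.1 xy.2 < r)%R].

Let mgr r : measurable_fun setT (g \_ (near_set r)).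
Proof.
apply/(measurable_restrictT g) => //; first exact: (measurable_near hZ).
exact: measurable_funS mg.
Qed.

Let gr0 r xy : 0 <= (g \_ (near_set r)) xy.
Proof. by rewrite patchE; case: ifP. Qed.

Let ball_intE r x :
  \int[nu]_(y in ball x r) g (x, y) = \int[nu]_y (g \_ (near_set r)) (x, y).
Proof.
rewrite integral_mkcond; apply: eq_integral => y _; rewrite !patchE.
case: ifPn => [/set_mem/ball_mdist xy|/negP xy]; first by rewrite ifT// inE.
by rewrite ifF//; apply/negP => /set_mem H; apply: xy; rewrite inE; apply/ball_mdist.
Qed.

Let ball_intE' r y :
  \int[nu]_(x in ball y r) g (x, y) = \int[nu]_x (g \_ (near_set r)) (x, y).
Proof.
rewrite integral_mkcond; apply: eq_integral => x _; rewrite !patchE.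
case: ifPn => [/set_mem/ball_mdist xy|/negP xy].
  by rewrite ifT// inE /near_set/= metric_sym.
rewrite ifF//; apply/negP => /set_mem H; apply: xy; rewrite inE.
by apply/ball_mdist; rewrite metric_sym.
Qed.

(** The relation [mdist x y < r] is symmetric: one cut-off of [g] describes both the balls around
    [x] and those around [y]. *)
Lemma tonelli_ball r : \int[nu]_x \int[nu]_(y in ball x r) g (x, y) =
  \int[nu]_y \int[nu]_(x in ball y r) g (x, y).
Proof.
under eq_integral do rewrite ball_intE.
rewrite (tonelli_nu hZ)//.
by apply: eq_integral => y _; rewrite ball_intE'.
Qed.

Lemma measurable_ball_int r :
  measurable_fun setT (fun x => \int[nu]_(y in ball x r) g (x, y)).
Proof.
under eq_fun do rewrite ball_intE.
exact: (measurable_int_snd hZ).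
Qed.

End tonelli_ball.

Lemma measurable_vball r : measurable_fun setT (fun x => vball nu x r).
Proof.
have -> : (fun x => vball nu x r) =
    fine \o (fun x => \int[nu]_(y in ball x r) cst 1 (x, y))%E.
  apply/funext => x /=; rewrite integral_cst; last exact: (measurable_ballm hZ).
  by rewrite mul1e.
apply: (measurableT_comp (@fine_measurable R setT _)) => //.
by apply: (measurable_ball_int (g := cst 1%E)) => // xy; exact: lee01.
Qed.

Variable Cd : R.
Hypotheses (Cd1 : 1 <= Cd)
  (hCd : forall x r, 0 < r -> vball nu x (2 * r) <= Cd * vball nu x r).

Lemma vball_doubling x r n : 0 < r -> vball nu x (2 ^+ n * r) <= Cd ^+ n * vball nu x r.
Proof.
move=> r0; elim: n => [|n IH]; first by rewrite !expr0 !mul1r.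
rewrite exprS -mulrA (le_trans (hCd _ _))// ?mulr_gt0// ?exprn_gt0//.
by rewrite exprS -mulrA ler_wpM2l// (le_trans _ Cd1).
Qed.

Lemma vball_comparable n x y r s : 0 < r -> 0 < s ->
  mdist x y + s <= 2 ^+ n * r -> vball nu y s <= Cd ^+ n * vball nu x r.
Proof.
move=> r0 s0 h; apply: le_trans (vball_doubling _ _ r0).
exact: le_vball.
Qed.

Lemma inv_vball_comparable n x y r s : 0 < r -> 0 < s ->
  mdist x y + s <= 2 ^+ n * r -> (vball nu x r)^-1 <= Cd ^+ n * (vball nu y s)^-1.
Proof.
move=> r0 s0 h; have := vball_comparable r0 s0 h.
rewrite -{1}(mul1r (_^-1)) ler_pdivrMr ?vball_gt0// -mulrA mulrCA => ss.
by rewrite mulrC ler_pdivlMr ?vball_gt0// mul1r.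
Qed.

Local Open Scope ereal_scope.

(** After Tonelli, [g y] carries the integral of [1/nu(B(x,r))] over [x] in [B(y,s)], where
    [s = 2^n r]. There [B(y,s)] lies in [B(x,2s)], so [n + 1] doublings bound the weight. *)
Lemma integral_ball_average n r (g : Z -> \bar R) : (0 < r)%R ->
  measurable_fun setT g -> (forall x, 0 <= g x) ->
  \int[nu]_x ((vball nu x r)^-1%:E * \int[nu]_(y in ball x (2 ^+ n * r)) g y) <=
  (Cd ^+ n.+1)%:E * \int[nu]_x g x.
Proof.
move=> r0 mg g0; set s := (2 ^+ n * r)%R.
have s0 : (0 < s)%R by rewrite mulr_gt0// exprn_gt0.
have mV : measurable_fun setT (fun x => (vball nu x r)^-1%:E).
  apply/measurable_EFinP; under eq_fun do rewrite -powR_inv1 ?vball_ge0//.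
  by apply: (measurableT_comp (measurable_powR _)); exact: measurable_vball.
have mk : measurable_fun setT
    (fun xy : Z * Z => (vball nu xy.1 r)^-1%:E * g xy.2).
  by apply: emeasurable_funM; [exact: (measurableT_comp mV)|
    exact: (measurableT_comp mg)].
have k0 (xy : Z * Z) : 0 <= (vball nu xy.1 r)^-1%:E * g xy.2.
  by rewrite mule_ge0// lee_fin invr_ge0 vball_ge0.
rewrite (_ : (fun x => _) =
    fun x => \int[nu]_(y in ball x s) ((vball nu x r)^-1%:E * g y)); last first.
  apply/funext => x; rewrite ge0_integralZl//.
  - exact: (measurable_ballm hZ).
  - exact: measurable_funS mg.
  - by rewrite lee_fin invr_ge0 vball_ge0.
rewrite (tonelli_ball mk k0)/= -ge0_integralZl//; last first.
  by rewrite lee_fin exprn_ge0// (le_trans _ Cd1).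
apply: ge0_le_integral_nomeas => y _; first by apply: integral_ge0 => x _; exact: k0 (x, y).
rewrite ge0_integralZr//; last 3 first.
- exact: (measurable_ballm hZ).
- exact: measurable_funS mV.
- by move=> x _; rewrite lee_fin invr_ge0 vball_ge0.
rewrite lee_pmul//.
  by apply: integral_ge0 => x _; rewrite lee_fin invr_ge0 vball_ge0.
apply: (@le_trans _ _ (\int[nu]_(x in ball y s) (Cd ^+ n.+1 * (vball nu y s)^-1)%:E)).
  apply: ge0_le_integral_nomeas => x yx; rewrite lee_fin ?invr_ge0 ?vball_ge0//.
  apply: inv_vball_comparable => //; rewrite exprS -mulrA -/s mulr_natl mulr2n lerD2r.
  by rewrite metric_sym ltW//; apply/ball_mdist.
rewrite integral_cst ?(nu_ballE hZ)//; last exact: (measurable_ballm hZ).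
by rewrite -EFinM -mulrA mulVf ?mulr1// gt_eqF// vball_gt0.
Qed.

End ball_kernel.

(** * Power and geometric sums *)

Section powR_inequalities.
Context {R : realType}.
Implicit Types p t a b : R.

(** Each [x j] is at most the [l^p] size of the whole family; this replaces Hölder's inequality and
    allows every [p > 0]. *)
Lemma powR_sum_weights p W n (w x : nat -> R) : 0 < p ->
  (forall j, 0 <= w j) -> (forall j, 0 <= x j) -> \sum_(0 <= j < n) w j <= W ->
  (\sum_(0 <= j < n) w j * x j) `^ p <= W `^ p * \sum_(0 <= j < n) (x j) `^ p.
Proof.
move=> p0 w0 x0 wW; set T := \sum_(0 <= j < n) (x j) `^ p.
have T0 : 0 <= T by apply: sumr_ge0 => j _; exact: powR_ge0.
have W0 : 0 <= W by apply: le_trans wW; exact: sumr_ge0.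
have TE : (T `^ p^-1) `^ p = T by rewrite -powRrM mulVf ?powRr1// gt_eqF.
rewrite -[in leRHS]TE -powRM ?powR_ge0//.
apply: ge0_ler_powR; rewrite ?nnegrE ?mulr_ge0 ?powR_ge0//; first exact: ltW.
  by apply: sumr_ge0 => j _; exact: mulr_ge0.
apply: le_trans (ler_wpM2r (powR_ge0 _ _) wW).
rewrite mulr_suml big_nat [leRHS]big_nat; apply: ler_sum => j /andP[_ jn].
apply: ler_wpM2l => //.
rewrite -[leLHS](_ : (x j `^ p) `^ p^-1 = _); last first.
  by rewrite -powRrM mulfV ?powRr1// gt_eqF.
apply: ge0_ler_powR; rewrite ?nnegrE ?powR_ge0 ?invr_ge0//; first exact: ltW.
rewrite /T (bigD1_seq j) ?iota_uniq ?mem_index_iota//= lerDl.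
by apply: sumr_ge0 => i _; exact: powR_ge0.
Qed.

Lemma powRD_le p a b : 0 < p -> 0 <= a -> 0 <= b ->
  (a + b) `^ p <= 2 `^ p * (a `^ p + b `^ p).
Proof.
move=> p0 a0 b0.
have := @powR_sum_weights p 2 2 (fun=> 1) (fun j => if j is 0%N then a else b) p0.
rewrite !big_nat_recr//= !big_geq// !add0r !mul1r; apply => //.
by case.
Qed.

(** For [t > a] the factor [(t/a)^(p-1)] is at least 1. Integrating this and then choosing [a]
    bounds a mean by a [p]-mean up to a factor 2, in place of Jensen's inequality. *)
Lemma ler_add_powR p t a : 1 <= p -> 0 <= t -> 0 < a ->
  t <= a + a `^ (1 - p) * t `^ p.
Proof.
move=> p1 t0 a0; have [ta|/ltW at_] := leP t a.
  by rewrite (le_trans ta)// lerDl mulr_ge0 ?powR_ge0.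
apply: (@le_trans _ _ (a `^ (1 - p) * t `^ p)); last by rewrite lerDr ltW.
have t_gt0 : 0 < t by exact: lt_le_trans at_.
rewrite (_ : a `^ (1 - p) = (a `^ (p - 1))^-1); last first.
  by rewrite -powRN opprB.
rewrite mulrC ler_pdivlMr ?powR_gt0//.
rewrite [leRHS](_ : _ = t * t `^ (p - 1)); last first.
  by rewrite -mulr_powRB1// (lt_le_trans _ p1).
rewrite ler_wpM2l//.
by apply: ge0_ler_powR; rewrite ?nnegrE ?subr_ge0// ltW.
Qed.

End powR_inequalities.

Section geometric_sums.
Context {R : realType}.
Implicit Types s t r a : R.

Lemma sum_geometric_le (q : R) n : 0 < q < 1 ->
  \sum_(0 <= j < n) q ^+ j <= (1 - q)^-1.
Proof.
move=> /andP[q0 q1]; have q10 : 0 < 1 - q by rewrite subr_gt0.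
rewrite -[leRHS]mul1r ler_pdivlMr//.
suff -> : (\sum_(0 <= j < n) q ^+ j) * (1 - q) = 1 - q ^+ n.
  by rewrite gerBl exprn_ge0// ltW.
elim: n => [|n IH]; first by rewrite big_geq// mul0r expr0 subrr.
by rewrite big_nat_recr//= mulrDl IH exprSr; ring.
Qed.

Lemma powR1E s : 1 `^ s = 1 :> R.
Proof. by rewrite powR1. Qed.

Lemma powR_le1 t s : 0 <= s -> 0 <= t <= 1 -> t `^ s <= 1.
Proof.
move=> s0 /andP[t0 t1]; rewrite -[leRHS](powR1E s).
by apply: ge0_ler_powR; rewrite ?nnegrE.
Qed.

Lemma powR_ge1 t s : 0 <= s -> 1 <= t -> 1 <= t `^ s.
Proof.
move=> s0 t1; rewrite -[leLHS](powR1E s).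
by apply: ge0_ler_powR; rewrite ?nnegrE// (le_trans _ t1).
Qed.

Lemma powR_inv t s : 0 < t -> (t^-1) `^ s = (t `^ s)^-1.
Proof. by move=> t0; rewrite -powR_inv1 ?ltW// -powRrM mulN1r powRN. Qed.

Lemma powR2_gt1 s : 0 < s -> 1 < 2 `^ s :> R.
Proof.
move=> s0; rewrite -[ltLHS](powR1E s).
by apply: gt0_ltr_powR; rewrite ?nnegrE// ltr1n.
Qed.

Lemma sum_min_geometric s : 0 < s ->
  exists2 C : R, 0 <= C & forall n t, 0 < t ->
    \sum_(0 <= j < n) (Num.min (2 ^+ j * t) (2 ^+ j * t)^-1) `^ s <= C.
Proof.
move=> s0; pose q : R := 2 `^ s; have q1 : 1 < q := powR2_gt1 s0.
have q0 : 0 < q by exact: lt_trans q1.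
pose F n t := \sum_(0 <= j < n) (Num.min (2 ^+ j * t) (2 ^+ j * t)^-1) `^ s.
have FS n t : F n.+1 t = (Num.min t t^-1) `^ s + F n (2 * t).
  rewrite /F big_nat_recl//= expr0 mul1r; congr (_ + _).
  by apply: eq_bigr => j _; rewrite exprSr mulrA.
pose D := (1 - q^-1)^-1; pose B := (q - 1)^-1.
have q11 : 0 < 1 - q^-1 by rewrite subr_gt0 invf_lt1.
have D0 : 0 < D by rewrite invr_gt0.
have B0 : 0 < B by rewrite invr_gt0 subr_gt0.
have DE : 1 + D * q^-1 = D.
  have : D * (1 - q^-1) = 1 by rewrite mulVf// gt_eqF.
  by rewrite mulrBr mulr1 => <-; rewrite subrK.
have BE : 1 + B = B * q.
  have : B * (q - 1) = 1 by rewrite mulVf// subr_eq0 gt_eqF.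
  by rewrite mulrBr mulr1 => <-; rewrite subrK.
clearbody D B.
have F1 n t : 1 <= t -> F n t <= D * (t `^ s)^-1.
  elim: n t => [|n IH] t t1.
    by rewrite /F big_geq// mulr_ge0 ?invr_ge0 ?powR_ge0 ?ltW.
  have t0 : 0 < t by exact: lt_le_trans t1.
  rewrite FS min_r; last by rewrite (le_trans _ t1)// invf_le1.
  rewrite powR_inv// -[in leRHS]DE [leRHS]mulrDl [X in _ <= X + _]mul1r lerD2l.
  apply: le_trans (IH _ _) _; first by lra.
  by rewrite powRM ?(ltW t0)// invfM mulrA.
(* The subtracted multiple of [t^s] closes the induction: replacing [t] by [2 t] lowers the bound by
   exactly the new summand, since [B q = B + 1]. *)
have F2 n t : 0 < t <= 1 -> F n t <= 1 + D + B - B * t `^ s.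
  elim: n t => [|n IH] t /andP[t0 t1].
    rewrite /F big_geq// subr_ge0 (le_trans (_ : _ <= B))//; last by rewrite lerDr addr_ge0// ltW.
    by rewrite ler_piMr ?(ltW B0)// powR_le1 ?(ltW s0) ?(ltW t0).
  have ts1 : t `^ s <= 1 by rewrite powR_le1 ?(ltW s0) ?(ltW t0).
  rewrite FS min_l; last by rewrite (le_trans t1)// invf_ge1.
  have [t2|t2] := leP (2 * t) 1.
    have := IH (2 * t); rewrite t2 mulr_gt0// => /(_ isT).
    rewrite powRM ?(ltW t0)// -/q mulrA -BE.
    by move: (F n (2 * t)) (t `^ s) => G a; lra.
  have := F1 n (2 * t) (ltW t2) => H.
  have : F n (2 * t) <= D.
    apply: (le_trans H); rewrite ler_piMr ?(ltW D0)// invf_le1 ?powR_gt0 ?mulr_gt0//.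
    by rewrite powR_ge1 ?(ltW s0) ?(ltW t2).
  have : B * t `^ s <= B by rewrite ler_piMr// ltW.
  move: ts1; move: (F n (2 * t)) (t `^ s) => G a; lra.
exists (1 + D + B); first by rewrite !addr_ge0// ltW.
move=> n t t0; rewrite -/(F n t); have [t1|/ltW t1] := leP t 1.
  apply: (le_trans (F2 _ _ _)); first by rewrite t0.
  by rewrite gerBl mulr_ge0 ?powR_ge0// ltW.
apply: (le_trans (F1 _ _ t1)).
apply: (@le_trans _ _ D); last by rewrite -addrA addrCA lerDl addr_ge0// ltW.
rewrite ler_piMr ?(ltW D0)// invf_le1 ?powR_gt0//.
by rewrite powR_ge1 ?(ltW s0).
Qed.

(** The sum is dominated by its smallest scale, which still exceeds [t]. *)
Lemma sum_geometric_above s : 0 < s ->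
  exists2 C : R, 0 <= C & forall n r t, 0 < r -> 0 < t ->
    \sum_(0 <= j < n) (if t < 2 ^- j * r then (2 ^- j * r) `^ (- s) else 0)
    <= C * t `^ (- s).
Proof.
move=> s0; pose q : R := 2 `^ s; have q1 : 1 < q := powR2_gt1 s0.
have q0 : 0 < q by exact: lt_trans q1.
pose F n r t := \sum_(0 <= j < n)
  (if t < 2 ^- j * r then (2 ^- j * r) `^ (- s) else 0).
have FS n r t : F n.+1 r t = (if t < r then r `^ (- s) else 0) + F n (2^-1 * r) t.
  rewrite /F big_nat_recl//= expr0 invr1 mul1r; congr (_ + _).
  by apply: eq_bigr => j _; rewrite exprSr invfM (mulrC _ 2^-1) mulrCA !mulrA.
have F0 n r t : 0 < r -> r <= t -> F n r t = 0.
  elim: n r => [|n IH] r r0 rt; first by rewrite /F big_geq.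
  rewrite FS ltNge rt/= IH ?addr0 ?mulr_gt0// (le_trans _ rt)//.
  by rewrite ler_piMl ?(ltW r0)// invf_le1// ler1n.
pose B := (q - 1)^-1.
have B0 : 0 < B by rewrite invr_gt0 subr_gt0.
have BE : 1 + B = B * q.
  have : B * (q - 1) = 1 by rewrite mulVf// subr_eq0 gt_eqF.
  by rewrite mulrBr mulr1 => <-; rewrite subrK.
clearbody B.
have rt_pow a t : 0 < t -> t < a -> a `^ (- s) <= t `^ (- s).
  move=> t0 tr; have a0 : 0 < a by exact: lt_trans tr.
  rewrite !powRN lef_pV2 ?posrE ?powR_gt0//.
  by apply: ge0_ler_powR; rewrite ?nnegrE ?(ltW s0) ?(ltW t0) ?(ltW a0) ?(ltW tr).
(* Here the subtracted term pays for the summand of scale [r] when [r] is halved. *)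
have F1 n r t : 0 < t -> t < r -> F n r t <= (1 + B) * t `^ (- s) - B * r `^ (- s).
  move=> t0; elim: n r => [|n IH] r tr.
    rewrite /F big_geq// subr_ge0; have := rt_pow _ _ t0 tr.
    have := powR_ge0 t (- s); have := powR_ge0 r (- s).
    by set a := r `^ _; set b := t `^ _; nra.
  rewrite FS tr; have [tr2|tr2] := ltP t (2^-1 * r).
    have := IH _ tr2; rewrite powRM ?(ltW (lt_trans t0 tr))//.
    rewrite (powR_inv (- s)) ?powRN ?invrK//.
    rewrite -/q mulrA -BE.
    by move: (F n (2^-1 * r) t) (r `^ s)^-1 (t `^ s)^-1 => G a b; lra.
  have r0 : 0 < r by exact: lt_trans tr.
  rewrite (F0 _ (2^-1 * r)) ?mulr_gt0// addr0.
  have := rt_pow _ _ t0 tr; have := powR_ge0 t (- s); have := powR_ge0 r (- s).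
  by set a := r `^ _; set b := t `^ _; nra.
exists (1 + B); first by rewrite addr_ge0// ltW.
move=> n r t r0 t0; rewrite -/(F n r t).
have [rt|tr] := leP r t; first by rewrite F0// mulr_ge0 ?powR_ge0// addr_ge0// ltW.
by rewrite (le_trans (F1 _ _ _ t0 tr))// gerBl mulr_ge0 ?powR_ge0// ltW.
Qed.

Lemma dyadic_between a : 1 <= a -> exists n, 2 ^+ n <= a < 2 ^+ n.+1.
Proof.
move=> a1.
have [N Na] : exists N, a < 2 ^+ N.
  exists (Num.bound a); rewrite (lt_le_trans (archi_boundP _))// ?(le_trans _ a1)//.
  by rewrite -natrX ler_nat ltnW// ltn_expl.
have ex : exists n, a < 2 ^+ n by exists N.
case: (ex_minnP ex) => -[|n] an H; first by rewrite expr0 ltNge a1 in an.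
exists n; rewrite an andbT leNgt; apply/negP => /H; by rewrite ltnn.
Qed.

End geometric_sums.

(** * Oscillations and averages *)

Section oscillation.
Context (R : realType) (d : measure_display) (Z : metricMeasurableType R d).
Variable nu : {measure set Z -> \bar R}.
Implicit Types (w x y z : Z) (r s : R).
Hypothesis hZ : metric_measure_space nu.
Variables (p : R) (u : Z -> R).
Hypotheses (p1 : 1 <= p) (mu : measurable_fun setT u).

Definition osc r y : \bar R :=
  ((vball nu y r)^-1%:E * \int[nu]_(z in ball y r) (`|u y - u z| `^ p)%:E)%E.

Definition avg r y : R :=
  (vball nu y r)^-1 * fine (\int[nu]_(z in ball y r) (u z)%:E)%E.

Lemma osc_ge0 r y : (0 <= osc r y)%E.
Proof.
apply: mule_ge0; first by rewrite lee_fin invr_ge0 vball_ge0.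
by apply: integral_ge0 => z _; rewrite lee_fin powR_ge0.
Qed.

Lemma measurable_vballV r : measurable_fun setT (fun x => (vball nu x r)^-1).
Proof.
under eq_fun do rewrite -powR_inv1 ?vball_ge0//.
by apply: (measurableT_comp (measurable_powR _)); exact: (measurable_vball hZ).
Qed.

Lemma measurable_osc r : measurable_fun setT (osc r).
Proof.
apply: emeasurable_funM.
  exact/measurable_EFinP/measurable_vballV.
apply: (measurable_ball_int hZ (g := fun yz => (`|u yz.1 - u yz.2| `^ p)%:E)).
  apply/measurable_EFinP; apply: (measurableT_comp (measurable_powR _)).
  apply: (measurableT_comp (@normr_measurable R setT)).
  by apply: measurable_funB; [exact: (measurableT_comp mu)|exact: (measurableT_comp mu)].
by move=> yz; rewrite lee_fin powR_ge0.
Qed.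

Lemma measurable_avg r : measurable_fun setT (avg r).
Proof.
apply: measurable_funM; first exact: measurable_vballV.
apply: (measurableT_comp (@fine_measurable R setT _)) => //.
under eq_fun do rewrite integralE.
have mE : measurable_fun setT (fun z => (u z)%:E) by exact/measurable_EFinP.
apply: emeasurable_funB.
- apply: (measurable_ball_int hZ (g := fun yz : Z * Z => ((fun z => (u z)%:E)^\+ yz.2)%E)) => //.
  exact: (measurableT_comp (measurable_funepos mE) measurable_snd).
- apply: (measurable_ball_int hZ (g := fun yz : Z * Z => ((fun z => (u z)%:E)^\- yz.2)%E)) => //.
  exact: (measurableT_comp (measurable_funeneg mE) measurable_snd).
Qed.

Hypothesis Lp : forall z r, (\int[nu]_(x in ball z r) (`|u x| `^ p)%:E < +oo)%E.

Lemma integrable_ball y r : 0 < r -> nu.-integrable (ball y r) (EFin \o u).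
Proof.
move=> r0; apply/integrableP; split.
  by apply/measurable_EFinP; exact: measurable_funS mu.
apply: (@le_lt_trans _ _
    (\int[nu]_(x in ball y r) (1%:E + (`|u x| `^ p)%:E))%E).
  apply: ge0_le_integral_nomeas => // x _ /=; rewrite -EFinD lee_fin.
  have := ler_add_powR p1 (normr_ge0 (u x)) ltr01.
  by rewrite (powR1E (1 - p)) mul1r.
have mB := measurable_ballm hZ y r.
rewrite ge0_integralD//=.
- by rewrite integral_cst// mul1e (nu_ballE hZ)// lte_add_pinfty ?ltry.
- apply/measurable_EFinP; apply: (measurableT_comp (measurable_powR _)).
  apply: (measurableT_comp (@normr_measurable R setT)).
  exact: measurable_funS mu.
Qed.

Lemma avg_subr_le y r c : 0 < r ->
  ((`|avg r y - c|)%:E <=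
   (vball nu y r)^-1%:E * \int[nu]_(z in ball y r) (`|c - u z|)%:E)%E.
Proof.
move=> r0; have iu := integrable_ball y r0.
have mB := measurable_ballm hZ y r.
have V0 := vball_gt0 hZ y r0.
have ic : nu.-integrable (ball y r) (EFin \o cst c).
  apply/integrableP; split; first exact/measurable_EFinP.
  by rewrite /= integral_cst// (nu_ballE hZ)// ltry.
have E : (avg r y - c)%:E =
    ((vball nu y r)^-1%:E * \int[nu]_(z in ball y r) ((u z)%:E - c%:E))%E.
  rewrite (integralB_EFin mB iu ic)/= (integral_cst nu mB c%:E) (nu_ballE hZ)// /avg EFinB.
  have := integrable_fin_num mB iu => ufin.
  rewrite -{2}(fineK ufin). rewrite -EFinM -!EFinB mulrBr; congr (_ - _)%:E.
  by rewrite mulrCA mulVf ?mulr1// gt_eqF.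
rewrite -[leLHS]/(`|(avg r y - c)%:E|)%E E abseM gee0_abs; last first.
  by rewrite lee_fin invr_ge0 vball_ge0.
rewrite lee_pmul2l ?lte_fin ?invr_gt0//.
apply: (le_trans (le_abse_integral nu mB _)).
  by apply/measurable_EFinP/measurable_funB => //; exact: measurable_funS mu.
by apply: ge0_le_integral_nomeas => // z _; rewrite -EFinB abse_EFin distrC.
Qed.

Lemma avg_osc_le y z r s C : 0 < r -> mdist z y + r <= s ->
  0 <= C -> vball nu z s <= C * vball nu y r ->
  ((`|avg r y - u z| `^ p)%:E <= (2 `^ p * C)%:E * osc s z)%E.
Proof.
move=> r0 zs C0 VC; have p0 : 0 < p by exact: lt_le_trans p1.
have s0 : 0 < s by rewrite (lt_le_trans _ zs)// ltr_wpDl// mdist_ge0.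
have Vr := vball_gt0 hZ y r0; have Vs := vball_gt0 hZ z s0.
have mB := measurable_ballm hZ y r.
have mf : measurable_fun setT (fun x => `|u z - u x|).
  by apply: (measurableT_comp (@normr_measurable R setT)); exact: measurable_funB.
(* A truncation level [l] contributes [l] to the mean, and the excess over [l] contributes at most
   [l] once [l^p] is at least [C * osc s z]. The best level is the [p]-th root of that quantity. *)
have key l : 0 < l -> (C%:E * osc s z <= (l `^ p)%:E)%E -> `|avg r y - u z| <= 2 * l.
  move=> l0 Cl; rewrite -lee_fin.
  apply: (le_trans (avg_subr_le _ _ r0)).
  apply: (@le_trans _ _ ((vball nu y r)^-1%:E * (l%:E * (vball nu y r)%:E +
     (l `^ (1 - p))%:E * ((vball nu z s)%:E * osc s z)))%E).
    rewrite lee_pmul2l ?lte_fin ?invr_gt0//.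
    apply: (@le_trans _ _ (\int[nu]_(x in ball y r)
       (l%:E + (l `^ (1 - p) * `|u z - u x| `^ p)%:E))%E).
      apply: ge0_le_integral_nomeas => x _; rewrite ?lee_fin//.
      exact: ler_add_powR.
    have mh : measurable_fun (ball y r) (fun x => (`|u z - u x| `^ p)%:E).
      apply/measurable_EFinP; apply: (measurableT_comp (measurable_powR _)).
      exact: measurable_funS mf.
    rewrite ge0_integralD//=; last 3 first.
    - by move=> x _; rewrite lee_fin ltW.
    - by move=> x _; rewrite lee_fin mulr_ge0 ?powR_ge0.
    - by under eq_fun do rewrite EFinM; exact: measurable_funeM.
    rewrite integral_cst// (nu_ballE hZ)// leeD2l//.
    under eq_integral do rewrite EFinM.
    rewrite ge0_integralZl ?lee_fin ?powR_ge0//.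
    rewrite lee_pmul2l ?lte_fin ?powR_gt0// /osc muleA -EFinM mulfV ?gt_eqF// mul1e.
    apply: ge0_subset_integral => //.
    - exact: (measurable_ballm hZ).
    - apply/measurable_EFinP; apply: (measurableT_comp (measurable_powR _)).
      exact: measurable_funS mf.
    - exact: subset_metric_ball.
  have X0 : (0 <= (l `^ (1 - p))%:E * ((vball nu z s)%:E * osc s z))%E.
    apply: mule_ge0; first exact: powR_ge0.
    by apply: mule_ge0; [exact: vball_ge0|exact: osc_ge0].
  rewrite ge0_muleDr//; last by rewrite -EFinM lee_fin mulr_ge0 ?vball_ge0 ?(ltW l0).
  rewrite -!EFinM mulrCA mulVf ?gt_eqF// mulr1 mulr_natl mulr2n EFinD leeD2l//.
  rewrite muleCA muleA -EFinM.
  apply: (@le_trans _ _ ((l `^ (1 - p))%:E * (C%:E * osc s z))%E).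
    rewrite EFinM -muleA lee_pmul2l ?lte_fin ?powR_gt0// muleA -EFinM.
    apply: lee_wpmul2r; first exact: osc_ge0.
    by rewrite lee_fin mulrC ler_pdivrMr.
  apply: (@le_trans _ _ ((l `^ (1 - p))%:E * (l `^ p)%:E)%E).
    by rewrite lee_pmul2l ?lte_fin ?powR_gt0.
  by rewrite -EFinM lee_fin -powRD ?subrK ?powRr1 ?(ltW l0)// (gt_eqF l0) implybT.
have O0 := osc_ge0 s z.
have CO0 : (0 <= C%:E * osc s z)%E by rewrite mule_ge0.
case E : (C%:E * osc s z)%E CO0 => [a| |] // a0; last first.
  by rewrite EFinM -muleA E mulry gtr0_sg ?powR_gt0// mul1e leey.
rewrite EFinM -muleA E -EFinM lee_fin.
move: a0; rewrite lee_fin => a0.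
rewrite [leRHS](_ : _ = (2 * a `^ p^-1) `^ p); last first.
  by rewrite powRM ?powR_ge0// -powRrM mulVf ?gt_eqF// powRr1.
apply: ge0_ler_powR; rewrite ?nnegrE ?mulr_ge0 ?powR_ge0// ?(ltW p0)//.
have [a_gt0|] := ltP 0 a.
  apply: key; rewrite ?powR_gt0// E lee_fin -powRrM mulVf ?gt_eqF// powRr1//.
(* A vanishing oscillation admits every positive level, and the level tends to 0. *)
move=> a_le0; have a00 : a = 0 by apply/eqP; rewrite eq_le a_le0.
rewrite a00 powR0 ?mulr0 ?invr_neq0 ?gt_eqF//.
apply/ler_addgt0Pl => e e0; rewrite addr0.
have := key (e / 2); rewrite divr_gt0// E a00 lee_fin powR_ge0 => /(_ isT isT).
by rewrite mulrC divfK.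
Qed.

Lemma const_le_ball_int x r K c (g : Z -> \bar R) : 0 < r -> 0 <= c -> 0 < K ->
  measurable_fun setT g -> (forall z, 0 <= g z)%E ->
  (forall z, ball x r z -> (c%:E <= K%:E * g z)%E) ->
  ((c * vball nu x r)%:E <= K%:E * \int[nu]_(z in ball x r) g z)%E.
Proof.
move=> r0 c0 K0 mg g0 cg; have mB := measurable_ballm hZ x r.
rewrite EFinM -(nu_ballE hZ)// -integral_cst// -ge0_integralZl//.
- exact: ge0_le_integral_nomeas.
- exact: measurable_funS mg.
- by rewrite lee_fin ltW.
Qed.

Lemma avg_osc_center y r : 0 < r ->
  ((`|avg r y - u y| `^ p)%:E <= (2 `^ p)%:E * osc r y)%E.
Proof.
by move=> r0; rewrite -[2 `^ p]mulr1; apply: avg_osc_le; rewrite ?mdistxx ?add0r ?mul1r.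
Qed.

(** Both averages are compared with [u z] for every [z] in [B(x,r)], and the resulting bound is
    integrated in [z]; an integral of [osc] thus plays the part of a Poincaré inequality. *)
Lemma avg_compare x w1 w2 s1 s2 r (C : R) : 0 < r -> 0 < s1 -> 0 < s2 -> 0 < C ->
  (forall z, ball x r z -> [/\ mdist z w1 + s1 <= 4 * r,
    vball nu z (4 * r) <= C * vball nu w1 s1,
    mdist z w2 + s2 <= 4 * r & vball nu z (4 * r) <= C * vball nu w2 s2]) ->
  ((`|avg s1 w1 - avg s2 w2| `^ p * vball nu x r)%:E <=
    (2 * 2 `^ p * (2 `^ p * C))%:E * \int[nu]_(z in ball x r) osc (4 * r) z)%E.
Proof.
move=> r0 s10 s20 C0 H; have p0 : 0 < p by exact: lt_le_trans p1.
apply: const_le_ball_int => //.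
- by rewrite !mulr_gt0// powR_gt0.
- exact: measurable_osc.
- by move=> z; exact: osc_ge0.
move=> z /H[h1 v1 h2 v2].
have := avg_osc_le s10 h1 (ltW C0) v1; have := avg_osc_le s20 h2 (ltW C0) v2.
set a := avg s1 w1; set b := avg s2 w2 => B1 B2.
apply: (@le_trans _ _ (2 `^ p * (`|a - u z| `^ p + `|b - u z| `^ p))%:E).
  rewrite lee_fin; apply: (le_trans _ (powRD_le p0 (normr_ge0 _) (normr_ge0 _))).
  apply: ge0_ler_powR; rewrite ?nnegrE ?addr_ge0 ?(ltW p0)//.
  by rewrite (distrC b) (le_trans _ (ler_normD _ _))// addrA subrK.
rewrite EFinM EFinD.
apply: (@le_trans _ _ ((2 `^ p)%:E * ((2 `^ p * C)%:E * osc (4 * r) z +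
  (2 `^ p * C)%:E * osc (4 * r) z))%E).
  apply: lee_wpmul2l; first by rewrite lee_fin powR_ge0.
  by apply: leeD; [exact: B2|exact: B1].
have A0 : 0 <= 2 `^ p * C by rewrite mulr_ge0 ?powR_ge0 ?(ltW C0).
rewrite -ge0_muleDl; [|exact: A0|exact: A0]; rewrite muleA -EFinD -EFinM.
by rewrite -mulr2n -(mulr_natl (_ * C)) mulrCA mulrA.
Qed.

End oscillation.

Lemma nneseries_le_ub {R : realType} (f : nat -> \bar R) (M : \bar R) :
  (forall j, 0 <= f j)%E -> (forall n, \sum_(0 <= j < n) f j <= M)%E ->
  (\sum_(0 <= j <oo) f j <= M)%E.
Proof.
move=> f0 fM; apply: lime_le; first by apply: is_cvg_nneseries => j _ _; exact: f0.
by apply: nearW => n; exact: fM.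
Qed.

(** * Oscillation sums and the Besov energy *)

Section besov_energy.
Context (R : realType) (d : measure_display) (Z : metricMeasurableType R d).
Variable nu : {measure set Z -> \bar R}.
Implicit Types (w x y z : Z) (r s : R).
Hypothesis hZ : metric_measure_space nu.
Variable Cd : R.
Hypotheses (Cd1 : 1 <= Cd)
  (hCd : forall x r, 0 < r -> vball nu x (2 * r) <= Cd * vball nu x r).
Variables (p theta : R) (u : Z -> R).
Hypotheses (p1 : 1 <= p) (theta0 : 0 < theta) (mu : measurable_fun setT u).

Definition besov_slice y : \bar R :=
  (\int[nu]_x ((`|u x - u y| `^ p / mdist x y `^ (p * theta))%:E
        / nu (ball x (mdist x y))))%E.

Definition osc_sum r y : \bar R := (\sum_(0 <= j <oo)
   ((2 ^- j * r) `^ (- (p * theta)))%:E * osc nu p u (2 ^- j * r) y)%E.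

(** For fixed [x] and [y] only the scales above [d(x,y)] contribute, and their factors add up to a
    multiple of [d(x,y)^(-p theta)]. Doubling trades [1/nu(B(y,s))] for a multiple of
    [1/nu(B(x,d(x,y)))] at these scales. *)
Lemma osc_sum_le : exists2 C : R, 0 < C & forall r y, 0 < r ->
  (osc_sum r y <= C%:E * besov_slice y)%E.
Proof.
have p0 : 0 < p by exact: lt_le_trans p1.
have Cd0 : 0 < Cd by exact: lt_le_trans Cd1.
have s0 : 0 < p * theta by rewrite mulr_gt0.
have [C C0 HC] := @sum_geometric_above R _ s0.
exists ((C + 1) * Cd); first by rewrite mulr_gt0// ltr_wpDl.
move=> r y r0; pose K := (C + 1) * Cd.
have K0 : 0 < K by rewrite mulr_gt0// ltr_wpDl.
have rj0 j : 0 < 2 ^- j * r by rewrite mulr_gt0// invr_gt0 exprn_gt0.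
pose c j := (2 ^- j * r) `^ (- (p * theta)) * (vball nu y (2 ^- j * r))^-1.
have c0 j : 0 <= c j by rewrite mulr_ge0 ?powR_ge0// invr_ge0 vball_ge0.
pose f j : Z -> \bar R :=
  (fun x => (c j * `|u y - u x| `^ p)%:E) \_ (ball y (2 ^- j * r)).
have mB j : measurable (ball y (2 ^- j * r)) by exact: (measurable_ballm hZ).
have mdiff : measurable_fun setT (fun x => `|u y - u x| `^ p).
  apply: (measurableT_comp (measurable_powR _)).
  by apply: (measurableT_comp (@normr_measurable R setT)); exact: measurable_funB.
have f0 j x : (0 <= f j x)%E.
  by rewrite /f patchE; case: ifP => // _; rewrite lee_fin mulr_ge0 ?powR_ge0.
have mf j : measurable_fun setT (f j).
  apply/(measurable_restrictT (fun x => (c j * `|u y - u x| `^ p)%:E)) => //.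
  by apply/measurable_EFinP/measurable_funM => //; exact: measurable_funS mdiff.
have -> : osc_sum r y = (\int[nu]_x \sum_(0 <= j <oo) f j x)%E.
  rewrite integral_nneseries//; apply: eq_eseriesr => j _.
  rewrite -integral_mkcond; under eq_integral do rewrite EFinM.
  rewrite ge0_integralZl// ?lee_fin//; first by rewrite /osc muleA -EFinM.
  by apply/measurable_EFinP; exact: measurable_funS mdiff.
rewrite -lee_pdivrMl// -ge0_integralZl//; last 3 first.
- exact: ge0_emeasurable_sum.
- by move=> x _; exact: nneseries_ge0.
- by rewrite lee_fin invr_ge0 ltW.
apply: ge0_le_integral_nomeas => x _.
  by rewrite mule_ge0// ?lee_fin ?invr_ge0 ?(ltW K0)//; exact: nneseries_ge0.
rewrite lee_pdivrMl//; apply: nneseries_le_ub => // n.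
have [xy|xy] := eqVneq x y.
  rewrite big1; last first.
    move=> j _; rewrite /f patchE; case: ifP => // _.
    by rewrite xy subrr normr0 powR0 ?mulr0// gt_eqF.
  rewrite mule_ge0 ?lee_fin ?(ltW K0)//.
  by rewrite mule_ge0 ?lee_fin ?divr_ge0 ?powR_ge0// inve_ge0.
have d0 : 0 < mdist x y by rewrite mdist_gt0.
have Vd := vball_gt0 hZ x d0.
rewrite (nu_ballE hZ)// inver (gt_eqF Vd) -!EFinM.
pose b j := if mdist x y < 2 ^- j * r then (2 ^- j * r) `^ (- (p * theta)) else 0.
apply: (@le_trans _ _ (\sum_(0 <= j < n)
    (b j * (Cd * (vball nu x (mdist x y))^-1 * `|u y - u x| `^ p))%:E)%E).
  apply: lee_sum => j _; rewrite /f patchE /b; case: ifPn => [|xB].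
    rewrite inE => /ball_mdist; rewrite metric_sym => dj; rewrite dj lee_fin /c.
    rewrite -!mulrA ler_wpM2l ?powR_ge0// mulrA ler_wpM2r ?powR_ge0//.
    rewrite -(expr1 Cd); apply: (inv_vball_comparable hZ Cd1 hCd) => //.
    by rewrite (metric_sym y) expr1 mulr_natl [leRHS]mulr2n lerD// ltW.
  rewrite lee_fin; apply: mulr_ge0; first by case: ifP => // _; exact: powR_ge0.
  by rewrite !mulr_ge0 ?powR_ge0 ?(ltW Cd0)// invr_ge0 vball_ge0.
rewrite sumEFin lee_fin -mulr_suml.
apply: (@le_trans _ _ (((C + 1) * mdist x y `^ (- (p * theta))) *
   (Cd * (vball nu x (mdist x y))^-1 * `|u y - u x| `^ p))).
  rewrite ler_wpM2r//.
    by rewrite !mulr_ge0 ?powR_ge0 ?(ltW Cd0)// invr_ge0 vball_ge0.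
  apply: (le_trans (HC n r (mdist x y) r0 d0)).
  by rewrite ler_wpM2r ?powR_ge0// lerDl.
rewrite powRN distrC /K.
set a := `|_| `^ p; set e := (_ `^ _)^-1; set v := (vball _ _ _)^-1.
by rewrite le_eqVlt; apply/orP; left; apply/eqP; ring.
Qed.

End besov_energy.

(** * Sobolev inequality on balls *)

Section sobolev_exponent.
Context (R : realType).
Variables (p theta Q : R).
Hypotheses (p1 : 1 <= p) (theta0 : 0 < theta) (Q0 : 0 < Q) (pQ : p * theta < Q).

Let p0 : 0 < p. Proof. exact: lt_le_trans p1. Qed.

Lemma sobolev_exponent_gt0 : 0 < Q * p / (Q - p * theta).
Proof. by rewrite divr_gt0 ?mulr_gt0// subr_gt0. Qed.

Let beta_gt0 : 0 < Q / p - theta.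
Proof. by rewrite subr_gt0 ltr_pdivlMr// mulrC. Qed.

(* Optimizing over the scale [2 ^+ n ~ (h / t) `^ (p / Q)] gives
   [D <= C t (h / t) `^ (1 - p theta / Q)]. *)
Lemma optimize_scale (D h t K : R) : 0 < K -> 0 < t -> 0 <= h -> 0 <= D ->
  (forall n, D <= K * ((2 ^+ n) `^ (- theta) * h + (2 ^+ n) `^ (Q / p - theta) * t)) ->
  D `^ (Q * p / (Q - p * theta)) <=
    (K * (2 `^ theta + 1)) `^ (Q * p / (Q - p * theta)) *
    t `^ (Q * p / (Q - p * theta)) * (1 + h `^ p / t `^ p).
Proof.
move=> K0 t0 h0 D0 HD; set q := Q * p / (Q - p * theta).
have q0 : 0 < q := sobolev_exponent_gt0.
have tp0 : 0 < t `^ p by rewrite powR_gt0.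
have K20 : 0 < K * (2 `^ theta + 1) by rewrite mulr_gt0// addr_gt0// powR_gt0.
have Kt0 : 0 <= (K * (2 `^ theta + 1)) `^ q * t `^ q by rewrite mulr_ge0 ?powR_ge0.
have [ht|/ltW th] := leP h t.
  apply: (@le_trans _ _ ((K * (2 `^ theta + 1)) `^ q * t `^ q)); last first.
    by rewrite ler_peMr// lerDl divr_ge0// powR_ge0.
  rewrite -powRM ?(ltW K20) ?(ltW t0)//.
  apply: ge0_ler_powR; rewrite ?nnegrE ?(ltW q0)//.
    by rewrite mulr_ge0 ?(ltW K20) ?(ltW t0).
  apply: (le_trans (HD 0%N)); rewrite expr0 !powR1E !mul1r -mulrA ler_pM2l//.
  rewrite mulrDl mul1r lerD2r (le_trans ht)// ler_peMl ?(ltW t0)//.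
  by rewrite powR_ge1 ?(ltW theta0)// ler1n.
(* At [2^n = a] the two terms balance: [2^(-n theta) h = 2^(n (Q/p - theta)) t] exactly when
   [2^(n Q/p) = h/t]. *)
pose a := (h / t) `^ (p / Q).
have ht1 : 1 <= h / t by rewrite ler_pdivlMr// mul1r.
have a1 : 1 <= a by rewrite powR_ge1// divr_ge0 ?(ltW p0) ?(ltW Q0).
have [n /andP[na an]] := dyadic_between a1.
have a0 : 0 < a by exact: lt_le_trans a1.
have n0 : 0 < 2 ^+ n :> R by rewrite exprn_gt0.
have h_gt0 : 0 < h by exact: lt_le_trans th.
pose e := (h / t) `^ (1 - p * theta / Q).
have e0 : 0 < e by rewrite powR_gt0 ?divr_gt0.
have De : D <= K * (2 `^ theta + 1) * (t * e).
  apply: (le_trans (HD n)); rewrite -mulrA ler_pM2l// mulrDl mul1r lerD//.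
    apply: (@le_trans _ _ ((a / 2) `^ (- theta) * h)).
      rewrite ler_wpM2r// !powRN lef_pV2 ?posrE ?powR_gt0 ?divr_gt0//.
      apply: ge0_ler_powR; rewrite ?nnegrE ?(ltW theta0) ?(ltW n0)//.
        by rewrite divr_ge0 ?(ltW a0).
      by rewrite ler_pdivrMr// -exprSr ltW.
    rewrite powRM ?(ltW a0)// (powR_inv (- theta))// (powRN 2) invrK.
    rewrite [a `^ _ * _]mulrC -mulrA ler_pM2l ?powR_gt0//.
    have -> : a `^ (- theta) = (h / t) `^ (- (p * theta / Q)).
      by rewrite /a -powRrM; congr (_ `^ _); field; rewrite gt_eqF.
    rewrite /e powRD; last by apply/implyP => _; rewrite gt_eqF ?divr_gt0.
    rewrite powRr1 ?divr_ge0 ?(ltW t0)// mulrA (mulrCA t) mulfV ?gt_eqF// mulr1.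
    by rewrite mulrC.
  rewrite mulrC ler_pM2l//.
  apply: (@le_trans _ _ (a `^ (Q / p - theta))).
    apply: ge0_ler_powR; rewrite ?nnegrE ?(ltW beta_gt0) ?(ltW n0) ?(ltW a0)//.
  rewrite /a /e -powRrM mulrBr mulrA divfK ?gt_eqF// mulfV ?gt_eqF//.
  by rewrite (mulrAC p).
apply: (@le_trans _ _ ((K * (2 `^ theta + 1) * (t * e)) `^ q)).
  apply: ge0_ler_powR; rewrite ?nnegrE ?(ltW q0)//.
  by rewrite mulr_ge0 ?(ltW K20)// mulr_ge0 ?(ltW t0) ?(ltW e0).
rewrite powRM ?(ltW K20) ?mulr_ge0 ?(ltW t0) ?(ltW e0)//.
rewrite [(t * e) `^ q]powRM ?(ltW t0) ?(ltW e0)// mulrA ler_wpM2l//.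
(* This determines the Sobolev exponent: it turns [(h/t)^(1 - p theta/Q)] into [(h/t)^p], which is
   linear in the oscillation sum when [h^p] is that sum. *)
rewrite /e -powRrM (_ : (1 - _) * q = p); last first.
  by rewrite /q; field; rewrite !gt_eqF// subr_gt0.
rewrite powRM ?h0 ?invr_ge0 ?(ltW t0)// powR_inv// lerDr//.
Qed.

End sobolev_exponent.

Lemma powR_root_le {R : realType} (p a b : R) : 0 < p -> 0 <= a -> 0 <= b ->
  a `^ p <= b `^ p -> a <= b.
Proof.
move=> p0 a0 b0 ab; rewrite -(powRr1 a0) -(powRr1 b0) -(@mulfV _ p) ?gt_eqF//.
rewrite !powRrM; apply: ge0_ler_powR; rewrite ?nnegrE ?powR_ge0//.
by rewrite invr_ge0 ltW.
Qed.

Section sobolev.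
Context (R : realType) (d : measure_display) (Z : metricMeasurableType R d).
Variable nu : {measure set Z -> \bar R}.
Implicit Types (w x y z : Z) (r s t : R).
Hypothesis hZ : metric_measure_space nu.
Variable Cd : R.
Hypotheses (Cd1 : 1 <= Cd)
  (hCd : forall x r, 0 < r -> vball nu x (2 * r) <= Cd * vball nu x r).
Variables (p theta Q Clow : R) (u : Z -> R).
Hypotheses (p1 : 1 <= p) (theta0 : 0 < theta) (Q0 : 0 < Q) (pQ : p * theta < Q).
Hypotheses (Clow1 : 1 <= Clow) (hlow : forall x s r, 0 < s -> s <= r ->
  vball nu x r * (s / r) `^ Q <= Clow * vball nu x s).
Hypothesis mu : measurable_fun setT u.
Hypothesis Lp : forall z r, (\int[nu]_(x in ball z r) (`|u x| `^ p)%:E < +oo)%E.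

Local Notation osc := (osc nu p u).
Local Notation avg := (avg nu u).
Local Notation osc_sum := (osc_sum nu p theta u).

Let p0 : 0 < p. Proof. exact: lt_le_trans p1. Qed.
Let Cd0 : 0 < Cd. Proof. exact: lt_le_trans Cd1. Qed.

Lemma measurable_osc_sum r : measurable_fun setT (osc_sum r).
Proof.
apply: ge0_emeasurable_sum => [k x _ _|k _].
  by rewrite mule_ge0 ?osc_ge0// lee_fin powR_ge0.
by apply: measurable_funeM; exact: measurable_osc.
Qed.

Lemma osc_sum_ge0 r y : (0 <= osc_sum r y)%E.
Proof.
by apply: nneseries_ge0 => k _ _; rewrite mule_ge0 ?osc_ge0// lee_fin powR_ge0.
Qed.

Lemma osc_le_sum r y j : 0 < r ->
  (osc (2 ^- j * r) y <= ((2 ^- j * r) `^ (p * theta))%:E * osc_sum r y)%E.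
Proof.
move=> r0; set s := 2 ^- j * r.
have s0 : 0 < s by rewrite mulr_gt0// invr_gt0 exprn_gt0.
rewrite -lee_pdivrMl ?powR_gt0// -powRN.
apply: (@le_trans _ _ (\sum_(0 <= i < j.+1)
  ((2 ^- i * r) `^ (- (p * theta)))%:E * osc (2 ^- i * r) y)%E).
  rewrite big_nat_recr//= leeDr// sume_ge0// => i _.
  by rewrite mule_ge0 ?osc_ge0// lee_fin powR_ge0.
by apply: nneseries_lim_ge => i _ _; rewrite mule_ge0 ?osc_ge0// lee_fin powR_ge0.
Qed.

(** The constant of [avg_compare] with [C = Cd ^+ 4]: for [z] in [B(y,s)] the ball [B(z,4s)] lies in
    the ball around [y] of radius [2^4] times [s/2]. *)
Definition halving_const : R := 2 * 2 `^ p * (2 `^ p * Cd ^+ 4).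

Lemma halving_const_gt0 : 0 < halving_const.
Proof. by rewrite !mulr_gt0 ?powR_gt0// exprn_gt0. Qed.

Lemma avg_halve y s : 0 < s ->
  ((`|avg (s / 2) y - avg s y| `^ p * vball nu y s)%:E <=
    halving_const%:E * \int[nu]_(z in ball y s) osc (4 * s) z)%E.
Proof.
move=> s0.
have := @avg_compare _ _ _ _ hZ _ _ p1 mu Lp y y y (s / 2) s s (Cd ^+ 4) s0.
rewrite divr_gt0// s0 exprn_gt0// => /(_ isT isT isT); apply.
move=> z /ball_mdist yz; rewrite metric_sym in yz; split.
- by move: yz; set a := mdist _ _; lra.
- apply: (vball_comparable hZ Cd1 hCd) => //; rewrite ?divr_gt0 ?mulr_gt0//.
  by rewrite metric_sym; move: yz; set a := mdist _ _; rewrite !exprS expr0; lra.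
- by move: yz; set a := mdist _ _; lra.
- apply: (vball_comparable hZ Cd1 hCd) => //; rewrite ?divr_gt0 ?mulr_gt0//.
  by rewrite metric_sym; move: yz; set a := mdist _ _; rewrite !exprS expr0; lra.
Qed.

Section sobolev_ball.
Variables (x : Z) (r t : R).
Hypotheses (r0 : 0 < r) (t0 : 0 < t).
(** A positive parameter bounding the mean, rather than the mean itself, leaves room for a vanishing
    mean and lets [t] be prescribed later. *)
Hypothesis Ht :
  (\int[nu]_(z in ball x r) osc_sum r z <= (t `^ p * vball nu x r)%:E)%E.

Lemma int_osc_le A j : measurable A -> A `<=` ball x r ->
  (\int[nu]_(z in A) osc (2 ^- j * r) z <=
   ((2 ^- j * r) `^ (p * theta) * (t `^ p * vball nu x r))%:E)%E.
Proof.
move=> mA Ax.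
apply: (@le_trans _ _ (\int[nu]_(z in A)
    (((2 ^- j * r) `^ (p * theta))%:E * osc_sum r z))%E).
  by apply: ge0_le_integral_nomeas => z _; [exact: osc_ge0|exact: osc_le_sum].
have mS B := measurable_funS (measurableT) (@subsetT _ B) (measurable_osc_sum r).
rewrite ge0_integralZl ?lee_fin ?powR_ge0//; last by move=> z _; exact: osc_sum_ge0.
rewrite EFinM lee_wpmul2l ?lee_fin ?powR_ge0//; apply: le_trans Ht.
apply: ge0_subset_integral => //; first exact: (measurable_ballm hZ).
by move=> z _; exact: osc_sum_ge0.
Qed.

Let Kc : R := halving_const.

Let Kc0 : 0 < Kc := halving_const_gt0.

Let K1 : R := (Kc * (Cd * Clow * 4 `^ Q)) `^ p^-1.

Let K3 : R := (Kc * Cd ^+ 2) `^ p^-1.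

Let Clow0 : 0 < Clow. Proof. exact: lt_le_trans Clow1. Qed.

(** The ball of radius [2^-i r/4] at [y] may be smaller in measure than [B(x,r)] by a factor of
    order [2^(i Q)]. This loss to the power [1/p], against the gain [2^(-i theta)] from the scale,
    gives the growth exponent [Q/p - theta]. Radii start at [r/4] because [avg_halve] looks at
    radius [4 s], which then runs through the scales of [osc_sum r]. *)
Lemma avg_step y i : ball x (r / 4) y ->
  `|avg (2 ^- i.+1 * (r / 4)) y - avg (2 ^- i * (r / 4)) y| <=
  K1 * (r `^ theta * t * (2 ^+ i) `^ (Q / p - theta)).
Proof.
move=> /ball_mdist xy; set s := 2 ^- i * (r / 4).
have i0 : 0 < 2 ^+ i :> R by rewrite exprn_gt0.
have i1 : 1 <= 2 ^+ i :> R by rewrite exprn_ege1// ler1n.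
have s0 : 0 < s by rewrite mulr_gt0 ?invr_gt0// divr_gt0.
have sr : s <= r / 4.
  by rewrite ler_piMl ?invf_le1// divr_ge0// ltW.
have s2 : 2 ^- i.+1 * (r / 4) = s / 2.
  by rewrite /s exprSr invfM; ring.
have s4 : 4 * s = 2 ^- i * r by rewrite /s; field; rewrite gt_eqF.
have Vs0 := vball_gt0 hZ y s0.
have H := avg_halve y s0.
have Bys : ball y s `<=` ball x r.
  by apply: subset_metric_ball; move: xy; set a := mdist _ _; lra.
have := int_osc_le i (measurable_ballm hZ y s) Bys.
rewrite -s4 => /(lee_wpmul2l (ltW (Kc0 : (0 < Kc%:E)%E))) /(le_trans H).
rewrite -EFinM lee_fin => {}H; rewrite s2.
apply: (@powR_root_le _ p) => //.
  by rewrite !mulr_ge0 ?powR_ge0// ltW.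
have V1 : vball nu x r <= Cd * vball nu y r.
  rewrite -[Cd]expr1; apply: (vball_comparable hZ Cd1 hCd) => //.
  by rewrite expr1 metric_sym; move: xy; set a := mdist _ _; lra.
have sr1 : s <= r by apply: (le_trans sr); move: r0; lra.
have := hlow y s0 sr1.
have -> : (s / r) `^ Q = ((2 ^+ i) `^ Q * 4 `^ Q)^-1.
  rewrite -powRM ?(ltW i0)// -powR_inv ?mulr_gt0//; congr (_ `^ _).
  by rewrite /s; field; rewrite !gt_eqF.
rewrite ler_pdivrMr ?mulr_gt0 ?powR_gt0// => V2.
have V3 : vball nu x r <= Cd * Clow * 4 `^ Q * (2 ^+ i) `^ Q * vball nu y s.
  apply: (le_trans V1); rewrite -!mulrA ler_pM2l//; apply: (le_trans V2).
  by rewrite le_eqVlt; apply/orP; left; apply/eqP; ring.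
rewrite -(ler_pM2r Vs0); apply: (le_trans H).
have -> : (4 * s) `^ (p * theta) =
    (r `^ theta) `^ p * (2 ^+ i) `^ (- (p * theta)).
  rewrite s4 powRM ?invr_ge0 ?(ltW i0) ?(ltW r0)// powR_inv// powRN mulrC.
  by rewrite -powRrM (mulrC p).
rewrite [leRHS](_ : _ = Kc * ((r `^ theta) `^ p * (2 ^+ i) `^ (- (p * theta)) *
    (t `^ p * (Cd * Clow * 4 `^ Q * (2 ^+ i) `^ Q * vball nu y s)))); last first.
  rewrite powRM ?powR_ge0//; last by rewrite !mulr_ge0 ?powR_ge0// ltW.
  rewrite powRM ?powR_ge0//; last by rewrite mulr_ge0 ?powR_ge0// ltW.
  rewrite [(_ * t) `^ p]powRM ?powR_ge0 ?(ltW t0)//.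
  rewrite -(powRrM (2 ^+ i)) mulrBl divfK ?gt_eqF// (mulrC theta).
  rewrite powRD; last by apply/implyP => _; rewrite gt_eqF.
  rewrite /K1 -powRrM mulVf ?gt_eqF// powRr1; first ring.
  by rewrite !mulr_ge0 ?powR_ge0// ltW.
by rewrite ler_pM2l// !ler_wpM2l ?mulr_ge0 ?powR_ge0.
Qed.

Lemma avg_base y : ball x (r / 4) y ->
  `|avg (r / 4) y - avg (r / 4) x| <= K3 * (r `^ theta * t).
Proof.
move=> /ball_mdist xy; set s := r / 4.
have s0 : 0 < s by rewrite divr_gt0.
have s4 : 4 * s = r by rewrite /s; field.
have Vs0 := vball_gt0 hZ x s0.
have := @avg_compare _ _ _ _ hZ _ _ p1 mu Lp x y x s s s (Cd ^+ 4) s0.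
rewrite s0 exprn_gt0// => /(_ isT isT isT) H.
have {}H : ((`|avg s y - avg s x| `^ p * vball nu x s)%:E <=
    Kc%:E * \int[nu]_(z in ball x s) osc (4 * s) z)%E.
  apply: H => z /ball_mdist xz; have zy := metric_triangle z x y.
  rewrite (metric_sym z x) in zy; split.
  - by rewrite (le_trans (lerD zy (lexx s)))//; move: xz xy; rewrite -/s; lra.
  - apply: (vball_comparable hZ Cd1 hCd) => //; rewrite ?mulr_gt0// metric_sym !exprS expr0.
    by rewrite (le_trans (lerD zy (lexx _)))//; move: xz xy; rewrite -/s; lra.
  - by rewrite metric_sym; move: xz; lra.
  - apply: (vball_comparable hZ Cd1 hCd) => //; rewrite ?mulr_gt0// !exprS expr0.
    by move: xz; lra.
have Bxs : ball x s `<=` ball x r.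
  by apply: subset_metric_ball; rewrite mdistxx add0r -s4; move: s0; lra.
have := int_osc_le 0 (measurable_ballm hZ x s) Bxs.
rewrite expr0 invr1 mul1r -{1}s4.
move=> /(lee_wpmul2l (ltW (Kc0 : (0 < Kc%:E)%E))) /(le_trans H).
rewrite -EFinM lee_fin => {}H.
apply: (@powR_root_le _ p) => //.
  by rewrite !mulr_ge0 ?powR_ge0// ltW.
rewrite -(ler_pM2r Vs0); apply: (le_trans H).
have V1 : vball nu x r <= Cd ^+ 2 * vball nu x s.
  apply: (vball_comparable hZ Cd1 hCd) => //.
  by rewrite mdistxx add0r -s4 !exprS expr0; lra.
rewrite [leRHS](_ : _ = Kc * ((r `^ theta) `^ p *
    (t `^ p * (Cd ^+ 2 * vball nu x s)))); last first.
  rewrite powRM ?powR_ge0//; last by rewrite mulr_ge0 ?powR_ge0// ltW.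
  rewrite powRM ?powR_ge0 ?(ltW t0)//.
  rewrite /K3 -powRrM mulVf ?gt_eqF// powRr1; first ring.
  by rewrite !mulr_ge0 ?powR_ge0// ltW.
by rewrite -powRrM (mulrC theta) ler_pM2l// !ler_wpM2l ?mulr_ge0 ?powR_ge0.
Qed.

(** The oscillation at the point [y] itself is used, so no volume is lost and the error decays with
    [n]. *)
Lemma avg_center y n h : ball x (r / 4) y -> osc_sum r y = (h `^ p)%:E -> 0 <= h ->
  `|avg (2 ^- n * (r / 4)) y - u y| <= 2 * r `^ theta * ((2 ^+ n) `^ (- theta) * h).
Proof.
move=> xy yh h0; set s := 2 ^- n * (r / 4).
have n0 : 0 < 2 ^+ n :> R by rewrite exprn_gt0.
have s0 : 0 < s by rewrite mulr_gt0 ?invr_gt0// divr_gt0.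
have sE : s = 2 ^- n.+2 * r by rewrite /s !exprS; field; rewrite gt_eqF.
have := avg_osc_center hZ p1 mu Lp y s0.
have := osc_le_sum y n.+2 r0; rewrite -sE yh -EFinM => H1.
move=> /le_trans /(_ (lee_wpmul2l _ H1)); rewrite lee_fin powR_ge0 => /(_ isT).
rewrite -EFinM lee_fin => H.
apply: (@powR_root_le _ p) => //.
  by rewrite !mulr_ge0 ?powR_ge0.
apply: (le_trans H).
rewrite powRM ?mulr_ge0 ?powR_ge0// powRM ?powR_ge0// -mulrA ler_pM2l ?powR_gt0//.
rewrite powRM ?powR_ge0// -!powRrM mulrA ler_wpM2r ?powR_ge0//.
rewrite mulNr (mulrC theta) powRN -powR_inv// -powRM ?invr_ge0 ?(ltW n0) ?(ltW r0)//.
apply: ge0_ler_powR; rewrite ?nnegrE ?(ltW s0)//.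
- by rewrite mulr_ge0// ltW.
- by rewrite mulr_ge0 ?invr_ge0 ?(ltW n0) ?(ltW r0).
- by rewrite /s mulrC ler_wpM2r ?invr_ge0 ?(ltW n0)//; move: r0; lra.
Qed.

(** The steps of the telescoping grow by the ratio [b = 2^(Q/p - theta) > 1], so the last one
    dominates: [K1 + M <= M b] closes the induction in [avg_chain], and [K3] starts it. *)
Let M : R := K3 + K1 / (2 `^ (Q / p - theta) - 1).

Let M0 : 0 <= M.
Proof.
apply: addr_ge0; first exact: powR_ge0.
apply: divr_ge0; first exact: powR_ge0.
by rewrite subr_ge0 ltW// powR2_gt1// subr_gt0 ltr_pdivlMr// mulrC.
Qed.

Lemma avg_chain y n : ball x (r / 4) y ->
  `|avg (2 ^- n * (r / 4)) y - avg (r / 4) x| <=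
  M * (r `^ theta * t * (2 ^+ n) `^ (Q / p - theta)).
Proof.
move=> xy; have rt0 : 0 <= r `^ theta * t by rewrite mulr_ge0 ?powR_ge0// ltW.
have b1 : 1 < 2 `^ (Q / p - theta) :> R.
  by rewrite powR2_gt1// subr_gt0 ltr_pdivlMr// mulrC.
have b0 : 0 < 2 `^ (Q / p - theta) - 1 :> R by rewrite subr_gt0.
elim: n => [|n IH].
  rewrite expr0 invr1 mul1r powR1E mulr1 (le_trans (avg_base xy))// ler_wpM2r//.
  by rewrite lerDl divr_ge0 ?powR_ge0// ltW.
have -> : avg (2 ^- n.+1 * (r / 4)) y - avg (r / 4) x =
    (avg (2 ^- n.+1 * (r / 4)) y - avg (2 ^- n * (r / 4)) y) +
    (avg (2 ^- n * (r / 4)) y - avg (r / 4) x) by rewrite addrA subrK.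
apply: (le_trans (ler_normD _ _)).
apply: (le_trans (lerD (avg_step _ xy) IH)).
rewrite exprSr powRM// [leRHS](_ : _ = M * (2 `^ (Q / p - theta)) *
   (r `^ theta * t * (2 ^+ n) `^ (Q / p - theta))); last by ring.
rewrite -mulrDl ler_wpM2r ?mulr_ge0 ?powR_ge0// ?(ltW t0)//.
rewrite -lerBrDr -{2}(mulr1 M) -mulrBr /M mulrDl divfK ?gt_eqF//.
by rewrite lerDr mulr_ge0 ?powR_ge0// ltW.
Qed.

Let q := Q * p / (Q - p * theta).

(** The final factor 2 comes from integrating [1 + t^(-p) osc_sum]: each summand contributes at most
    [nu(B(x,r))]. *)
Definition sobolev_const : R := ((2 + M) * (2 `^ theta + 1)) `^ q * 2.

Lemma sobolev_pointwise y : ball x (r / 4) y ->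
  ((`|u y - avg (r / 4) x| `^ q)%:E <=
   (((2 + M) * (2 `^ theta + 1)) `^ q * (r `^ theta * t) `^ q)%:E *
    (1 + (t `^ (- p))%:E * osc_sum r y))%E.
Proof.
move=> xy; have O0 := osc_sum_ge0 r y.
have M20 : 0 < 2 + M by rewrite ltr_wpDr.
have C0 : 0 < ((2 + M) * (2 `^ theta + 1)) `^ q * (r `^ theta * t) `^ q.
  by rewrite mulr_gt0// powR_gt0 ?mulr_gt0 ?powR_gt0// addr_gt0// powR_gt0.
case E : (osc_sum r y) O0 => [a| |] // a0; last first.
  rewrite mulry gtr0_sg ?powR_gt0// mul1e addey// mulry gtr0_sg// mul1e leey//.
rewrite lee_fin in a0.
pose h := a `^ p^-1.
have h0 : 0 <= h by exact: powR_ge0.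
have hp : h `^ p = a by rewrite -powRrM mulVf ?gt_eqF// powRr1.
rewrite -[leRHS]/((((2 + M) * (2 `^ theta + 1)) `^ q * (r `^ theta * t) `^ q *
  (1 + t `^ (- p) * a))%:E) lee_fin powRN -hp (mulrC _ (h `^ p)).
have rt0 : 0 < r `^ theta by rewrite powR_gt0.
have := @optimize_scale R p theta Q p1 theta0 Q0 pQ
  `|u y - avg (r / 4) x| h t ((2 + M) * r `^ theta).
rewrite mulr_gt0// t0 h0 normr_ge0 => /(_ isT isT isT isT).
rewrite -/q => H; apply: le_trans (H _) _; last first.
  apply: ler_wpM2r; first by rewrite addr_ge0// divr_ge0 ?powR_ge0.
  have T0 : 0 <= 2 `^ theta + 1 :> R by rewrite addr_ge0// powR_ge0.
  have P1 : 0 <= (2 + M) * (2 `^ theta + 1) by rewrite mulr_ge0// ltW.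
  have P2 : 0 <= r `^ theta * t by rewrite mulr_ge0// ltW.
  have P3 : 0 <= (2 + M) * r `^ theta * (2 `^ theta + 1).
    by rewrite mulr_ge0// mulr_ge0// ltW.
  have P4 : 0 <= t by rewrite ltW.
  rewrite -powRM// -powRM//.
  by rewrite le_eqVlt; apply/orP; left; apply/eqP; congr (_ `^ _); ring.
move=> n.
have -> : u y - avg (r / 4) x = (avg (2 ^- n * (r / 4)) y - avg (r / 4) x) -
   (avg (2 ^- n * (r / 4)) y - u y) by ring.
apply: (le_trans (ler_normB _ _)).
have yh : osc_sum r y = (h `^ p)%:E by rewrite hp.
apply: (le_trans (lerD (avg_chain n xy) (avg_center n xy yh h0))).
set A := (2 ^+ n) `^ (- theta); set B := (2 ^+ n) `^ (Q / p - theta).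
have A0 : 0 <= A by exact: powR_ge0.
have B0 : 0 <= B by exact: powR_ge0.
rewrite -subr_ge0 [leRHS](_ : _ = r `^ theta * (M * (A * h) + 2 * (B * t))); last by ring.
apply: mulr_ge0; first exact: ltW.
by apply: addr_ge0; apply: mulr_ge0 => //; apply: mulr_ge0 => //; exact: ltW.
Qed.

Lemma sobolev_ball :
  (\int[nu]_(y in ball x (r / 4)) (`|u y - avg (r / 4) x| `^ q)%:E <=
   (sobolev_const * (r `^ theta * t) `^ q * vball nu x r)%:E)%E.
Proof.
set s := r / 4; have s0 : 0 < s by rewrite divr_gt0.
have mB := measurable_ballm hZ x s.
have sr : s <= r by rewrite /s; move: r0; lra.
have tp0 : 0 < t `^ p by rewrite powR_gt0.
have K0 : 0 <= ((2 + M) * (2 `^ theta + 1)) `^ q * (r `^ theta * t) `^ q.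
  by rewrite mulr_ge0 ?powR_ge0.
apply: (@le_trans _ _ (\int[nu]_(y in ball x s)
    ((((2 + M) * (2 `^ theta + 1)) `^ q * (r `^ theta * t) `^ q)%:E *
    (1 + (t `^ (- p))%:E * osc_sum r y)))%E).
  apply: ge0_le_integral_nomeas => y xy; first by rewrite lee_fin powR_ge0.
  exact: sobolev_pointwise.
have mS : measurable_fun (ball x s) (osc_sum r).
  exact: measurable_funS (measurable_osc_sum r).
have mT : measurable_fun (ball x s) (fun y => (t `^ (- p))%:E * osc_sum r y)%E.
  exact: measurable_funeM.
have S0 y : (0 <= (t `^ (- p))%:E * osc_sum r y)%E.
  by rewrite mule_ge0 ?osc_sum_ge0// lee_fin powR_ge0.
rewrite ge0_integralZl//; last 2 first.
- by apply: emeasurable_funD => //.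
- by move=> y _; rewrite adde_ge0.
rewrite [leRHS](_ : _ =
    (((2 + M) * (2 `^ theta + 1)) `^ q * (r `^ theta * t) `^ q)%:E *
    (2 * vball nu x r)%:E)%E; last first.
  by rewrite -EFinM /sobolev_const; congr (_ %:E); ring.
rewrite lee_wpmul2l//.
rewrite ge0_integralD//= integral_cst// mul1e (nu_ballE hZ)//.
rewrite mulr_natl mulr2n EFinD leeD//.
  by rewrite lee_fin le_vball// mdistxx add0r.
rewrite ge0_integralZl ?lee_fin ?powR_ge0//; last by move=> y _; exact: osc_sum_ge0.
rewrite powRN lee_pdivrMl// -EFinM; apply: le_trans Ht.
apply: ge0_subset_integral => //.
- exact: (measurable_ballm hZ).
- exact: measurable_funS (measurable_osc_sum r).
- by move=> y _; exact: osc_sum_ge0.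
- by apply: subset_metric_ball; rewrite mdistxx add0r.
Qed.

End sobolev_ball.

End sobolev.

(** * Capacity of superlevel sets *)

Section bump.
Context (R : realType) (Z : metricType R).
Implicit Types (x y z : Z) (r : R).
Variables (r : R) (f A : Z -> R).
Hypotheses (r0 : 0 < r) (f0 : forall x, 0 <= f x).
(** The distance is [2 r] because cones reach up to [r]: if [d(x,y) <= r], the values of [f]
    entering [bump y] lie within [2 r] of [x], and all of them must be dominated by [A x] for the
    Lipschitz bound at [x]. *)
Hypothesis fA : forall x y, mdist x y < 2 * r -> f y <= A x.

Definition cone x y : R := Num.max 0 (1 - mdist x y / r) * f y.

Definition bump x : R := sup [set cone x y | y in [set: Z]].

Let A0 x : 0 <= A x.
Proof. by rewrite (le_trans (f0 x))// fA// mdistxx mulr_gt0. Qed.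

Let cone_le x y : cone x y <= A x.
Proof.
rewrite /cone; have [xy|xy] := ltP (mdist x y) r.
  have xyr : mdist x y / r < 1 by rewrite ltr_pdivrMr// mul1r.
  rewrite max_r; last by rewrite subr_ge0 ltW.
  apply: le_trans (fA (lt_le_trans xy _)); last by move: r0; lra.
  by rewrite ler_piMl// gerBl divr_ge0 ?mdist_ge0// ltW.
by rewrite max_l ?mul0r// subr_le0 ler_pdivlMr// mul1r.
Qed.

Let has_sup_cone x : has_sup [set cone x y | y in [set: Z]].
Proof.
split; first by exists (cone x x), x.
by exists (A x) => _ [y _ <-]; exact: cone_le.
Qed.

Let cone_le_bump x y : cone x y <= bump x.
Proof. by apply: (ub_le_sup (has_sup_cone x).2); exists y. Qed.

Lemma le_bump x : f x <= bump x.
Proof.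
by apply: le_trans (cone_le_bump x x); rewrite /cone mdistxx mul0r subr0 max_r// mul1r.
Qed.

Lemma bump_ge0 x : 0 <= bump x.
Proof. exact: le_trans (le_bump x). Qed.

Lemma bump_le x : bump x <= A x.
Proof.
apply: ge_sup; first by case: (has_sup_cone x).
by move=> _ [y _ <-]; exact: cone_le.
Qed.

Let cone_lip x1 x2 y a : f y <= a -> cone x1 y <= cone x2 y + mdist x1 x2 / r * a.
Proof.
move=> fa; have a0 : 0 <= a by exact: le_trans fa.
have tri : (1 - mdist x1 y / r) <= (1 - mdist x2 y / r) + mdist x1 x2 / r.
  rewrite -subr_ge0 [leRHS](_ : _ = (mdist x2 x1 + mdist x1 y - mdist x2 y) / r).
    by rewrite divr_ge0 ?(ltW r0)// subr_ge0 metric_triangle.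
  by rewrite (metric_sym x2 x1); ring.
have d0 : 0 <= mdist x1 x2 / r by rewrite divr_ge0 ?mdist_ge0// ltW.
rewrite /cone; set m1 := Num.max _ _; set m2 := Num.max _ _.
have m12 : m1 <= m2 + mdist x1 x2 / r.
  rewrite /m1 /m2 ge_max; apply/andP; split.
    by rewrite addr_ge0// le_max lexx.
  by apply: (le_trans tri); rewrite lerD2r le_max lexx orbT.
apply: (@le_trans _ _ ((m2 + mdist x1 x2 / r) * f y)); first by rewrite ler_wpM2r.
by rewrite mulrDl lerD2l ler_wpM2l.
Qed.

Lemma bump_lipschitz x y : mdist x y <= r ->
  `|bump x - bump y| <= mdist x y / r * A x.
Proof.
move=> xy; have d0 : 0 <= mdist x y / r by rewrite divr_ge0 ?mdist_ge0// ltW.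
have dA0 : 0 <= mdist x y / r * A x by rewrite mulr_ge0.
have far z1 z : r <= mdist z1 z -> cone z1 z = 0.
  by move=> h; rewrite /cone max_l ?mul0r// subr_le0 ler_pdivlMr// mul1r.
rewrite ler_distl; apply/andP; split.
  rewrite lerBlDr; apply: ge_sup; first by case: (has_sup_cone y).
  move=> _ [z _ <-]; have [yz|/far->] := ltP (mdist y z) r; last first.
    by rewrite addr_ge0// bump_ge0.
  rewrite (metric_sym x) (le_trans (@cone_lip y x z (A x) _))//; last first.
    by rewrite lerD2r.
  by apply: fA; rewrite (le_lt_trans (metric_triangle x y z))//; move: xy yz; lra.
apply: ge_sup; first by case: (has_sup_cone x).
move=> _ [z _ <-]; have [xz|/far->] := ltP (mdist x z) r; last first.
  by rewrite addr_ge0// bump_ge0.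
rewrite (le_trans (@cone_lip x y z (A x) _))//; last by rewrite lerD2r.
by apply: fA; move: r0 xz; lra.
Qed.

Lemma bump_diff_le x y :
  `|bump x - bump y| <= Num.min 1 (mdist x y / r) * (A x + A y).
Proof.
have [xy|/ltW xy] := leP (mdist x y) r.
  rewrite min_r; last by rewrite ler_pdivrMr// mul1r.
  rewrite (le_trans (bump_lipschitz xy))// ler_wpM2l ?lerDl//.
  by rewrite divr_ge0 ?mdist_ge0// ltW.
rewrite min_l; last by rewrite ler_pdivlMr// mul1r.
rewrite mul1r (le_trans (ler_normB _ _))// !ger0_norm ?bump_ge0//.
by rewrite lerD// bump_le.
Qed.

Lemma continuous_bump : continuous bump.
Proof.
move=> x; apply/cvgrPdist_lt => e e0.
pose s := Num.min r (e * r / (A x + 1)).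
have Ax1 : 0 < A x + 1 by rewrite ltr_wpDl.
have s0 : 0 < s by rewrite lt_min r0 divr_gt0// mulr_gt0.
near=> y.
have : ball x s y by near: y; exact: nbhsx_ballx.
rewrite ballEmdist/= lt_min => /andP[xy1 xy2].
rewrite (le_lt_trans (bump_lipschitz (ltW xy1)))//.
rewrite ltr_pdivlMr// in xy2; rewrite mulrAC ltr_pdivrMr//.
by rewrite (le_lt_trans _ xy2)// ler_wpM2l ?mdist_ge0// lerDl.
Unshelve. all: by end_near. Qed.

End bump.

(** * Kernels with bounded marginals *)

Section ball_kernels.
Context (R : realType) (d : measure_display) (Z : metricMeasurableType R d).
Variable nu : {measure set Z -> \bar R}.
Implicit Types (x y z : Z) (r s : R).
Hypothesis hZ : metric_measure_space nu.
Variable Cd : R.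
Hypotheses (Cd1 : 1 <= Cd)
  (hCd : forall x r, 0 < r -> vball nu x (2 * r) <= Cd * vball nu x r).

Local Open Scope ereal_scope.

(** A Schur test: in each half of the sum [a] depends on one variable only, and the kernel is
    integrated in the other one first. *)
Lemma integral_kernel_double (K : Z * Z -> \bar R) (c : R) (a : Z -> \bar R) :
  (0 <= c)%R -> measurable_fun setT K -> (forall xy, 0 <= K xy) ->
  (forall y, \int[nu]_x K (x, y) <= c%:E) ->
  (forall x, \int[nu]_y K (x, y) <= c%:E) ->
  measurable_fun setT a -> (forall x, 0 <= a x) ->
  \int[nu]_y \int[nu]_x ((a x + a y) * K (x, y)) <= (2 * c)%:E * \int[nu]_x a x.
Proof.
move=> c0 mK K0 Kc1 Kc2 ma a0.
have ma1 : measurable_fun setT (fun xy : Z * Z => a xy.1 * K xy).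
  by apply: emeasurable_funM => //; exact: (measurableT_comp ma).
have ma2 : measurable_fun setT (fun xy : Z * Z => a xy.2 * K xy).
  by apply: emeasurable_funM => //; exact: (measurableT_comp ma).
have Ky y : measurable_fun setT (fun x => K (x, y)).
  exact: (measurableT_comp mK).
have Kx x : measurable_fun setT (fun y => K (x, y)).
  exact: (measurableT_comp mK).
have ge01 xy : 0 <= a xy.1 * K xy by rewrite mule_ge0.
have ge02 xy : 0 <= a xy.2 * K xy by rewrite mule_ge0.
have -> : \int[nu]_y \int[nu]_x ((a x + a y) * K (x, y)) =
   \int[nu]_y \int[nu]_x (a x * K (x, y)) + \int[nu]_y \int[nu]_x (a y * K (x, y)).
  rewrite -ge0_integralD//; last 4 first.
  - by move=> y _; apply: integral_ge0 => x _; rewrite mule_ge0.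
  - exact: (measurable_int_fst hZ ma1 ge01).
  - by move=> y _; apply: integral_ge0 => x _; rewrite mule_ge0.
  - exact: (measurable_int_fst hZ ma2 ge02).
  apply: eq_integral => y _; rewrite -ge0_integralD//; last 4 first.
  - by move=> x _; rewrite mule_ge0.
  - exact: emeasurable_funM.
  - by move=> x _; rewrite mule_ge0.
  - exact: measurable_funeM.
  by apply: eq_integral => x _; rewrite ge0_muleDl.
rewrite -(tonelli_nu hZ ma1 ge01)/= (_ : (2 * c)%:E = c%:E + c%:E); last first.
  by rewrite mulr_natl mulr2n.
have I0 : 0 <= \int[nu]_x a x by exact: integral_ge0.
rewrite ge0_muleDl ?lee_fin//; apply: leeD.
  rewrite -ge0_integralZl ?lee_fin//; apply: ge0_le_integral_nomeas => x _.
    by apply: integral_ge0 => y _; rewrite mule_ge0.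
  rewrite ge0_integralZl// muleC; exact: lee_wpmul2r.
rewrite -ge0_integralZl ?lee_fin//; apply: ge0_le_integral_nomeas => y _.
  by apply: integral_ge0 => x _; rewrite mule_ge0.
rewrite ge0_integralZl// muleC; exact: lee_wpmul2r.
Qed.

Definition ball_kernel s (xy : Z * Z) : \bar R :=
  ((vball nu xy.1 s)^-1 * \1_[set xy | (mdist xy.1 xy.2 < s)%R] xy)%:E.

Lemma ball_kernel_ge0 s xy : 0 <= ball_kernel s xy.
Proof. by rewrite lee_fin mulr_ge0// invr_ge0 vball_ge0. Qed.

Lemma measurable_ball_kernel s : measurable_fun setT (ball_kernel s).
Proof.
apply/measurable_EFinP/measurable_funM.
  exact: (measurableT_comp (measurable_vballV hZ s)).
apply: measurable_indic; exact: (measurable_near hZ).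
Qed.

(** The normalizing measure sits at the variable of integration; doubling moves it to [y]. *)
Lemma integral_ball_kernel_fst s y : (0 < s)%R ->
  \int[nu]_x ball_kernel s (x, y) <= Cd%:E.
Proof.
move=> s0; have mB := measurable_ballm hZ y s.
have Vs := vball_gt0 hZ y s0.
apply: (@le_trans _ _ (\int[nu]_x
    ((Cd * (vball nu y s)^-1)%:E * (\1_(ball y s) x)%:E))).
  apply: ge0_le_integral_nomeas => x _; first exact: ball_kernel_ge0.
  rewrite -EFinM lee_fin /= !indicE; have [xy|xy] := ltP (mdist x y) s.
    have yx : ball y s x by apply/ball_mdist; rewrite metric_sym.
    rewrite mem_set// (mem_set yx) !mulr1 -[X in (_ <= X * _)%R]expr1.
    apply: (inv_vball_comparable hZ Cd1 hCd) => //.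
    by rewrite expr1 mulr_natl mulr2n lerD// ltW.
  rewrite memNset ?mulr0 ?mulr_ge0// ?invr_ge0 ?vball_ge0 ?(le_trans _ Cd1)//.
  by rewrite /= ltNge xy.
rewrite ge0_integralZl ?lee_fin ?mulr_ge0 ?invr_ge0 ?vball_ge0 ?(le_trans _ Cd1)//.
  rewrite integral_indic// setIT (nu_ballE hZ)// -EFinM lee_fin -mulrA mulVf ?mulr1//.
  by rewrite gt_eqF.
by apply/measurable_EFinP; exact: measurable_indic.
Qed.

Lemma integral_ball_kernel_snd s x : (0 < s)%R ->
  \int[nu]_y ball_kernel s (x, y) <= Cd%:E.
Proof.
move=> s0; have mB := measurable_ballm hZ x s.
have Vs := vball_gt0 hZ x s0.
apply: (@le_trans _ _ (\int[nu]_y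
    (((vball nu x s)^-1)%:E * (\1_(ball x s) y)%:E))).
  apply: ge0_le_integral_nomeas => y _; first exact: ball_kernel_ge0.
  rewrite -EFinM lee_fin /= !indicE; have [xy|xy] := ltP (mdist x y) s.
    have yx : ball x s y by apply/ball_mdist.
    by rewrite mem_set// (mem_set yx).
  rewrite memNset ?mulr0 ?mulr_ge0// ?invr_ge0 ?vball_ge0//.
  by rewrite /= ltNge xy.
rewrite ge0_integralZl ?lee_fin ?invr_ge0 ?vball_ge0//.
  by rewrite integral_indic// setIT (nu_ballE hZ)// -EFinM lee_fin mulVf ?gt_eqF.
by apply/measurable_EFinP; exact: measurable_indic.
Qed.

Variable kappa : R.
Hypothesis kappa0 : (0 < kappa)%R.

(* Dominates [min(t, 1/t)^kappa / nu(B(x, d(x,y)))] up to a constant, where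
   [t = d(x,y) / r], by a sum whose integral in either variable is bounded by
   doubling. *)
Definition besov_kernel r (xy : Z * Z) : \bar R := \sum_(0 <= n <oo)
  ((2 ^- n) `^ kappa)%:E *
  (ball_kernel (2 ^- n * (2 * r)) xy + ball_kernel (2 ^+ n * (2 * r)) xy).

Let term_ge0 r n xy : 0 <= ((2 ^- n) `^ kappa)%:E *
  (ball_kernel (2 ^- n * (2 * r)) xy + ball_kernel (2 ^+ n * (2 * r)) xy).
Proof.
apply: mule_ge0; first by rewrite lee_fin powR_ge0.
by apply: adde_ge0; exact: ball_kernel_ge0.
Qed.

Let measurable_term r n : measurable_fun setT (fun xy => ((2 ^- n) `^ kappa)%:E *
  (ball_kernel (2 ^- n * (2 * r)) xy + ball_kernel (2 ^+ n * (2 * r)) xy)).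
Proof.
apply: measurable_funeM.
by apply: emeasurable_funD; exact: measurable_ball_kernel.
Qed.

Lemma besov_kernel_ge0 r xy : 0 <= besov_kernel r xy.
Proof. by apply: nneseries_ge0 => n _ _; exact: term_ge0. Qed.

Lemma measurable_besov_kernel r : measurable_fun setT (besov_kernel r).
Proof.
by apply: ge0_emeasurable_sum => [n xy _ _|n _]; [exact: term_ge0|exact: measurable_term].
Qed.

Let Kb : R := (1 - 2 `^ (- kappa))^-1 * (2 * Cd).

Let sum_bound (F : nat -> \bar R) : (forall n, 0 <= F n <= (2 * Cd)%:E) ->
  \sum_(0 <= n <oo) ((2 ^- n) `^ kappa)%:E * F n <= Kb%:E.
Proof.
move=> F2; apply: nneseries_le_ub => [n|n].
  by have /andP[? _] := F2 n; rewrite mule_ge0// lee_fin powR_ge0.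
apply: (@le_trans _ _ (\sum_(0 <= j < n) ((2 `^ (- kappa)) ^+ j * (2 * Cd))%:E)).
  apply: lee_sum => j _; have /andP[_ Fj] := F2 j.
  rewrite EFinM (_ : (2 ^- j) `^ kappa = (2 `^ (- kappa)) ^+ j)%R; last first.
    rewrite powR_inv// -powRN -(powR_mulrn j (powR_ge0 _ _)) -powRrM.
    by rewrite -powR_mulrn// -powRrM mulrN mulNr mulrC.
  by apply: lee_wpmul2l => //; rewrite lee_fin exprn_ge0// powR_ge0.
rewrite sumEFin lee_fin -mulr_suml ler_wpM2r//.
  by rewrite mulr_ge0// (le_trans _ Cd1).
apply: sum_geometric_le; rewrite powR_gt0//= powRN invf_lt1 ?powR_gt0//.
exact: powR2_gt1.
Qed.

Lemma integral_besov_kernel_fst r y : (0 < r)%R ->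
  \int[nu]_x besov_kernel r (x, y) <= Kb%:E.
Proof.
move=> r0; have m1 s : measurable_fun setT (fun x => ball_kernel s (x, y)).
  by apply: (measurableT_comp (measurable_ball_kernel s)).
have mt n : measurable_fun setT (fun x => ((2 ^- n) `^ kappa)%:E *
  (ball_kernel (2 ^- n * (2 * r)) (x, y) + ball_kernel (2 ^+ n * (2 * r)) (x, y))).
  by apply: measurable_funeM; exact: emeasurable_funD.
rewrite integral_nneseries//.
rewrite (eq_eseriesr (g := fun n => ((2 ^- n) `^ kappa)%:E *
   \int[nu]_x (ball_kernel (2 ^- n * (2 * r)) (x, y) +
                ball_kernel (2 ^+ n * (2 * r)) (x, y)))); last first.
  move=> n _; rewrite ge0_integralZl ?lee_fin ?powR_ge0//.
  - exact: emeasurable_funD.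
  - by move=> x _; rewrite adde_ge0 ?ball_kernel_ge0.
apply: sum_bound => n; apply/andP; split.
  by apply: integral_ge0 => x _; rewrite adde_ge0 ?ball_kernel_ge0.
rewrite ge0_integralD//.
- rewrite (_ : (2 * Cd)%:E = Cd%:E + Cd%:E); last by rewrite mulr_natl mulr2n.
  rewrite leeD// integral_ball_kernel_fst//.
    by rewrite mulr_gt0 ?invr_gt0 ?exprn_gt0 ?mulr_gt0.
  by rewrite mulr_gt0 ?exprn_gt0 ?mulr_gt0.
- by move=> x _; exact: ball_kernel_ge0.
- by move=> x _; exact: ball_kernel_ge0.
Qed.

Lemma integral_besov_kernel_snd r x : (0 < r)%R ->
  \int[nu]_y besov_kernel r (x, y) <= Kb%:E.
Proof.
move=> r0; have m1 s : measurable_fun setT (fun y => ball_kernel s (x, y)).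
  by apply: (measurableT_comp (measurable_ball_kernel s)).
have mt n : measurable_fun setT (fun y => ((2 ^- n) `^ kappa)%:E *
  (ball_kernel (2 ^- n * (2 * r)) (x, y) + ball_kernel (2 ^+ n * (2 * r)) (x, y))).
  by apply: measurable_funeM; exact: emeasurable_funD.
rewrite integral_nneseries//.
rewrite (eq_eseriesr (g := fun n => ((2 ^- n) `^ kappa)%:E *
   \int[nu]_y (ball_kernel (2 ^- n * (2 * r)) (x, y) +
                ball_kernel (2 ^+ n * (2 * r)) (x, y)))); last first.
  move=> n _; rewrite ge0_integralZl ?lee_fin ?powR_ge0//.
  - exact: emeasurable_funD.
  - by move=> y _; rewrite adde_ge0 ?ball_kernel_ge0.
apply: sum_bound => n; apply/andP; split.
  by apply: integral_ge0 => y _; rewrite adde_ge0 ?ball_kernel_ge0.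
rewrite ge0_integralD//.
- rewrite (_ : (2 * Cd)%:E = Cd%:E + Cd%:E); last by rewrite mulr_natl mulr2n.
  rewrite leeD// integral_ball_kernel_snd//.
    by rewrite mulr_gt0 ?invr_gt0 ?exprn_gt0 ?mulr_gt0.
  by rewrite mulr_gt0 ?exprn_gt0 ?mulr_gt0.
- by move=> y _; exact: ball_kernel_ge0.
- by move=> y _; exact: ball_kernel_ge0.
Qed.

(** One term of the series is enough: the one whose radius [s] lies in [(D, 4 D]] and whose index
    satisfies [min(D/r, r/D) <= 2^-n]. It is a small radius when [D <= r] and a large one otherwise.
    The factor 2 in the radii makes [D < s] strict, as the open balls require. *)
Lemma le_besov_kernel r x y : (0 < r)%R -> x != y ->
  (Num.min (mdist x y / r) (mdist x y / r)^-1 `^ kappa *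
   (vball nu x (mdist x y))^-1)%:E <= (Cd ^+ 2)%:E * besov_kernel r (x, y).
Proof.
move=> r0; rewrite -mdist_gt0; set D := mdist x y => D0.
have key n (s : R) : (0 < s)%R -> (D < s)%R -> (s <= 4 * D)%R ->
    (Num.min (D / r) (D / r)^-1 <= 2 ^- n)%R ->
    (s = 2 ^- n * (2 * r) \/ s = 2 ^+ n * (2 * r))%R ->
    (Num.min (D / r) (D / r)^-1 `^ kappa * (vball nu x D)^-1)%:E <=
    (Cd ^+ 2)%:E * besov_kernel r (x, y).
  move=> s0 Ds sD mn sE.
  have E : ball_kernel s (x, y) = ((vball nu x s)^-1)%:E.
    by rewrite /ball_kernel/= indicE mem_set// mulr1.
  have Jn : ball_kernel s (x, y) <=
      ball_kernel (2 ^- n * (2 * r)) (x, y) + ball_kernel (2 ^+ n * (2 * r)) (x, y).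
    by case: sE => ->; rewrite (leeDl, leeDr)//; exact: ball_kernel_ge0.
  apply: (@le_trans _ _ ((Cd ^+ 2)%:E *
      (((2 ^- n) `^ kappa)%:E * ball_kernel s (x, y)))).
    rewrite E -!EFinM lee_fin mulrCA; apply: ler_pM.
    - exact: powR_ge0.
    - by rewrite invr_ge0 vball_ge0.
    - apply: ge0_ler_powR; rewrite ?nnegrE ?(ltW kappa0)//.
      by rewrite le_min invr_ge0 divr_ge0 ?(ltW D0) ?(ltW r0).
    - apply: (inv_vball_comparable hZ Cd1 hCd) => //.
      by rewrite mdistxx add0r !exprS expr0; move: sD; lra.
  rewrite lee_wpmul2l ?lee_fin ?exprn_ge0 ?(le_trans _ Cd1)//.
  apply: (@le_trans _ _ (\sum_(0 <= j < n.+1) ((2 ^- j) `^ kappa)%:E *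
    (ball_kernel (2 ^- j * (2 * r)) (x, y) + ball_kernel (2 ^+ j * (2 * r)) (x, y)))).
    rewrite big_nat_recr//=; apply: (@le_trans _ _ (((2 ^- n) `^ kappa)%:E *
       (ball_kernel (2 ^- n * (2 * r)) (x, y) + ball_kernel (2 ^+ n * (2 * r)) (x, y)))).
      by rewrite lee_wpmul2l ?lee_fin ?powR_ge0.
    by rewrite leeDr// sume_ge0.
  by apply: nneseries_lim_ge => j _ _; exact: term_ge0.
have [Dr|rD] := leP D r.
  have : (1 <= r / D)%R by rewrite ler_pdivlMr// mul1r.
  move=> /dyadic_between[n /andP[n1 n2]].
  have n0 : (0 < 2 ^+ n :> R)%R by rewrite exprn_gt0.
  have h1 : (D <= 2 ^- n * r)%R.
    by rewrite mulrC ler_pdivlMr// mulrC -ler_pdivlMr.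
  have h2 : (2 ^- n * r <= 2 * D)%R.
    by rewrite mulrC ler_pdivrMr// mulrAC -exprS -ler_pdivrMr// ltW.
  apply: (key n (2 ^- n * (2 * r))%R).
  - by rewrite mulr_gt0 ?invr_gt0// mulr_gt0.
  - by move: h1 D0; rewrite mulrCA; set a := (2 ^- n * r)%R; lra.
  - by move: h2; rewrite mulrCA; set a := (2 ^- n * r)%R; lra.
  - by rewrite ge_min; apply/orP; left; rewrite ler_pdivrMr.
  - by left.
have : (1 <= D / r)%R by rewrite ler_pdivlMr// mul1r ltW.
move=> /dyadic_between[n /andP[n1 n2]].
have n0 : (0 < 2 ^+ n :> R)%R by rewrite exprn_gt0.
have h1 : (2 ^+ n * r <= D)%R by rewrite -ler_pdivlMr.
have h2 : (D < 2 ^+ n * (2 * r))%R by rewrite mulrA -exprSr -ltr_pdivrMr.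
apply: (key n (2 ^+ n * (2 * r))%R) => //.
- by rewrite mulr_gt0 ?mulr_gt0.
- by move: h1 D0; rewrite mulrCA; set a := (2 ^+ n * r)%R; lra.
- rewrite ge_min; apply/orP; right.
  by rewrite lef_pV2 ?posrE ?divr_gt0.
- by right.
Qed.

End ball_kernels.

(** * Test functions built from bumps *)

Section capacity_test_function.
Context (R : realType) (d : measure_display) (Z : metricMeasurableType R d).
Variable nu : {measure set Z -> \bar R}.
Implicit Types (x y z : Z) (r s : R).
Hypothesis hZ : metric_measure_space nu.

Lemma measurable_open_superlevel (f : Z -> R) :
  (forall t, open [set x | t < f x]) -> measurable_fun setT f.
Proof.
move=> of_ _; apply: (measurability _ (RGenOInfty.measurableE R)) => //.
move=> _ [_ [t ->] <-]; apply: measurableI => //.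
apply: (measurable_open hZ).
rewrite (_ : _ @^-1` _ = [set x | t < f x])//.
by apply/seteqP; split => x; rewrite /= in_itv/= andbT.
Qed.

Variables f A : nat -> Z -> R.
Hypothesis f0 : forall j x, 0 <= f j x.
Hypothesis fA : forall j x y, mdist x y < 2 * 2 ^- j -> f j y <= A j x.

Definition bumps j : Z -> R := bump (2 ^- j) (f j).

Let r0 j : 0 < 2 ^- j :> R. Proof. by rewrite invr_gt0 exprn_gt0. Qed.

Definition bump_sum n x : R := \sum_(0 <= j < n) bumps j x.

Lemma bumps_ge0 j x : 0 <= bumps j x.
Proof. exact: (bump_ge0 (r0 j) (f0 j) (@fA j)). Qed.

Lemma A_ge0 j x : 0 <= A j x.
Proof. by rewrite (le_trans (f0 j x))// fA// mdistxx mulr_gt0. Qed.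

Lemma continuous_bump_sum n : continuous (bump_sum n).
Proof.
elim: n => [|n IH] x.
  rewrite /bump_sum (_ : (fun x => _) = cst 0); first exact: cvg_cst.
  by apply/funext => y; rewrite big_geq.
rewrite /bump_sum (_ : (fun x => _) = (fun x => bump_sum n x + bumps n x)); last first.
  by apply/funext => y; rewrite big_nat_recr.
by apply: cvgD; [exact: IH|exact: (continuous_bump (r0 n) (f0 n) (@fA n))].
Qed.

Lemma bump_sum_ge0 n x : 0 <= bump_sum n x.
Proof. by apply: sumr_ge0 => j _; exact: bumps_ge0. Qed.

(** Truncation of the partial sums keeps the supremum finite even where the series diverges. A
    supremum of continuous functions is lower semicontinuous, hence Borel. *)
Definition test_fun x : R := sup [set Num.min 1 (bump_sum n x) | n in [set: nat]].

Let test_has_sup x : has_sup [set Num.min 1 (bump_sum n x) | n in [set: nat]].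
Proof.
split; first by exists (Num.min 1 (bump_sum 0 x)), 0%N.
by exists 1 => _ [n _ <-]; rewrite ge_min lexx.
Qed.

Lemma le_test_fun n x : Num.min 1 (bump_sum n x) <= test_fun x.
Proof. by apply: (ub_le_sup (test_has_sup x).2); exists n. Qed.

Lemma test_fun_le x a : (forall n, Num.min 1 (bump_sum n x) <= a) -> test_fun x <= a.
Proof.
move=> H; apply: ge_sup; first by case: (test_has_sup x).
by move=> _ [n _ <-].
Qed.

Lemma test_fun_ge0 x : 0 <= test_fun x.
Proof. by apply: le_trans (le_test_fun 0 x); rewrite le_min ler01 bump_sum_ge0. Qed.

Lemma measurable_test_fun : measurable_fun setT test_fun.
Proof.
apply: measurable_open_superlevel => t.
rewrite (_ : [set x | t < test_fun x] =
    \bigcup_n [set x | t < Num.min 1 (bump_sum n x)]); last first.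
  apply/seteqP; split => [x /= tx|x [n _ /= tx]]; last first.
    by rewrite (lt_le_trans tx)// le_test_fun.
  apply: contrapT => H; move: tx; rewrite ltNge => /negP; apply.
  apply: test_fun_le => n; rewrite leNgt; apply/negP => tn; apply: H.
  by exists n.
apply: bigcup_open => n _.
have [t1|t1] := ltP t 1.
  rewrite (_ : [set x | _] = bump_sum n @^-1` [set a | t < a]).
    by apply: open_comp; [move=> *; exact: continuous_bump_sum|exact: open_gt].
  by apply/seteqP; split => x /=; rewrite lt_min t1.
rewrite (_ : [set x | _] = set0); first exact: open0.
by apply/seteqP; split => x //=; rewrite lt_min ltNge t1.
Qed.

(** Strict superlevel sets of the continuous partial sums are open and, as bumps dominate the [f j],
    they contain [G]. *)
Lemma test_fun_nbhs (G : set Z) :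
  (forall x, G x -> exists n, 1 < \sum_(0 <= j < n) f j x) ->
  exists2 V, set_nbhs G V & forall x, V x -> 1 <= test_fun x.
Proof.
move=> HG; exists (\bigcup_n (bump_sum n @^-1` [set a | 1 < a])).
  apply/set_nbhsP; exists (\bigcup_n (bump_sum n @^-1` [set a | 1 < a])).
  split => //; last first.
    move=> x /HG[n fn]; exists n => //=; apply: (lt_le_trans fn).
    apply: ler_sum => j _; exact: (le_bump (r0 j) (f0 j) (@fA j)).
  apply: bigcup_open => n _.
  by apply: open_comp; [move=> *; exact: continuous_bump_sum|exact: open_gt].
move=> x [n _ /= xn]; apply: le_trans (le_test_fun n x).
by rewrite le_min lexx ltW.
Qed.

(** Truncation at 1 does not increase differences, so a bound uniform in the partial sums passes to
    the supremum. An extended real [B] lets possibly divergent series be used as bounds. *)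
Lemma test_fun_diff_le (p : R) x y (B : \bar R) : 0 < p ->
  (forall n, ((\sum_(0 <= j < n) Num.min 1 (2 ^+ j * mdist x y) *
     (A j x + A j y)) `^ p)%:E <= B)%E ->
  ((`|test_fun x - test_fun y| `^ p)%:E <= B)%E.
Proof.
move=> p0; case: B => [b| |] H; last 2 first.
- by rewrite leey.
- by have := H 0%N; rewrite leNgt ltNyr.
rewrite lee_fin.
have b0 : 0 <= b by have := H 0%N; rewrite lee_fin; apply: le_trans; exact: powR_ge0.
have bE : (b `^ p^-1) `^ p = b by rewrite -powRrM mulVf ?gt_eqF// powRr1.
rewrite -bE; apply: ge0_ler_powR; rewrite ?nnegrE ?powR_ge0 ?(ltW p0)//.
have min_diff (a1 a2 : R) : Num.min 1 a1 <= Num.min 1 a2 + `|a1 - a2|.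
  have n1 := ler_norm (a1 - a2); have n2 := normr_ge0 (a1 - a2).
  by have [h1|h1] := leP 1 a1; have [h2|h2] := leP 1 a2; lra.
have key n : `|bump_sum n x - bump_sum n y| <= b `^ p^-1.
  have S0 : 0 <= \sum_(0 <= j < n) Num.min 1 (2 ^+ j * mdist x y) * (A j x + A j y).
    apply: sumr_ge0 => j _; rewrite mulr_ge0 ?addr_ge0 ?A_ge0//.
    by rewrite le_min ler01 mulr_ge0 ?mdist_ge0.
  apply: (@powR_root_le _ p) => //; first exact: powR_ge0.
  rewrite bE -lee_fin; apply: le_trans (H n); rewrite lee_fin.
  apply: ge0_ler_powR; rewrite ?nnegrE ?(ltW p0)//.
  rewrite /bump_sum -sumrB; apply: (le_trans (ler_norm_sum _ _ _)).
  apply: ler_sum => j _.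
  apply: (le_trans (bump_diff_le (r0 j) (f0 j) (@fA j) _ _)).
  by rewrite invrK (mulrC (mdist x y)).
rewrite ler_distl; apply/andP; split.
  rewrite lerBlDr; apply: test_fun_le => n.
  apply: (le_trans (min_diff _ (bump_sum n x))).
  by rewrite lerD ?le_test_fun// distrC.
apply: test_fun_le => n; apply: (le_trans (min_diff _ (bump_sum n y))).
by rewrite lerD ?le_test_fun.
Qed.

Lemma test_fun_powR_le (p : R) x (B : \bar R) : 0 < p ->
  (forall n, ((\sum_(0 <= j < n) A j x) `^ p)%:E <= B)%E ->
  ((`|test_fun x| `^ p)%:E <= B)%E.
Proof.
move=> p0; case: B => [b| |] H; last 2 first.
- by rewrite leey.
- by have := H 0%N; rewrite leNgt ltNyr.
rewrite lee_fin ger0_norm ?test_fun_ge0//.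
have b0 : 0 <= b by have := H 0%N; rewrite lee_fin; apply: le_trans; exact: powR_ge0.
have bE : (b `^ p^-1) `^ p = b by rewrite -powRrM mulVf ?gt_eqF// powRr1.
rewrite -bE; apply: ge0_ler_powR; rewrite ?nnegrE ?powR_ge0 ?test_fun_ge0 ?(ltW p0)//.
apply: test_fun_le => n.
have S0 : 0 <= \sum_(0 <= j < n) A j x by apply: sumr_ge0 => j _; exact: A_ge0.
apply: (@le_trans _ _ (\sum_(0 <= j < n) A j x)).
  rewrite ge_min; apply/orP; right; apply: ler_sum => j _.
  exact: (bump_le (r0 j) (f0 j) (@fA j)).
apply: (@powR_root_le _ p) => //; first exact: powR_ge0.
by rewrite bE -lee_fin.
Qed.

End capacity_test_function.

(** * Decoupling the scales *)

Section lipschitz_sum.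
Context (R : realType).
Variables (p theta : R).
Hypotheses (p1 : 1 <= p) (theta0 : 0 < theta) (theta1 : theta < 1).

(* Half of the room between [theta] and the exponents 0 and 1 pays for the
   weights in [powR_sum_weights], the other half for [besov_kernel]. *)
Definition besov_kappa : R := Num.min theta (1 - theta) / 2.

Lemma besov_kappa_gt0 : 0 < besov_kappa.
Proof. by rewrite divr_gt0// lt_min theta0 subr_gt0. Qed.

Lemma min1_le_powR (t : R) : 0 < t ->
  Num.min 1 t <= t `^ theta * (Num.min t t^-1) `^ (besov_kappa + besov_kappa).
Proof.
move=> t0; set e := _ + _; have eE : e = Num.min theta (1 - theta).
  by rewrite /e -splitr.
have e0 : 0 <= e by rewrite eE le_min (ltW theta0) subr_ge0 ltW.
have [t1|t1] := leP t 1.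
  rewrite min_l; last by rewrite (le_trans t1)// invf_ge1.
  rewrite -powRD; last by apply/implyP => _; rewrite gt_eqF.
  by apply: ger1_powR; rewrite ?t0// eE -lerBrDl ge_min lexx orbT.
rewrite min_r; last by rewrite (le_trans _ (ltW t1))// invf_le1// ltW.
rewrite powR_inv// ler_pdivlMr ?powR_gt0// mul1r.
by apply: ler_powR; rewrite ?(ltW t1)// eE ge_min lexx.
Qed.

Lemma lipschitz_sum_le : exists2 C : R, 0 < C &
  forall n (D : R) (a b : nat -> R), 0 < D ->
    (forall j, 0 <= a j) -> (forall j, 0 <= b j) ->
    (\sum_(0 <= j < n) Num.min 1 (2 ^+ j * D) * (a j + b j)) `^ p <=
    C * D `^ (p * theta) * \sum_(0 <= j < n) (2 ^+ j) `^ (p * theta) *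
      (Num.min (2 ^+ j * D) (2 ^+ j * D)^-1) `^ besov_kappa * (a j `^ p + b j `^ p).
Proof.
have k0 := besov_kappa_gt0; have p0 : 0 < p by exact: lt_le_trans p1.
have [W W0 HW] := sum_min_geometric k0.
exists ((W + 1) `^ p * 2 `^ p); first by rewrite mulr_gt0 ?powR_gt0// ltr_wpDl.
move=> n D a b D0 a0 b0.
have t0 j : 0 < 2 ^+ j * D by rewrite mulr_gt0// exprn_gt0.
pose w j := (Num.min (2 ^+ j * D) (2 ^+ j * D)^-1) `^ besov_kappa.
have m0 j : 0 <= Num.min (2 ^+ j * D) (2 ^+ j * D)^-1.
  by rewrite le_min invr_ge0 (ltW (t0 j)).
have m1 j : Num.min (2 ^+ j * D) (2 ^+ j * D)^-1 <= 1.
  rewrite ge_min; have [h|h] := leP (2 ^+ j * D) 1 => //=.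
  by rewrite invf_le1// ltW.
have w0 j : 0 <= w j by exact: powR_ge0.
have w1 j : w j <= 1 by rewrite powR_le1 ?(ltW k0)// m0 m1.
(* Of the two factors [w j] given by [min1_le_powR], one stays inside [x j] and will survive in the
   kernel; the other is the weight with bounded sum. *)
pose x j := w j * ((2 ^+ j * D) `^ theta * (a j + b j)).
have x0 j : 0 <= x j by rewrite mulr_ge0// mulr_ge0 ?powR_ge0// addr_ge0.
have wW : \sum_(0 <= j < n) w j <= W + 1 by rewrite (le_trans (HW n D D0))// lerDl.
apply: (@le_trans _ _ ((\sum_(0 <= j < n) w j * x j) `^ p)).
  apply: ge0_ler_powR; rewrite ?nnegrE ?(ltW p0)//.
  - apply: sumr_ge0 => j _; rewrite mulr_ge0 ?addr_ge0//.
    by rewrite le_min ler01 (ltW (t0 j)).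
  - by apply: sumr_ge0 => j _; rewrite mulr_ge0.
  apply: ler_sum => j _; rewrite /x !mulrA ler_wpM2r ?addr_ge0//.
  apply: (le_trans (min1_le_powR (t0 j))).
  rewrite powRD; last by apply/implyP; rewrite addr_eq0 gt_eqF// (lt_trans _ k0)// oppr_lt0.
  by rewrite /w mulrC.
apply: (le_trans (powR_sum_weights p0 w0 x0 wW)).
rewrite -!mulrA ler_wpM2l ?powR_ge0// mulrA mulr_sumr; apply: ler_sum => j _.
rewrite /x powRM//; last by rewrite mulr_ge0 ?powR_ge0// addr_ge0.
rewrite powRM ?powR_ge0 ?addr_ge0// -powRrM (mulrC theta) powRM ?exprn_ge0 ?(ltW D0)//.
rewrite -/(w j).
apply: (@le_trans _ _ (w j * ((2 ^+ j) `^ (p * theta) * D `^ (p * theta) *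
    (2 `^ p * (a j `^ p + b j `^ p))))); last first.
  by rewrite le_eqVlt; apply/orP; left; apply/eqP; ring.
apply: ler_pM; rewrite ?powR_ge0//.
- by rewrite !mulr_ge0 ?powR_ge0.
(* Since [w j <= 1 <= p], raising the surviving factor to the power [p] only decreases it. *)
- have [wj0|wj0] := eqVneq (w j) 0; first by rewrite wj0 powR0// gt_eqF.
  have wj_gt0 : 0 < w j by rewrite lt_neqAle eq_sym wj0 w0.
  by apply: ge1r_powR; rewrite ?wj_gt0 ?w1.
- by rewrite ler_wpM2l ?mulr_ge0 ?powR_ge0// powRD_le.
Qed.

End lipschitz_sum.

(** * From test functions to capacity *)

Section capacity.
Context (R : realType) (d : measure_display) (Z : metricMeasurableType R d).
Variable nu : {measure set Z -> \bar R}.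
Implicit Types (x y z : Z) (r s : R).
Hypothesis hZ : metric_measure_space nu.
Variable Cd : R.
Hypotheses (Cd1 : 1 <= Cd)
  (hCd : forall x r, 0 < r -> vball nu x (2 * r) <= Cd * vball nu x r).
Variables (p theta : R).
Hypotheses (p1 : 1 <= p) (theta0 : 0 < theta) (theta1 : theta < 1).

Local Open Scope ereal_scope.

Let p0 : (0 < p)%R. Proof. exact: lt_le_trans p1. Qed.

Definition scale_energy (A : nat -> Z -> R) : \bar R :=
  \sum_(0 <= j <oo) ((2 ^+ j) `^ (p * theta))%:E * \int[nu]_x (A j x `^ p)%:E.

Let mpow (A : nat -> Z -> R) j : measurable_fun setT (A j) ->
  measurable_fun setT (fun x => (A j x `^ p)%:E).
Proof.
by move=> mA; apply/measurable_EFinP; exact: (measurableT_comp (measurable_powR _)).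
Qed.

(** The summable weights [2^(-j theta)] are compensated by [2^(j theta)] inside the power, which is
    where the factors of [scale_energy] come from. *)
Lemma integral_test_fun_le : exists2 C : R, (0 < C)%R & forall f A : nat -> Z -> R,
  (forall j x, 0 <= f j x)%R -> (forall j, measurable_fun setT (A j)) ->
  (forall j x y, mdist x y < 2 * 2 ^- j -> f j y <= A j x)%R ->
  \int[nu]_x (`|test_fun f x| `^ p)%:E <= C%:E * scale_energy A.
Proof.
pose q : R := (2 `^ (- theta))%R.
have q01 : (0 < q < 1)%R.
  by rewrite /q powR_gt0//= powRN invf_lt1 ?powR_gt0//; exact: powR2_gt1.
have W0 : (0 < (1 - q)^-1)%R by rewrite invr_gt0 subr_gt0; case/andP: q01.
exists ((1 - q)^-1 `^ p)%R; first by rewrite powR_gt0.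
move=> f A f0 mA fA.
have Ap0 j x : 0 <= (A j x `^ p)%:E by rewrite lee_fin powR_ge0.
have -> : scale_energy A =
    \int[nu]_x \sum_(0 <= j <oo) (((2 ^+ j) `^ (p * theta))%:E * (A j x `^ p)%:E).
  rewrite integral_nneseries//.
  - apply: eq_eseriesr => j _; rewrite ge0_integralZl ?lee_fin ?powR_ge0//.
    exact: mpow.
  - by move=> j; apply: measurable_funeM; exact: mpow.
  - by move=> j x _; rewrite mule_ge0// lee_fin powR_ge0.
rewrite -ge0_integralZl ?lee_fin ?powR_ge0//; last 2 first.
- apply: ge0_emeasurable_sum => [j x _ _|j _]; first by rewrite mule_ge0// lee_fin powR_ge0.
  by apply: measurable_funeM; exact: mpow.
- by move=> x _; apply: nneseries_ge0 => j _ _; rewrite mule_ge0// lee_fin powR_ge0.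
apply: ge0_le_integral_nomeas => x _; first by rewrite lee_fin powR_ge0.
apply: (test_fun_powR_le f0 fA p0) => n.
apply: (@le_trans _ _ (((1 - q)^-1 `^ p)%:E *
   \sum_(0 <= j < n) (((2 ^+ j) `^ (p * theta))%:E * (A j x `^ p)%:E))); last first.
  rewrite lee_wpmul2l ?lee_fin ?powR_ge0//.
  by apply: nneseries_lim_ge => j _ _; rewrite mule_ge0// lee_fin powR_ge0.
rewrite [leRHS](_ : _ = ((1 - q)^-1 `^ p *
    \sum_(0 <= j < n) ((2 ^+ j) `^ (p * theta) * A j x `^ p))%:E); last first.
  by rewrite EFinM -sumEFin.
rewrite lee_fin.
have := @powR_sum_weights _ p (1 - q)^-1%R n (fun j => q ^+ j)%R
  (fun j => (2 ^+ j) `^ theta * A j x)%R p0.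
have A0 j : (0 <= A j x)%R.
  by rewrite (le_trans (f0 j x))// fA// mdistxx mulr_gt0 ?invr_gt0 ?exprn_gt0.
move=> /(_ (fun j => exprn_ge0 j (powR_ge0 _ _))
           (fun j => mulr_ge0 (powR_ge0 _ _) (A0 j)) (sum_geometric_le n q01)) H.
have E : (\sum_(0 <= j < n) ((2 ^+ j) `^ theta * A j x) `^ p =
    \sum_(0 <= j < n) (2 ^+ j) `^ (p * theta) * A j x `^ p)%R.
  by apply: eq_bigr => j _; rewrite powRM ?powR_ge0// -powRrM (mulrC theta).
rewrite E in H.
apply: le_trans H; rewrite le_eqVlt; apply/orP; left; apply/eqP; congr (_ `^ _)%R.
apply: eq_bigr => j _; rewrite mulrA (_ : q ^+ j * _ = 1)%R ?mul1r//.
rewrite -(powR_mulrn j (powR_ge0 _ _)) -(powR_mulrn j (ler0n _ 2)) -!powRrM.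
rewrite -powRD; last by rewrite pnatr_eq0 implybT.
by rewrite mulNr (mulrC theta) addNr powRr0.
Qed.

(** Pointwise, [lipschitz_sum_le] produces the power [d^(p theta)] that the seminorm divides by, and
    [le_besov_kernel] at [r = 2^-j] absorbs the remaining decay factor over the ball measure. Each
    scale is then settled by [integral_kernel_double]. *)
Lemma besov_energy_test_fun_le : exists2 C : R, (0 < C)%R & forall f A : nat -> Z -> R,
  (forall j x, 0 <= f j x)%R -> (forall j, measurable_fun setT (A j)) ->
  (forall j x y, mdist x y < 2 * 2 ^- j -> f j y <= A j x)%R ->
  \int[nu]_y \int[nu]_x
      ((`|test_fun f x - test_fun f y| `^ p / mdist x y `^ (p * theta))%:E
        / nu (ball x (mdist x y))) <= C%:E * scale_energy A.
Proof.
have [C C0 HC] := lipschitz_sum_le p1 theta0 theta1.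
have k0 := besov_kappa_gt0 theta0 theta1.
pose kappa := besov_kappa theta.
pose Kb : R := ((1 - 2 `^ (- kappa))^-1 * (2 * Cd))%R.
have Cd0 : (0 < Cd)%R by exact: lt_le_trans Cd1.
have Kb0 : (0 < Kb)%R.
  rewrite mulr_gt0 ?mulr_gt0// invr_gt0 subr_gt0 powRN invf_lt1 ?powR_gt0//.
  exact: powR2_gt1.
have C20 : (0 < C * Cd ^+ 2)%R by rewrite mulr_gt0 ?exprn_gt0.
have C2K0 : (0 < C * Cd ^+ 2 * (2 * Kb))%R.
  by apply: mulr_gt0 => //; apply: mulr_gt0.
exists (C * Cd ^+ 2 * (2 * Kb))%R => //.
move=> f A f0 mA fA.
have A0 j x : (0 <= A j x)%R.
  by rewrite (le_trans (f0 j x))// fA// mdistxx mulr_gt0 ?invr_gt0 ?exprn_gt0.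
have Ap0 j x : 0 <= (A j x `^ p)%:E by rewrite lee_fin powR_ge0.
pose K j := besov_kernel nu kappa (2 ^- j).
have K0 j xy : 0 <= K j xy by exact: besov_kernel_ge0.
have mK j : measurable_fun setT (K j) by exact: (measurable_besov_kernel hZ).
pose G j (xy : Z * Z) : \bar R := (C * Cd ^+ 2 * (2 ^+ j) `^ (p * theta))%:E *
  (((A j xy.1 `^ p)%:E + (A j xy.2 `^ p)%:E) * K j xy).
have c0 j : (0 <= C * Cd ^+ 2 * (2 ^+ j) `^ (p * theta))%R.
  by rewrite mulr_ge0 ?powR_ge0// ltW.
have G0 j xy : 0 <= G j xy.
  by apply: mule_ge0; rewrite ?lee_fin//; apply: mule_ge0 => //; exact: adde_ge0.
have mG1 j : measurable_fun setT
    (fun xy : Z * Z => ((A j xy.1 `^ p)%:E + (A j xy.2 `^ p)%:E) * K j xy).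
  apply: emeasurable_funM => //; apply: emeasurable_funD.
    exact: (measurableT_comp (mpow (mA j))).
  exact: (measurableT_comp (mpow (mA j))).
have mG j : measurable_fun setT (G j) by exact: measurable_funeM.
apply: (@le_trans _ _ (\int[nu]_y \int[nu]_x \sum_(0 <= j <oo) G j (x, y))).
  have G00 x y : 0 <= \sum_(0 <= j <oo) G j (x, y) by exact: nneseries_ge0.
  have I0 x y : 0 <= (`|test_fun f x - test_fun f y| `^ p /
      mdist x y `^ (p * theta))%:E / nu (ball x (mdist x y)).
    by rewrite mule_ge0 ?lee_fin ?divr_ge0 ?powR_ge0// inve_ge0.
  apply: ge0_le_integral_nomeas => y _; first exact: integral_ge0.
  apply: ge0_le_integral_nomeas => x _ //.
  have [->|xy] := eqVneq x y.
    by rewrite subrr normr0 powR0 ?gt_eqF// mul0r mul0e.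
  have D0 : (0 < mdist x y)%R by rewrite mdist_gt0.
  have V0 := vball_gt0 hZ x D0.
  rewrite (nu_ballE hZ)// inver (gt_eqF V0).
  set D := mdist x y in D0 V0 *; set V := vball nu x D in V0 *.
  pose s j := ((2 ^+ j) `^ (p * theta) *
      (Num.min (2 ^+ j * D) (2 ^+ j * D)^-1) `^ kappa * (A j x `^ p + A j y `^ p))%R.
  have s0 j : 0 <= (s j)%:E.
    by rewrite lee_fin mulr_ge0 ?addr_ge0 ?powR_ge0// mulr_ge0 ?powR_ge0.
  have := test_fun_diff_le f0 fA p0 (x := x) (y := y)
    (B := (C * D `^ (p * theta))%:E * \sum_(0 <= j <oo) (s j)%:E).
  have Hn n : ((\sum_(0 <= j < n) Num.min 1 (2 ^+ j * mdist x y) * (A j x + A j y))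
      `^ p)%:E <= (C * D `^ (p * theta))%:E * \sum_(0 <= j <oo) (s j)%:E.
    apply: (@le_trans _ _ ((C * D `^ (p * theta))%:E * \sum_(0 <= j < n) (s j)%:E)).
      rewrite sumEFin -EFinM lee_fin.
      by apply: (HC n D (A ^~ x) (A ^~ y)).
    rewrite lee_wpmul2l ?lee_fin ?mulr_ge0 ?powR_ge0 ?(ltW C0)//.
    by apply: nneseries_lim_ge => j _ _; exact: s0.
  move=> /(_ Hn) H.
  have DV0 : (0 <= D `^ (- (p * theta)) * V^-1)%R.
    by rewrite mulr_ge0 ?powR_ge0// invr_ge0 ltW.
  rewrite [leLHS](_ : _ = (D `^ (- (p * theta)) * V^-1)%:E *
      (`|test_fun f x - test_fun f y| `^ p)%:E); last first.
    by rewrite -!EFinM powRN; congr (_ %:E); ring.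
  apply: (le_trans (lee_wpmul2l _ H)); first by rewrite lee_fin.
  rewrite muleA -EFinM (_ : _ * _ * _ = C * V^-1)%R; last first.
    rewrite powRN; field; rewrite !gt_eqF ?powR_gt0//.
  rewrite -nneseriesZl//.
  apply: lee_nneseries => [j _ _|j _].
    by rewrite mule_ge0// lee_fin divr_ge0 ?(ltW C0) ?(ltW V0).
  have := le_besov_kernel hZ Cd1 hCd k0 (r := 2 ^- j) (x := x) (y := y).
  rewrite invr_gt0 exprn_gt0// xy => /(_ isT isT); rewrite -/D -/V -/(K j (x, y)).
  rewrite invrK (mulrC D) => H1.
  have e0 : (0 <= C * ((2 ^+ j) `^ (p * theta) * (A j x `^ p + A j y `^ p)))%R.
    by rewrite mulr_ge0 ?(ltW C0)// mulr_ge0 ?addr_ge0 ?powR_ge0.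
  have {}H1 := lee_wpmul2l (e0 : 0 <= (_%:E)) H1.
  rewrite [leLHS](_ : _ = (C * ((2 ^+ j) `^ (p * theta) * (A j x `^ p + A j y `^ p)))%:E *
    ((Num.min (2 ^+ j * D) (2 ^+ j * D)^-1) `^ kappa * V^-1)%:E); last first.
    by rewrite -!EFinM /s; congr (_ %:E); ring.
  apply: (le_trans H1); rewrite /G !muleA -EFinM -EFinD -EFinM.
  by apply: lee_wpmul2r => //; rewrite lee_fin le_eqVlt; apply/orP; left; apply/eqP; ring.
have -> : \int[nu]_y \int[nu]_x \sum_(0 <= j <oo) G j (x, y) =
    \sum_(0 <= j <oo) \int[nu]_y \int[nu]_x G j (x, y).
  rewrite -integral_nneseries//; last 2 first.
  - by move=> j; exact: (measurable_int_fst hZ).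
  - by move=> j y _; exact: integral_ge0.
  apply: eq_integral => y _; rewrite integral_nneseries// => j.
  exact: (measurableT_comp (mG j)).
rewrite /scale_energy -nneseriesZl; last first.
  by move=> j _; rewrite mule_ge0 ?lee_fin ?powR_ge0// integral_ge0.
apply: lee_nneseries => [j _ _|j _].
  by apply: integral_ge0 => y _; exact: integral_ge0.
rewrite /G.
have -> : \int[nu]_y \int[nu]_x ((C * Cd ^+ 2 * (2 ^+ j) `^ (p * theta))%:E *
    (((A j (x, y).1 `^ p)%:E + (A j (x, y).2 `^ p)%:E) * K j (x, y))) =
   (C * Cd ^+ 2 * (2 ^+ j) `^ (p * theta))%:E * \int[nu]_y \int[nu]_x
    (((A j x `^ p)%:E + (A j y `^ p)%:E) * K j (x, y)).
  have h0 x y : 0 <= ((A j x `^ p)%:E + (A j y `^ p)%:E) * K j (x, y).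
    by rewrite mule_ge0// adde_ge0.
  rewrite -ge0_integralZl ?lee_fin//; last 2 first.
  - by apply: (measurable_int_fst hZ (mG1 j)) => -[].
  - by move=> y _; exact: integral_ge0.
  apply: eq_integral => y _; rewrite ge0_integralZl ?lee_fin//.
  exact: (measurableT_comp (mG1 j)).
have r0 : (0 < 2 ^- j :> R)%R by rewrite invr_gt0 exprn_gt0.
have := integral_kernel_double hZ (ltW Kb0) (mK j) (K0 j)
  (fun y => integral_besov_kernel_fst hZ Cd1 hCd k0 y r0)
  (fun x => integral_besov_kernel_snd hZ Cd1 k0 x r0) (mpow (mA j)) (Ap0 j).
move=> H; apply: (le_trans (lee_wpmul2l _ H)); first by rewrite lee_fin.
rewrite !muleA -!EFinM; apply: lee_wpmul2r; first exact: integral_ge0.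
by rewrite lee_fin le_eqVlt; apply/orP; left; apply/eqP; ring.
Qed.

Lemma besov_capacity_le : exists2 C : R, (0 < C)%R & forall (f A : nat -> Z -> R) (G : set Z),
  (forall j x, 0 <= f j x)%R -> (forall j, measurable_fun setT (A j)) ->
  (forall j x y, mdist x y < 2 * 2 ^- j -> f j y <= A j x)%R ->
  (forall x, G x -> exists n, 1 < \sum_(0 <= j < n) f j x)%R ->
  besov_capacity nu theta p G <= C%:E * scale_energy A.
Proof.
have [C1 C10 H1] := integral_test_fun_le.
have [C2 C20 H2] := besov_energy_test_fun_le.
exists (2 `^ p * (C1 + C2))%R; first by rewrite mulr_gt0 ?powR_gt0// addr_gt0.
move=> f A G f0 mA fA HG.
have := H1 f A f0 mA fA; have := H2 f A f0 mA fA.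
set Y := \int[nu]_y _; set X := \int[nu]_x _ => YE XE.
have X0 : 0 <= X by apply: integral_ge0 => x _; rewrite lee_fin powR_ge0.
have Y0 : 0 <= Y.
  apply: integral_ge0 => y _; apply: integral_ge0 => x _.
  by rewrite mule_ge0 ?lee_fin ?divr_ge0 ?powR_ge0// inve_ge0.
have E0 : 0 <= scale_energy A.
  apply: nneseries_ge0 => j _ _; apply: mule_ge0; first by rewrite lee_fin powR_ge0.
  by apply: integral_ge0 => x _; rewrite lee_fin powR_ge0.
(* For infinite energy the bound is trivial, because the constant is positive. *)
move: E0 XE YE; case: (scale_energy A) => [e| |] // e0 XE YE; last first.
  by rewrite mulry gtr0_sg ?mul1e ?leey// mulr_gt0 ?powR_gt0// addr_gt0.
have Xoo : X < +oo by rewrite (le_lt_trans XE)// -EFinM ltry.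
have Yoo : Y < +oo by rewrite (le_lt_trans YE)// -EFinM ltry.
have NE : 'N[nu]_p%:E[EFin \o test_fun f] = X `^ p^-1.
  have pn0 : (p != 0)%R by rewrite gt_eqF.
  rewrite -[LHS]poweRe1 ?Lnorm_ge0// -(mulfV pn0) poweRrM poweR_Lnorm//.
have mPsi := measurable_test_fun hZ f0 fA.
have [V GV V1] := test_fun_nbhs f0 fA HG.
apply: (@le_trans _ _ (besov_check_norm nu theta p (test_fun f) `^ p)).
  apply: ereal_inf_lbound; exists (test_fun f) => //; split; last first.
    by exists V => //; exact: aeW.
  split; last split.
  - by rewrite /finite_norm NE poweR_lty.
  - split => // z r; apply: le_lt_trans Xoo.
    apply: ge0_subset_integral => //.
    + exact: (measurable_ballm hZ).
    + apply/measurable_EFinP; apply: (measurableT_comp (measurable_powR _)).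
      exact: (measurableT_comp (@normr_measurable R setT)).
  - by rewrite /besov_seminorm poweR_lty.
rewrite /besov_check_norm /besov_seminorm NE -/Y.
clear NE; move: X0 Y0 XE YE Xoo Yoo; move: X Y => [x| |] [y| |] //.
rewrite !lee_fin => x0 y0 xe ye _ _.
(* The norm is a sum of two [p]-th roots, and its [p]-th power costs the factor [2^p]. *)
apply: (le_trans (powRD_le p0 (powR_ge0 _ _) (powR_ge0 _ _))).
rewrite -!powRrM mulVf ?gt_eqF// !powRr1// -mulrA ler_wpM2l ?powR_ge0//.
by rewrite mulrDl lerD.
Qed.

End capacity.

(** * Greedy covering *)

Section greedy_cover.
Context (R : realType) (d : measure_display) (Z : metricMeasurableType R d).
Variable nu : {measure set Z -> \bar R}.
Implicit Types (x y z : Z) (r s : R) (E : set Z).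
Hypothesis hZ : metric_measure_space nu.
Variable Cd : R.
Hypotheses (Cd1 : 1 <= Cd)
  (hCd : forall x r, 0 < r -> vball nu x (2 * r) <= Cd * vball nu x r).

Definition fatten r E : set Z := \bigcup_(x in E) ball x r.

Lemma measurable_fatten r E : measurable (fatten r E).
Proof.
by apply: (measurable_open hZ); apply: bigcup_open => x _; exact: open_metric_ball.
Qed.

Local Open Scope ereal_scope.

(** Averaging replaces the choice of a disjoint subfamily: at every point [y] of the large
    fattening, the mean of [h] at radius [8 r] sees a whole ball [B(x,r)] with [x] in [E]. The
    exponent 7 is 3, for comparing [B(x,r)] with [B(y,r)], plus 4 from [integral_ball_average].
    Cutting [h] off to the small fattening keeps the bound local. *)
Lemma measure_fatten_le s r E (h : Z -> \bar R) : (0 < r)%R ->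
  measurable_fun setT h -> (forall x, 0 <= h x) ->
  (forall x, E x -> (vball nu x r)%:E <= (r `^ s)%:E * \int[nu]_(y in ball x r) h y) ->
  nu (fatten (4 * r) E) <= (Cd ^+ 7 * r `^ s)%:E * \int[nu]_(x in fatten r E) h x.
Proof.
move=> r0 mh h0 Eh; have mN := measurable_fatten r E.
have mM := measurable_fatten (4 * r) E.
have Cd0 : (0 < Cd)%R by exact: lt_le_trans Cd1.
pose g := h \_ (fatten r E).
have mg : measurable_fun setT g.
  by apply/(measurable_restrictT h) => //; exact: measurable_funS mh.
have g0 x : 0 <= g x by rewrite /g patchE; case: ifP.
have := integral_ball_average hZ Cd1 hCd 3 r0 mg g0.
rewrite [in X in _ <= X -> _]/g -integral_mkcond => avg_le.
have c0 : (0 <= Cd ^+ 3 * r `^ s)%R by rewrite mulr_ge0 ?powR_ge0// exprn_ge0 ?(ltW Cd0).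
rewrite (_ : (Cd ^+ 7 * r `^ s)%:E = (Cd ^+ 3 * r `^ s)%:E * (Cd ^+ 4)%:E); last first.
  by rewrite -EFinM [in RHS]mulrAC -exprD.
rewrite -muleA; apply: le_trans (lee_wpmul2l (c0 : 0 <= _%:E) avg_le).
have I0 x : 0 <= ((vball nu x r)^-1)%:E * \int[nu]_(y in ball x (2 ^+ 3 * r)) g y.
  by rewrite mule_ge0 ?lee_fin ?invr_ge0 ?vball_ge0//; exact: integral_ge0.
rewrite -ge0_integralZl//; last first.
  apply: emeasurable_funM; first exact/measurable_EFinP/(measurable_vballV hZ).
  apply: (measurable_ball_int hZ (g := fun xy => g xy.2)) => //.
  exact: (measurableT_comp mg).
have -> : nu (fatten (4 * r) E) = \int[nu]_y (\1_(fatten (4 * r) E) y)%:E.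
  by rewrite integral_indic// setIT.
apply: ge0_le_integral_nomeas => y _; first by rewrite lee_fin.
rewrite indicE; have [|_] := boolP (y \in _); last by rewrite mule_ge0.
rewrite inE => -[x Ex /ball_mdist xy].
have V0 := vball_gt0 hZ y r0.
apply: (@le_trans _ _ ((Cd ^+ 3 * (vball nu y r)^-1 * vball nu x r)%:E)).
  rewrite lee_fin mulrAC ler_pdivlMr// mul1r.
  apply: (vball_comparable hZ Cd1 hCd) => //.
  by rewrite !exprS expr0; move: xy; set a := mdist _ _; lra.
rewrite EFinM; apply: (le_trans (lee_wpmul2l _ (Eh _ Ex))).
  by rewrite lee_fin divr_ge0 ?exprn_ge0 ?(ltW Cd0) ?vball_ge0.
rewrite !muleA -!EFinM mulrAC; apply: lee_wpmul2l.
  by rewrite lee_fin divr_ge0 ?vball_ge0.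
rewrite [leLHS](_ : _ = \int[nu]_(z in ball x r) g z); last first.
  apply: eq_integral => z zx; rewrite /g patchE ifT// inE.
  by exists x => //; rewrite inE in zx.
apply: ge0_subset_integral => //.
- exact: (measurable_ballm hZ).
- exact: (measurable_ballm hZ).
- exact: measurable_funS mg.
- apply: subset_metric_ball; rewrite metric_sym !exprS expr0.
  by move: xy; set a := mdist _ _; lra.
Qed.

Section selection.
Variable F : nat -> set Z.

(** The radii [2^-n] decrease, so the larger balls choose first and later stages keep only the
    points left uncovered. Balls of one stage may overlap; a stage is treated as a single set. *)
Fixpoint covered n : set Z := if n is m.+1 then
  covered m `|` fatten (2 * 2 ^- m) (F m `\` covered m) else set0.

Definition selected n : set Z := F n `\` covered n.

Lemma covered_selected n x : covered n x ->
  exists2 i, (i < n)%N & fatten (2 * 2 ^- i) (selected i) x.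
Proof.
elim: n => //= n IH [/IH[i ni xi]|xn]; first by exists i => //; exact: ltnW.
by exists n.
Qed.

Lemma selected_cover n x : F n x -> exists i, fatten (2 * 2 ^- i) (selected i) x.
Proof.
move=> Fx; have [/covered_selected[i _]|nx] := pselect (covered n x); first by exists i.
exists n; exists x => //; apply/ball_mdist.
by rewrite mdistxx mulr_gt0// invr_gt0 exprn_gt0.
Qed.

Lemma fatten_covered i j : (i < j)%N ->
  fatten (2 * 2 ^- i) (selected i) `<=` covered j.
Proof.
elim: j => //= j IH; rewrite ltnS leq_eqVlt => /orP[/eqP->|/IH ij] x xi; first by right.
by left; exact: ij.
Qed.

(** A point selected at a later stage [j] has distance at least [2 * 2^-i] from those of stage [i],
    and [2^-i + 2^-j] does not exceed this. *)
Lemma trivIset_fatten_selected :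
  trivIset setT (fun j => fatten (2 ^- j) (selected j)).
Proof.
have lt_disj i j : (i < j)%N ->
    fatten (2 ^- i) (selected i) `&` fatten (2 ^- j) (selected j) = set0.
  move=> ij; apply/seteqP; split => // y [[a ia /ball_mdist ay]] [b [_ nb] /ball_mdist yb].
  apply: nb; apply: (fatten_covered ij); exists a => //; apply/ball_mdist.
  have rij : (2 ^- j <= 2 ^- i :> R)%R.
    by rewrite lef_pV2 ?posrE ?exprn_gt0// ler_weXn2l ?ler1n// ltnW.
  rewrite (le_lt_trans (metric_triangle a y b))// (metric_sym y).
  move: ay yb rij; set u := mdist a y; set v := mdist b y.
  by set A := (2 ^- j)%R; set B := (2 ^- i)%R; lra.
apply/trivIsetP => i j _ _; rewrite neq_ltn => /orP[ij|ji]; first exact: lt_disj.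
by rewrite setIC; exact: lt_disj.
Qed.

End selection.

(** Three enlargements of the selected sets are in play: by [2^-j] the stages are disjoint, so that
    the integrals of [h] add up; by [2 * 2^-j] they cover; by [4 * 2^-j] they leave the margin
    [2 * 2^-j] that the dominants of bumps need. *)
Lemma greedy_cover s (h : Z -> \bar R) :
  measurable_fun setT h -> (forall x, 0 <= h x) ->
  exists E : nat -> set Z,
   (forall j x, (vball nu x (2 ^- j))%:E <=
        ((2 ^- j) `^ s)%:E * \int[nu]_(y in ball x (2 ^- j)) h y ->
      exists i, fatten (2 * 2 ^- i) (E i) x) /\
   \sum_(0 <= j <oo) ((2 ^+ j) `^ s)%:E * nu (fatten (4 * 2 ^- j) (E j)) <=
     (Cd ^+ 7)%:E * \int[nu]_x h x.
Proof.
move=> mh h0.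
pose F j := [set x | (vball nu x (2 ^- j))%:E <=
        ((2 ^- j) `^ s)%:E * \int[nu]_(y in ball x (2 ^- j)) h y].
exists (selected F); split => [j x Fx|]; first exact: (@selected_cover F j).
have Cd0 : (0 <= Cd)%R by rewrite (le_trans _ Cd1).
apply: (@le_trans _ _ (\sum_(0 <= j <oo) (Cd ^+ 7)%:E *
    \int[nu]_(x in fatten (2 ^- j) (selected F j)) h x)).
  apply: lee_nneseries => [j _ _|j _]; first by rewrite mule_ge0 ?lee_fin ?powR_ge0.
  have r0 : (0 < 2 ^- j :> R)%R by rewrite invr_gt0 exprn_gt0.
  have := @measure_fatten_le s _ (selected F j) h r0 mh h0.
  move=> /(_ (fun x Ex => Ex.1)) H.
  apply: (le_trans (lee_wpmul2l _ H)); first by rewrite lee_fin powR_ge0.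
  rewrite muleA -EFinM mulrCA -powRM ?invr_ge0// mulfV ?gt_eqF ?exprn_gt0//.
  by rewrite powR1E mulr1.
rewrite nneseriesZl; last by move=> j _; exact: integral_ge0.
apply: lee_wpmul2l; first by rewrite lee_fin exprn_ge0.
rewrite -ge0_integral_bigcup//.
- apply: ge0_subset_integral => //.
  by apply: bigcup_measurable => j _; exact: measurable_fatten.
- by move=> j; exact: measurable_fatten.
- exact: measurable_funS mh.
- exact: trivIset_fatten_selected.
Qed.

End greedy_cover.

(** * Lebesgue points *)

Section representative.
Context (R : realType) (d : measure_display) (Z : metricMeasurableType R d).
Variable nu : {measure set Z -> \bar R}.
Implicit Types (w x y z : Z) (r s t : R).
Hypothesis hZ : metric_measure_space nu.
Variable Cd : R.
Hypotheses (Cd1 : 1 <= Cd)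
  (hCd : forall x r, 0 < r -> vball nu x (2 * r) <= Cd * vball nu x r).
Variables (p theta Q Clow : R) (u : Z -> R).
Hypotheses (p1 : 1 <= p) (theta0 : 0 < theta) (Q0 : 0 < Q) (pQ : p * theta < Q).
Hypotheses (Clow1 : 1 <= Clow) (hlow : forall x s r, 0 < s -> s <= r ->
  vball nu x r * (s / r) `^ Q <= Clow * vball nu x s).
Hypothesis mu : measurable_fun setT u.
Hypothesis Lp : forall z r, (\int[nu]_(x in ball z r) (`|u x| `^ p)%:E < +oo)%E.
Hypothesis besov_fin : (\int[nu]_y besov_slice nu p theta u y < +oo)%E.

Local Notation osc := (osc nu p u).
Local Notation avg := (avg nu u).
Local Notation osc_sum := (osc_sum nu p theta u).
Local Notation q := (Q * p / (Q - p * theta)).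
Local Open Scope ereal_scope.

Let p0 : (0 < p)%R. Proof. exact: lt_le_trans p1. Qed.
Let q0 : (0 < q)%R. Proof. exact: sobolev_exponent_gt0. Qed.

Lemma integral_osc_sum_lty r : (0 < r)%R -> \int[nu]_y osc_sum r y < +oo.
Proof.
move=> r0; have [C C0 HC] := osc_sum_le hZ Cd1 hCd p1 theta0 mu.
have Ci0 : (0 <= C^-1)%R by rewrite invr_ge0 ltW.
have : \int[nu]_y (C^-1%:E * osc_sum r y) < +oo.
  apply: le_lt_trans besov_fin; apply: ge0_le_integral_nomeas => y _.
    by rewrite mule_ge0 ?lee_fin//; exact: osc_sum_ge0.
  by rewrite lee_pdivrMl//; exact: HC.
rewrite ge0_integralZl//; last 2 first.
- exact: measurable_osc_sum.
- by move=> y _; exact: osc_sum_ge0.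
have I0 : 0 <= \int[nu]_y osc_sum r y.
  by apply: integral_ge0 => y _; exact: osc_sum_ge0.
move: I0; case: (\int[nu]_y osc_sum r y) => [a| |]// _.
  by move=> _; rewrite ltry.
by rewrite mulry gtr0_sg ?invr_gt0// mul1e.
Qed.

Lemma integral_powR_le (D : set Z) (w : Z -> R) (c : R) (a m : R) : measurable D ->
  measurable_fun setT w -> (0 <= m)%R -> nu D = m%:E ->
  \int[nu]_(y in D) (`|w y - c| `^ q)%:E <= a%:E ->
  \int[nu]_(y in D) (`|w y| `^ q)%:E <= (2 `^ q * (a + `|c| `^ q * m))%:E.
Proof.
move=> mD mw m0 Dm ha.
have mwc : measurable_fun D (fun y => (`|w y - c| `^ q)%:E).
  apply/measurable_EFinP; apply: (measurableT_comp (measurable_powR _)).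
  apply: (measurableT_comp (@normr_measurable R setT)).
  by apply: measurable_funB => //; exact: measurable_funS mw.
apply: (@le_trans _ _ (\int[nu]_(y in D)
    ((2 `^ q)%:E * ((`|w y - c| `^ q)%:E + (`|c| `^ q)%:E)))).
  apply: ge0_le_integral_nomeas => y _; first by rewrite lee_fin powR_ge0.
  rewrite -EFinD -EFinM lee_fin.
  apply: le_trans (powRD_le q0 (normr_ge0 _) (normr_ge0 _)).
  apply: ge0_ler_powR; rewrite ?nnegrE ?addr_ge0 ?(ltW q0)//.
  by rewrite -{1}(subrK c (w y)) ler_normD.
rewrite ge0_integralZl ?lee_fin ?powR_ge0//; last 2 first.
- exact: emeasurable_funD.
- by move=> y _; rewrite adde_ge0 ?lee_fin ?powR_ge0.
rewrite EFinM lee_wpmul2l ?lee_fin ?powR_ge0//.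
rewrite ge0_integralD//.
by rewrite (integral_cst nu mD (`|c| `^ q)%:E) Dm EFinD EFinM leeD.
Qed.

Lemma Lloc_sobolev : Lloc nu q u.
Proof.
(* Local integrability is also demanded for nonpositive radii, whose balls are empty. *)
split => // z r; have [r0|r0] := leP r 0%R.
  rewrite (_ : ball z r = set0) ?integral_set0//.
  apply/seteqP; split => // y /ball_mdist zy.
  by have := le_lt_trans (mdist_ge0 z y) (lt_le_trans zy r0); rewrite ltxx.
have r40 : (0 < 4 * r)%R by rewrite mulr_gt0.
have V0 := vball_gt0 hZ z r40.
have mB := measurable_ballm hZ z (4 * r).
have Ioo : \int[nu]_(y in ball z (4 * r)) osc_sum (4 * r) y < +oo.
  apply: le_lt_trans (integral_osc_sum_lty r40).
  apply: ge0_subset_integral => //; first exact: measurable_osc_sum.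
  by move=> y _; exact: osc_sum_ge0.
have I0 : 0 <= \int[nu]_(y in ball z (4 * r)) osc_sum (4 * r) y.
  by apply: integral_ge0 => y _; exact: osc_sum_ge0.
pose I := fine (\int[nu]_(y in ball z (4 * r)) osc_sum (4 * r) y).
have IE : \int[nu]_(y in ball z (4 * r)) osc_sum (4 * r) y = I%:E.
  by rewrite fineK// ge0_fin_numE.
have I00 : (0 <= I)%R by exact: fine_ge0.
(* The summand 1 keeps [t] positive when the oscillation vanishes. The radius [4 r] is used since
   [sobolev_ball] controls the ball of a quarter of the radius. *)
pose t := (((I + 1) / vball nu z (4 * r)) `^ p^-1)%R.
have I10 : (0 < (I + 1) / vball nu z (4 * r))%R by rewrite divr_gt0// ltr_wpDl.
have t0 : (0 < t)%R by rewrite powR_gt0.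
have tp : (t `^ p = (I + 1) / vball nu z (4 * r))%R.
  by rewrite /t -powRrM mulVf ?gt_eqF// powRr1// ltW.
have := sobolev_ball hZ Cd1 hCd p1 theta0 Q0 pQ Clow1 hlow mu Lp (x := z) r40 t0.
rewrite IE lee_fin tp divfK ?gt_eqF// lerDl => /(_ ler01).
rewrite (_ : 4 * r / 4 = r)%R; last by field.
move=> H; apply: le_lt_trans (integral_powR_le _ mu (ltW (vball_gt0 hZ z r0)) (nu_ballE hZ z r0) H) _.
  exact: (measurable_ballm hZ).
by rewrite ltry.
Qed.

(** The factor [1/4] makes this the average subtracted in [sobolev_ball] at radius [2^-j]. *)
Definition approximant j x : R := avg (2 ^- j * (1 / 4)) x.

(* [fine] turns an infinite limsup into 0; this only matters where the averages
   diverge, a set of zero capacity. *)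
Definition precise x : R := fine (limn_esup (fun j => (approximant j x)%:E)).

Lemma measurable_precise : measurable_fun setT precise.
Proof.
apply: (measurableT_comp (@fine_measurable R setT _)) => //.
apply: measurable_fun_limn_esup => j; apply/measurable_EFinP.
exact: (measurable_avg hZ).
Qed.

Lemma precise_lim x (l : R) :
  (approximant j x @[j --> \oo] --> l)%R -> precise x = l.
Proof.
move=> cl; rewrite /precise; have cE : (approximant j x)%:E @[j --> \oo] --> l%:E.
  by apply: cvg_EFin => //; exact: nearW.
rewrite is_cvg_limn_esupE; last by apply/cvg_ex; exists l%:E.
by rewrite (cvg_lim _ cE).
Qed.

(** A finite [osc_sum] dominates each of its terms, which forces convergence to [u x] at the rate
    [2^(-j theta)]. *)
Lemma approximant_cvg x : osc_sum 1 x < +oo ->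
  (approximant j x @[j --> \oo] --> u x)%R.
Proof.
move=> Hx; have H0 := osc_sum_ge0 nu p theta u 1 x.
pose h := (fine (osc_sum 1 x) `^ p^-1)%R.
have hE : osc_sum 1 x = (h `^ p)%:E.
  by rewrite -powRrM mulVf ?gt_eqF// powRr1 ?fine_ge0// fineK// ge0_fin_numE.
have h0 : (0 <= h)%R by exact: powR_ge0.
have xx : ball x (1 / 4) x by apply/ball_mdist; rewrite mdistxx divr_gt0.
have bnd n : (`|approximant n x - u x| <= 2 * h * (2 `^ (- theta)) ^+ n)%R.
  apply: (le_trans (avg_center hZ p1 theta0 mu Lp ltr01 n xx hE h0)).
  rewrite powR1E mulr1 -mulrA [leRHS](_ : _ = 2 * ((2 `^ (- theta)) ^+ n * h))%R.
    rewrite -(powR_mulrn n (powR_ge0 2 (- theta))) -(powR_mulrn n (ler0n _ 2)).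
    by rewrite -!powRrM (mulrC (- theta)%R).
  by ring.
apply/cvgrPdist_le => e e0.
have : (`|2 `^ (- theta) : R| < 1)%R.
  by rewrite ger0_norm ?powR_ge0// powRN invf_lt1 ?powR_gt0//; exact: powR2_gt1.
move=> /(cvg_geometric (2 * h))/cvgrPdist_le/(_ e e0); apply: filterS => n /=.
rewrite sub0r normrN => H; rewrite distrC (le_trans (bnd n))//.
by apply: le_trans H; exact: ler_norm.
Qed.

Lemma precise_ae : {ae nu, forall x, precise x = u x}.
Proof.
have Hfin : nu.-integrable setT (osc_sum 1).
  apply/integrableP; split; first exact: (measurable_osc_sum hZ).
  under eq_integral => x _ do rewrite gee0_abs ?osc_sum_ge0//.
  exact: integral_osc_sum_lty.
have := integrable_ae measurableT Hfin.
apply: filterS => x /(_ Logic.I) Hx; apply: precise_lim; apply: approximant_cvg.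
by rewrite ltey_eq Hx.
Qed.

End representative.

Lemma dyadic_below (R : realType) n (r : R) : 0 < r -> r < 2 ^- n / 8 ->
  exists2 j, (n <= j)%N & r <= 2 ^- j / 4 /\ 2 ^- j <= 2 ^+ 3 * r.
Proof.
move=> r_gt0 rn.
have n0 : 0 < 2 ^+ n :> R by rewrite exprn_gt0.
have rn' : 8 * 2 ^+ n * r < 1.
  by move: rn; rewrite ltr_pdivlMr// mulrC -[X in _ < X]mul1r ltr_pdivlMr// mulrAC.
have n1 : 1 <= 2 ^+ n :> R by rewrite exprn_ege1// ler1n.
have r41 : 1 <= 1 / (4 * r).
  rewrite ler_pdivlMr ?mulr_gt0// mul1r ltW// (le_lt_trans _ rn')//.
  by rewrite ler_wpM2r ?(ltW r_gt0)//; move: n1; lra.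
have [j /andP[j1 j2]] := dyadic_between r41; exists j.
  rewrite leqNgt; apply/negP => jn.
  have : 2 ^+ j.+1 <= 2 ^+ n :> R by rewrite ler_weXn2l// ler1n.
  move=> /(lt_le_trans j2); rewrite ltr_pdivrMr ?mulr_gt0// => H.
  by move: rn' H; rewrite -mulrA mulrCA mulrA; set a := 2 ^+ n * r; nra.
have j0 : 0 < 2 ^+ j :> R by rewrite exprn_gt0.
split.
  move: j1; rewrite ler_pdivlMr ?mulr_gt0// => H.
  by rewrite ler_pdivlMr// -[leRHS]mul1r ler_pdivlMr// mulrC (mulrC r).
move: j2; rewrite ltr_pdivrMr ?mulr_gt0// exprS => H.
rewrite -[leLHS]mul1r ler_pdivrMr// (_ : 2 ^+ 3 = 8)//; last by rewrite !exprS expr0; ring.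
by move: H; lra.
Qed.

(** * A criterion for Lebesgue points *)

Section lebesgue_points.
Context (R : realType) (d : measure_display) (Z : metricMeasurableType R d).
Variable nu : {measure set Z -> \bar R}.
Implicit Types (w x y z : Z) (r s t : R).
Hypothesis hZ : metric_measure_space nu.
Variable Cd : R.
Hypotheses (Cd1 : 1 <= Cd)
  (hCd : forall x r, 0 < r -> vball nu x (2 * r) <= Cd * vball nu x r).
Variables (p theta Q Clow : R) (u : Z -> R).
Hypotheses (p1 : 1 <= p) (theta0 : 0 < theta) (Q0 : 0 < Q) (pQ : p * theta < Q).
Hypotheses (Clow1 : 1 <= Clow) (hlow : forall x s r, 0 < s -> s <= r ->
  vball nu x r * (s / r) `^ Q <= Clow * vball nu x s).
Hypothesis mu : measurable_fun setT u.
Hypothesis Lp : forall z r, (\int[nu]_(x in ball z r) (`|u x| `^ p)%:E < +oo)%E.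
Hypothesis besov_fin : (\int[nu]_y besov_slice nu p theta u y < +oo)%E.

Local Notation osc := (osc nu p u).
Local Notation avg := (avg nu u).
Local Notation osc_sum := (osc_sum nu p theta u).
Local Notation q := (Q * p / (Q - p * theta)).
Local Notation approximant := (approximant nu u).
Local Notation precise := (precise nu u).
Local Open Scope ereal_scope.

Let p0 : (0 < p)%R. Proof. exact: lt_le_trans p1. Qed.
Let q0 : (0 < q)%R. Proof. exact: sobolev_exponent_gt0. Qed.
Let Cd0 : (0 < Cd)%R. Proof. exact: lt_le_trans Cd1. Qed.

Section at_point.
Variables (x : Z) (l : R).
Hypothesis cl : (approximant j x @[j --> \oo] --> l)%R.
(** A little o along dyadic radii, in multiplicative form so that extended reals are not divided. *)
Hypothesis small_energy : forall M : nat, (0 < M)%N -> exists J, forall j, (J <= j)%N ->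
  M%:R%:E * \int[nu]_(y in ball x (2 ^- j)) osc_sum (2 ^- j) y <=
  ((2 ^- j) `^ (- (p * theta)) * vball nu x (2 ^- j))%:E.

Let S : R := sobolev_const Cd p theta Q Clow.

Let S0 : (0 <= S)%R.
Proof. by rewrite /S /sobolev_const mulr_ge0 ?powR_ge0. Qed.

Lemma sobolev_small M : (0 < M)%N -> exists J, forall j, (J <= j)%N ->
  \int[nu]_(y in ball x (2 ^- j / 4)) (`|u y - approximant j x| `^ q)%:E <=
  (S * (M%:R^-1 `^ p^-1) `^ q * vball nu x (2 ^- j))%:E.
Proof.
move=> M0; have [J HJ] := small_energy M0; exists J => j Jj.
have r0 : (0 < 2 ^- j :> R)%R by rewrite invr_gt0 exprn_gt0.
have MR0 : (0 < M%:R^-1 :> R)%R by rewrite invr_gt0 ltr0n.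
(* With this [t] the hypothesis of [sobolev_ball] is exactly [small_energy], and its factor
   [r^theta] cancels: what remains is small with [1/M], uniformly in [j]. *)
pose t : R := (M%:R^-1 `^ p^-1 * (2 ^- j) `^ (- theta))%R.
have t0 : (0 < t)%R by rewrite mulr_gt0 ?powR_gt0.
have := sobolev_ball hZ Cd1 hCd p1 theta0 Q0 pQ Clow1 hlow mu Lp (x := x) r0 t0.
have -> : (t `^ p = M%:R^-1 * (2 ^- j) `^ (- (p * theta)))%R.
  rewrite powRM ?powR_ge0// -!powRrM mulVf ?gt_eqF// powRr1 ?(ltW MR0)//.
  by rewrite mulNr (mulrC theta).
rewrite (_ : (2 ^- j) `^ theta * t = M%:R^-1 `^ p^-1)%R; last first.
  rewrite /t mulrCA -powRD; last by apply/implyP => _; rewrite gt_eqF.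
  by rewrite subrr powRr0 mulr1.
rewrite /approximant mulrA mulr1 -/S; apply.
rewrite -mulrA EFinM lee_pdivlMl ?ltr0n//.
exact: HJ.
Qed.

Lemma average_small e : (0 < e)%R -> exists2 r0 : R, (0 < r0)%R & forall r,
  (0 < r)%R -> (r < r0)%R ->
  \int[nu]_(y in ball x r) (`|u y - l| `^ q)%:E <= (e * vball nu x r)%:E.
Proof.
(* [X] gathers the constants of [integral_powR_le], of the Sobolev inequality and of the passage
   from a dyadic radius to [r]. The choices of [M] and [e2] allot [e / 2] to the oscillation and
   [e / 2] to [approximant j x - l]. *)
move=> e0; pose X := (2 `^ q * S * Cd ^+ 3)%R.
have X0 : (0 <= X)%R.
  by rewrite mulr_ge0 ?exprn_ge0 ?(ltW Cd0)// mulr_ge0 ?powR_ge0.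
have e20 : (0 < e / 2)%R by rewrite divr_gt0.
have [M M0 HM] : exists2 M, (0 < M)%N & (X * (M%:R^-1 `^ p^-1) `^ q <= e / 2)%R.
  pose b := (((X + 1) / (e / 2)) `^ (p / q))%R.
  have X10 : (0 < X + 1)%R by rewrite ltr_wpDl.
  have b0 : (0 < b)%R by rewrite powR_gt0 ?divr_gt0.
  exists (Num.bound b).
    by rewrite -(ltr_nat R) (lt_trans b0)// archi_boundP// ltW.
  have bM : (b <= (Num.bound b)%:R)%R by rewrite ltW// archi_boundP// ltW.
  have M0 : (0 < (Num.bound b)%:R :> R)%R by exact: lt_le_trans bM.
  rewrite -powRrM powR_inv// ler_pdivrMr ?powR_gt0//.
  have : (b `^ (p^-1 * q) <= (Num.bound b)%:R `^ (p^-1 * q))%R.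
    apply: ge0_ler_powR; rewrite ?nnegrE ?(ltW b0) ?(ltW M0)//.
    by rewrite mulr_ge0 ?invr_ge0 ?(ltW p0) ?(ltW q0).
  rewrite /b -powRrM (_ : p / q * (p^-1 * q) = 1)%R; last first.
    by field; rewrite !gt_eqF// subr_gt0.
  rewrite powRr1 ?divr_ge0 ?(ltW X10) ?(ltW e0)// => H.
  apply: le_trans (ler_wpM2l (ltW e20) H).
  by rewrite mulrCA mulfV ?gt_eqF// mulr1 lerDl.
have [J HJ] := sobolev_small M0.
pose e2 := ((e / 2 / 2 `^ q) `^ q^-1)%R.
have e2q : (2 `^ q * e2 `^ q = e / 2)%R.
  rewrite -powRrM mulVf ?gt_eqF// powRr1; last by rewrite divr_ge0 ?powR_ge0// ltW.
  by rewrite mulrC divfK// gt_eqF ?powR_gt0.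
have e2_gt0 : (0 < e2)%R by rewrite powR_gt0 ?divr_gt0 ?powR_gt0.
have /cvgrPdist_le/(_ e2 e2_gt0)[N _ HN] := cl.
pose n := maxn J N.
exists (2 ^- n / 8)%R; first by rewrite divr_gt0// invr_gt0 exprn_gt0.
move=> r r_gt0 rn.
have [j nj [rj1 rj2]] := dyadic_below r_gt0 rn.
have rj0 : (0 < 2 ^- j :> R)%R by rewrite invr_gt0 exprn_gt0.
have Vr := vball_gt0 hZ x r_gt0.
have Vj : (vball nu x (2 ^- j) <= Cd ^+ 3 * vball nu x r)%R.
  apply: (vball_comparable hZ Cd1 hCd) => //.
  by rewrite mdistxx add0r.
have mB s := measurable_ballm hZ x s.
have mul (c : R) : measurable_fun setT (fun y => u y - c)%R by exact: measurable_funB.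
have H1 : \int[nu]_(y in ball x r) (`|u y - approximant j x| `^ q)%:E <=
    (S * (M%:R^-1 `^ p^-1) `^ q * (Cd ^+ 3 * vball nu x r))%:E.
  apply: (@le_trans _ _ (\int[nu]_(y in ball x (2 ^- j / 4))
      (`|u y - approximant j x| `^ q)%:E)).
    apply: ge0_subset_integral => //.
    - apply/measurable_EFinP; apply: (measurableT_comp (measurable_powR _)).
      apply: (measurableT_comp (@normr_measurable R setT)).
      exact: measurable_funS (mul _).
    - by apply: subset_metric_ball; rewrite mdistxx add0r.
  apply: (le_trans (HJ j (leq_trans (leq_maxl _ _) nj))).
  by rewrite lee_fin ler_wpM2l// mulr_ge0 ?powR_ge0.
have H2 : \int[nu]_(y in ball x r) (`|(u y - l) - (approximant j x - l)| `^ q)%:E <=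
    (S * (M%:R^-1 `^ p^-1) `^ q * (Cd ^+ 3 * vball nu x r))%:E.
  by under eq_integral do rewrite opprB addrA subrK.
have := integral_powR_le p1 Q0 pQ (mB r) (mul l) (ltW Vr) (nu_ballE hZ x r_gt0) H2.
move=> H; apply: (le_trans H); rewrite lee_fin.
have Hj := HN j (leq_trans (leq_maxr _ _) nj).
have Hjq : (2 `^ q * `|approximant j x - l| `^ q <= e / 2)%R.
  rewrite -e2q ler_wpM2l ?powR_ge0//; apply: ge0_ler_powR; rewrite ?nnegrE ?(ltW q0)//.
    exact: ltW.
  by rewrite distrC.
rewrite [leLHS](_ : _ = (X * (M%:R^-1 `^ p^-1) `^ q +
    2 `^ q * `|approximant j x - l| `^ q) * vball nu x r)%R; last by rewrite /X; ring.
by rewrite ler_wpM2r ?(ltW Vr)// (splitr e) lerD.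
Qed.

Lemma precise_lebesgue : Lq_lebesgue_pt nu q precise x.
Proof.
(* Inside the integral [precise] may be replaced by [u] almost everywhere; at the single point [x]
   its value is the limit [l], which need not be [u x]. *)
have vx : precise x = l by exact: precise_lim.
have ae_eq : {ae nu, forall y, precise y = u y}.
  exact: (precise_ae hZ Cd1 hCd p1 theta0 mu Lp besov_fin).
have small e : (0 < e)%R -> exists2 r0 : R, (0 < r0)%R & forall r,
    (0 < r)%R -> (r < r0)%R ->
    (nu (ball x r))^-1 * \int[nu]_(y in ball x r) (`|precise y - precise x| `^ q)%:E
    <= e%:E.
  move=> e0; have [r0 r00 Hr] := average_small e0; exists r0 => // r r_gt0 rr0.
  have Vr := vball_gt0 hZ x r_gt0.
  rewrite (nu_ballE hZ)// inver (gt_eqF Vr) lee_pdivrMl// [leRHS](_ : _ = (e * vball nu x r)%:E); last first.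
    by rewrite mulrC.
  apply: le_trans (Hr _ r_gt0 rr0).
  have mw (v : Z -> R) c : measurable_fun setT v ->
      measurable_fun (ball x r) (fun y => (`|v y - c| `^ q)%:E).
    move=> mv; apply/measurable_EFinP; apply: (measurableT_comp (measurable_powR _)).
    apply: (measurableT_comp (@normr_measurable R setT)).
    by apply: measurable_funB => //; exact: measurable_funS mv.
  apply: ae_ge0_le_integral.
  - exact: (measurable_ballm hZ).
  - by move=> y _; rewrite lee_fin powR_ge0.
  - by apply: mw; exact: (measurable_precise hZ).
  - by move=> y _; rewrite lee_fin powR_ge0.
  - exact: mw.
  - by move: ae_eq; apply: filterS => y -> _; rewrite vx.
have F0 r : 0 <= (nu (ball x r))^-1 *
    \int[nu]_(y in ball x r) (`|precise y - precise x| `^ q)%:E.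
  by rewrite mule_ge0 ?inve_ge0//; apply: integral_ge0 => y _; rewrite lee_fin powR_ge0.
apply/fine_cvgP; split.
  have [r0 r00 Hr] := small 1%R ltr01; near=> r.
  rewrite ge0_fin_numE//; apply: le_lt_trans (Hr r _ _) _; last by rewrite ltry.
    by near: r; exact: nbhs_right_gt.
  by near: r; exact: nbhs_right_lt.
apply/cvgrPdist_le => e e0; have [r0 r00 Hr] := small e e0; near=> r.
have H : (nu (ball x r))^-1 *
    \int[nu]_(y in ball x r) (`|precise y - precise x| `^ q)%:E <= e%:E.
  apply: Hr; first by near: r; exact: nbhs_right_gt.
  by near: r; exact: nbhs_right_lt.
rewrite sub0r normrN /= ger0_norm ?fine_ge0//.
by rewrite -lee_fin fineK// ge0_fin_numE// (le_lt_trans H)// ltry.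
Unshelve. all: by end_near. Qed.

End at_point.

End lebesgue_points.

(** * Capacity of the exceptional set *)

Section exceptional_set.
Context (R : realType) (d : measure_display) (Z : metricMeasurableType R d).
Variable nu : {measure set Z -> \bar R}.
Implicit Types (w x y z : Z) (r s t : R).
Hypothesis hZ : metric_measure_space nu.
Variable Cd : R.
Hypotheses (Cd1 : 1 <= Cd)
  (hCd : forall x r, 0 < r -> vball nu x (2 * r) <= Cd * vball nu x r).
Variables (p theta Q Clow : R) (u : Z -> R).
Hypotheses (p1 : 1 <= p) (theta0 : 0 < theta) (theta1 : theta < 1).
Hypotheses (Q0 : 0 < Q) (pQ : p * theta < Q).
Hypotheses (Clow1 : 1 <= Clow) (hlow : forall x s r, 0 < s -> s <= r ->
  vball nu x r * (s / r) `^ Q <= Clow * vball nu x s).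
Hypothesis mu : measurable_fun setT u.
Hypothesis Lp : forall z r, (\int[nu]_(x in ball z r) (`|u x| `^ p)%:E < +oo)%E.
Hypothesis besov_fin : (\int[nu]_y besov_slice nu p theta u y < +oo)%E.

Local Notation osc := (osc nu p u).
Local Notation osc_sum := (osc_sum nu p theta u).
Local Notation q := (Q * p / (Q - p * theta)).
Local Notation approximant := (approximant nu u).
Local Notation precise := (precise nu u).
Local Open Scope ereal_scope.

Let p0 : (0 < p)%R. Proof. exact: lt_le_trans p1. Qed.
Let Cd0 : (0 < Cd)%R. Proof. exact: lt_le_trans Cd1. Qed.
Let rj0 j : (0 < 2 ^- j :> R)%R. Proof. by rewrite invr_gt0 exprn_gt0. Qed.

(** The term of scale [2^-j] is the same in every [osc_sum] of dyadic radius, so these sums are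
    tails of one series. *)
Let T j x : \bar R := ((2 ^- j) `^ (- (p * theta)))%:E * osc (2 ^- j) x.

Let T_ge0 j x : 0 <= T j x.
Proof. by rewrite mule_ge0 ?osc_ge0// lee_fin powR_ge0. Qed.

Let measurable_T j : measurable_fun setT (T j).
Proof. by apply: measurable_funeM; exact: measurable_osc. Qed.

Lemma osc_sum_dyadicE k x : osc_sum (2 ^- k) x = \sum_(0 <= i <oo) T (i + k) x.
Proof. by apply: eq_eseriesr => i _; rewrite /T exprD invfM. Qed.

Lemma le_osc_sum k j x : (k <= j)%N -> osc_sum (2 ^- j) x <= osc_sum (2 ^- k) x.
Proof.
move=> kj; rewrite !osc_sum_dyadicE.
rewrite !(@nneseries_addn _ (T ^~ x))//.
rewrite (@nneseries_split _ (T ^~ x) k (j - k))// subnKC//.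
by rewrite leeDr// sume_ge0.
Qed.

Lemma integral_osc_sum_dyadic k :
  \int[nu]_x osc_sum (2 ^- k) x = \sum_(0 <= i <oo) \int[nu]_x T (i + k) x.
Proof.
under eq_integral do rewrite osc_sum_dyadicE.
by rewrite integral_nneseries.
Qed.

Lemma integral_osc_sum_small e : (0 < e)%R ->
  exists k, \int[nu]_x osc_sum (2 ^- k) x <= e%:E.
Proof.
move=> e0; pose a j := \int[nu]_x T j x.
have a0 j : 0 <= a j by exact: integral_ge0.
have aoo : \sum_(0 <= j <oo) a j < +oo.
  have -> : \sum_(0 <= j <oo) a j = \sum_(0 <= i <oo) \int[nu]_x T (i + 0) x.
    by apply: eq_eseriesr => i _; rewrite addn0.
  rewrite -(integral_osc_sum_dyadic 0).
  exact: (integral_osc_sum_lty hZ Cd1 hCd p1 theta0 mu besov_fin (rj0 0)).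
have := nneseries_tail_cvg aoo (fun j _ => a0 j).
move=> /fine_cvgP[[N1 _ H1]] /cvgrPdist_le/(_ e e0)[N2 _ H2].
pose k := maxn N1 N2; exists k.
rewrite integral_osc_sum_dyadic (@nneseries_addn _ a)//.
have := H2 k (leq_maxr _ _); rewrite sub0r normrN /= => H.
rewrite -(fineK (H1 k (leq_maxl _ _))) lee_fin.
exact: le_trans (ler_norm _) H.
Qed.

Lemma integral_osc_fin j x r : \int[nu]_(y in ball x r) osc (2 ^- j) y \is a fin_num.
Proof.
have oscT y : osc (2 ^- j) y <= ((2 ^- j) `^ (p * theta))%:E * osc_sum 1 y.
  by have := osc_le_sum nu p theta u y j ltr01; rewrite mulr1.
rewrite ge0_fin_numE; last by apply: integral_ge0 => y _; exact: osc_ge0.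
apply: (@le_lt_trans _ _ (\int[nu]_y (((2 ^- j) `^ (p * theta))%:E * osc_sum 1 y))).
  apply: (@le_trans _ _ (\int[nu]_y osc (2 ^- j) y)).
    apply: ge0_subset_integral => //.
    - exact: (measurable_ballm hZ).
    - exact: (measurable_osc hZ).
    - by move=> y _; exact: osc_ge0.
  by apply: ge0_le_integral_nomeas => y _; [exact: osc_ge0|exact: oscT].
rewrite ge0_integralZl ?lee_fin ?powR_ge0//; last 2 first.
- exact: (measurable_osc_sum hZ).
- by move=> y _; exact: osc_sum_ge0.
by rewrite lte_mul_pinfty ?lee_fin ?powR_ge0//;
  exact: (integral_osc_sum_lty hZ Cd1 hCd p1 theta0 mu besov_fin ltr01).
Qed.

Let Kc : R := (halving_const Cd p * Cd ^+ 4)%R.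

Let Kc0 : (0 < Kc)%R.
Proof. by rewrite mulr_gt0 ?exprn_gt0// halving_const_gt0. Qed.

Let jump j x : R := `|approximant j.+1 x - approximant j x|%R.

(** A measurable dominant of the jump at all points within [2 * 2^-j] of [x]: their balls of radius
    [2^-j / 4] lie in the ball of radius [4 * 2^-j] at [x]. The radius is written [2 ^+ 2 * 2 ^- j]
    to match [integral_ball_average], and [Cd ^+ 4] in [Kc] exchanges the normalizing measures. *)
Let jump_bound j x : R := ((Kc * ((vball nu x (2 ^- j))^-1 *
  fine (\int[nu]_(y in ball x (2 ^+ 2 * 2 ^- j)) osc (2 ^- j) y))) `^ p^-1)%R.

Let jump_boundE j x : (jump_bound j x `^ p)%:E =
  Kc%:E * ((vball nu x (2 ^- j))^-1%:E *
    \int[nu]_(y in ball x (2 ^+ 2 * 2 ^- j)) osc (2 ^- j) y).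
Proof.
rewrite /jump_bound -powRrM mulVf ?gt_eqF// powRr1.
  by rewrite !EFinM fineK// integral_osc_fin.
rewrite mulr_ge0 ?(ltW Kc0)// mulr_ge0 ?invr_ge0 ?vball_ge0// fine_ge0//.
by apply: integral_ge0 => y _; exact: osc_ge0.
Qed.

Let measurable_jump_bound j : measurable_fun setT (jump_bound j).
Proof.
apply: (measurableT_comp (measurable_powR _)).
apply: measurable_funM => //; apply: measurable_funM.
  exact: (measurable_vballV hZ).
apply: (measurableT_comp (@fine_measurable R setT _)) => //.
apply: (measurable_ball_int hZ (g := fun xy => osc (2 ^- j) xy.2)).
  exact: (measurableT_comp (measurable_osc hZ _ mu _)).
by move=> xy; exact: osc_ge0.
Qed.

Let jump_le j x y : (mdist x y < 2 * 2 ^- j)%R -> (jump j y <= jump_bound j x)%R.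
Proof.
move=> xy; set r := (2 ^- j)%R in xy *.
have r0 : (0 < r)%R by exact: rj0.
pose s := (r * (1 / 4))%R.
have s0 : (0 < s)%R by rewrite mulr_gt0 ?divr_gt0.
have Vs := vball_gt0 hZ y s0; have Vr := vball_gt0 hZ x r0.
have s4 : (4 * s = r)%R by rewrite /s; field.
have H := avg_halve hZ Cd1 hCd p1 mu Lp y s0.
apply: (powR_root_le p0); first by rewrite /jump.
  by rewrite /jump_bound powR_ge0.
rewrite -lee_fin jump_boundE -/r.
have -> : jump j y = (`|avg nu u (s / 2) y - avg nu u s y|)%R.
  rewrite /jump /approximant/= (_ : 2 ^- j.+1 * (1 / 4) = s / 2)%R//.
  by rewrite /s /r exprSr invfM; ring.
rewrite EFinM -lee_pdivlMr// in H.
apply: (le_trans H); rewrite s4 muleC muleA -EFinM.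
have I0 : 0 <= \int[nu]_(z in ball y s) osc r z.
  by apply: integral_ge0 => z _; exact: osc_ge0.
apply: (@le_trans _ _ ((Kc * (vball nu x r)^-1)%:E * \int[nu]_(z in ball y s) osc r z)).
  apply: lee_wpmul2r => //; rewrite lee_fin mulrC /Kc -mulrA ler_wpM2l//.
    by rewrite ltW// halving_const_gt0.
  apply: (inv_vball_comparable hZ Cd1 hCd) => //.
  by rewrite metric_sym !exprS expr0 -s4; move: xy; rewrite -s4; set a := mdist _ _; lra.
rewrite EFinM -muleA; apply: lee_wpmul2l; first by rewrite lee_fin ltW.
apply: lee_wpmul2l; first by rewrite lee_fin invr_ge0 vball_ge0.
apply: ge0_subset_integral.
- exact: (measurable_ballm hZ).
- exact: (measurable_ballm hZ).
- exact: measurable_funS (measurable_osc hZ _ mu _).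
- by move=> z _; exact: osc_ge0.
- apply: subset_metric_ball; rewrite !exprS expr0 -s4.
  by move: xy; rewrite -s4; set a := mdist _ _; move: s0; lra.
Qed.

Let integral_jump_bound_le j : ((2 ^+ j) `^ (p * theta))%:E *
    \int[nu]_x (jump_bound j x `^ p)%:E <=
  (Kc * Cd ^+ 3)%:E * \int[nu]_x T j x.
Proof.
have mO := measurable_osc hZ p mu (2 ^- j).
have O0 y : 0 <= osc (2 ^- j) y by exact: osc_ge0.
rewrite (_ : \int[nu]_x T j x =
    ((2 ^+ j) `^ (p * theta))%:E * \int[nu]_x osc (2 ^- j) x); last first.
  rewrite ge0_integralZl ?lee_fin ?powR_ge0//.
  by rewrite powR_inv ?exprn_gt0// powRN invrK.
rewrite muleCA; apply: lee_wpmul2l; first by rewrite lee_fin powR_ge0.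
under eq_integral do rewrite jump_boundE.
have mI : measurable_fun setT (fun x => (vball nu x (2 ^- j))^-1%:E *
    \int[nu]_(y in ball x (2 ^+ 2 * 2 ^- j)) osc (2 ^- j) y).
  apply: emeasurable_funM; first exact/measurable_EFinP/(measurable_vballV hZ).
  apply: (measurable_ball_int hZ (g := fun xy => osc (2 ^- j) xy.2)) => //.
  exact: (measurableT_comp mO).
rewrite ge0_integralZl ?lee_fin ?(ltW Kc0)//; last first.
  move=> x _; rewrite mule_ge0 ?lee_fin ?invr_ge0 ?vball_ge0//.
  exact: integral_ge0.
rewrite [leRHS](_ : _ = Kc%:E * ((Cd ^+ 3)%:E * \int[nu]_x osc (2 ^- j) x)); last first.
  by rewrite muleA -EFinM.
apply: lee_wpmul2l; first by rewrite lee_fin ltW.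
exact: (integral_ball_average hZ).
Qed.

Lemma nneseries_ge_start (F G : nat -> \bar R) k : (forall j, 0 <= F j) ->
  (forall j, 0 <= G j) ->
  (forall j, (j < k)%N -> F j = 0) -> (forall j, (k <= j)%N -> F j <= G j) ->
  \sum_(0 <= j <oo) F j <= \sum_(0 <= i <oo) G (i + k)%N.
Proof.
move=> F0 G0 Fk FG; rewrite (@nneseries_split _ F 0 k)// add0n big1_seq ?add0e; last first.
  by move=> j /andP[_]; rewrite mem_index_iota => /andP[_ /Fk].
rewrite -nneseries_addn//; apply: lee_nneseries => // i _.
by apply: FG; exact: leq_addl.
Qed.

Section scale.
Variables (kappa : nat -> nat) (K : nat).
Hypothesis kappaP :
  forall m, \int[nu]_x osc_sum (2 ^- kappa m) x <= (2 ^- m)%:E.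

(* Finite energy, yet [M osc_sum (2^-j) <= h] for every [M] once [j] is large:
   this turns a bound by [h] into the [o(.)] needed at Lebesgue points. *)
Let h x : \bar R := \sum_(0 <= m <oo) osc_sum (2 ^- kappa (m + K)) x.

Let h_ge0 x : 0 <= h x.
Proof. by apply: nneseries_ge0 => m _ _; exact: osc_sum_ge0. Qed.

Let measurable_h : measurable_fun setT h.
Proof.
apply: ge0_emeasurable_sum => [m x _ _|m _]; first exact: osc_sum_ge0.
exact: (measurable_osc_sum hZ).
Qed.

Let integral_h_le : \int[nu]_x h x <= (2 * 2 ^- K)%:E.
Proof.
rewrite integral_nneseries//; last 2 first.
- by move=> m; exact: (measurable_osc_sum hZ).
- by move=> m x _; exact: osc_sum_ge0.
apply: nneseries_le_ub => [m|n].
  by apply: integral_ge0 => x _; exact: osc_sum_ge0.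
apply: (@le_trans _ _ (\sum_(0 <= m < n) (2^-1 ^+ m * 2 ^- K)%:E)).
  apply: lee_sum => m _; apply: (le_trans (kappaP _)).
  by rewrite lee_fin exprD invfM exprVn.
rewrite sumEFin lee_fin -mulr_suml ler_wpM2r ?(ltW (rj0 K))//.
have := @sum_geometric_le R 2^-1 n.
rewrite (_ : (1 - 2^-1)^-1 = 2 :> R)%R; last by field.
by apply; rewrite invr_gt0 ltr0n invf_lt1// ltr1n.
Qed.

Lemma small_energy_h M : exists J, forall j, (J <= j)%N ->
  forall x, M%:R%:E * osc_sum (2 ^- j) x <= h x.
Proof.
(* Once [j] passes the first [M] values of [kappa (m + K)], each of the first [M] terms of [h]
   dominates [osc_sum (2 ^- j)], because [osc_sum] grows with the radius. *)
exists (\max_(m < M) kappa (m + K)) => j Jj x.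
have O0 k y : 0 <= osc_sum (2 ^- k) y by exact: osc_sum_ge0.
apply: (@le_trans _ _ (\sum_(0 <= m < M) osc_sum (2 ^- kappa (m + K)) x)); last first.
  by apply: nneseries_lim_ge => m _ _.
apply: (@le_trans _ _ (\sum_(0 <= m < M) osc_sum (2 ^- j) x)).
  suff -> : M%:R%:E * osc_sum (2 ^- j) x = \sum_(0 <= m < M) osc_sum (2 ^- j) x by [].
  elim: M {Jj} => [|M IH]; first by rewrite mul0e big_geq.
  by rewrite big_nat_recr//= -IH -natr1 EFinD ge0_muleDl ?lee_fin// mul1e.
rewrite 2!big_mkord.
apply: lee_sum => m _.
apply: le_osc_sum.
by apply: leq_trans Jj; exact: (leq_bigmax m).
Qed.

(** Dropping the finitely many jumps before [kappa K] does not affect convergence and makes the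
    total energy of order [2^-K]. *)
Let jump_from j x : R := if (kappa K <= j)%N then jump j x else 0%R.

Let jump_bound_from j x : R := if (kappa K <= j)%N then jump_bound j x else 0%R.

Let jump_bound_from_ge0 j x : (0 <= jump_bound_from j x)%R.
Proof. by rewrite /jump_bound_from; case: ifP => // _; exact: powR_ge0. Qed.

Let measurable_jump_bound_from j : measurable_fun setT (jump_bound_from j).
Proof. by rewrite /jump_bound_from; case: (kappa K <= j)%N. Qed.

Lemma scale_energy_jump :
  scale_energy nu p theta jump_bound_from <= (Kc * Cd ^+ 3 * 2 ^- K)%:E.
Proof.
have C0 : (0 <= Kc * Cd ^+ 3)%R by rewrite mulr_ge0 ?(ltW Kc0) ?exprn_ge0 ?(ltW Cd0).
have IT0 j : 0 <= \int[nu]_x T j x by exact: integral_ge0.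
apply: (@le_trans _ _ (\sum_(0 <= i <oo)
    (Kc * Cd ^+ 3)%:E * \int[nu]_x T (i + kappa K) x)).
  apply: (@nneseries_ge_start _ (fun j => (Kc * Cd ^+ 3)%:E * \int[nu]_x T j x) (kappa K)).
  - move=> j; rewrite mule_ge0 ?lee_fin ?powR_ge0//.
    by apply: integral_ge0 => x _; rewrite lee_fin powR_ge0.
  - by move=> j; rewrite mule_ge0 ?lee_fin.
  - move=> j jk; rewrite integral0_eq ?mule0// => x _.
    by rewrite /jump_bound_from leqNgt jk powR0// gt_eqF.
  - move=> j kj; apply: le_trans (integral_jump_bound_le j).
    apply: lee_wpmul2l; first by rewrite lee_fin powR_ge0.
    by under eq_integral do rewrite /jump_bound_from kj.
rewrite nneseriesZl// -integral_osc_sum_dyadic [leRHS]EFinM.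
by apply: lee_wpmul2l; rewrite ?lee_fin//; exact: kappaP.
Qed.

(** The value 2 exceeds the threshold 1, so a point of a single fattened set is caught by the
    superlevel set. *)
Let fat_const (E : nat -> set Z) (c : R) j x : R :=
  (2 * \1_(fatten (c * 2 ^- j) (E j)) x)%R.

Let fat_const_ge0 E c j x : (0 <= fat_const E c j x)%R.
Proof. by rewrite mulr_ge0. Qed.

Let measurable_fat_const E c j : measurable_fun setT (fat_const E c j).
Proof.
by apply: measurable_funM => //; apply: measurable_indic; exact: (measurable_fatten hZ).
Qed.

Lemma scale_energy_fat E : scale_energy nu p theta (fat_const E 4) =
  (2 `^ p)%:E * \sum_(0 <= j <oo) ((2 ^+ j) `^ (p * theta))%:E *
     nu (fatten (4 * 2 ^- j) (E j)).
Proof.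
rewrite -nneseriesZl; last by move=> j _; rewrite mule_ge0 ?lee_fin ?powR_ge0.
apply: eq_eseriesr => j _; rewrite muleCA; congr (_ * _).
have mN := measurable_fatten hZ (4 * 2 ^- j) (E j).
rewrite [X in _ * nu X](_ : _ = fatten (4 * 2 ^- j) (E j) `&` setT); last by rewrite setIT.
rewrite -integral_indic// -ge0_integralZl ?lee_fin ?powR_ge0//; last first.
  by apply/measurable_EFinP; exact: measurable_indic.
apply: eq_integral => x _; rewrite -EFinM; congr (_ %:E).
rewrite /fat_const indicE; case: (x \in _); rewrite ?mulr1// !mulr0 powR0//.
by rewrite gt_eqF.
Qed.

Lemma scale_energyD (A B : nat -> Z -> R) : (forall j x, 0 <= A j x)%R -> (forall j x, 0 <= B j x)%R ->
  (forall j, measurable_fun setT (A j)) -> (forall j, measurable_fun setT (B j)) ->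
  scale_energy nu p theta (fun j x => A j x + B j x)%R <=
  (2 `^ p)%:E * (scale_energy nu p theta A + scale_energy nu p theta B).
Proof.
move=> A0 B0 mA mB.
have I0 (D : nat -> Z -> R) j : 0 <= \int[nu]_x (D j x `^ p)%:E.
  by apply: integral_ge0 => x _; rewrite lee_fin powR_ge0.
have mp (D : nat -> Z -> R) j : measurable_fun setT (D j) ->
    measurable_fun setT (fun x => (D j x `^ p)%:E).
  by move=> mD; apply/measurable_EFinP; exact: (measurableT_comp (measurable_powR _)).
have T0 (D : nat -> Z -> R) j :
    0 <= ((2 ^+ j) `^ (p * theta))%:E * \int[nu]_x (D j x `^ p)%:E.
  by rewrite mule_ge0 ?lee_fin ?powR_ge0.
rewrite /scale_energy -nneseriesD; [|by move=> *; exact: T0|by move=> *; exact: T0].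
rewrite -nneseriesZl; last by move=> j _; rewrite adde_ge0.
apply: lee_nneseries => [j _ _|j _]; first exact: (T0 (fun j x => A j x + B j x)%R).
rewrite -ge0_muleDr// muleCA; apply: lee_wpmul2l; first by rewrite lee_fin powR_ge0.
have mAj := mp A j (mA j); have mBj := mp B j (mB j).
have pA x : 0 <= (A j x `^ p)%:E by rewrite lee_fin powR_ge0.
have pB x : 0 <= (B j x `^ p)%:E by rewrite lee_fin powR_ge0.
rewrite -ge0_integralD// -ge0_integralZl ?lee_fin ?powR_ge0//; last 2 first.
- exact: emeasurable_funD.
- by move=> x _; rewrite adde_ge0.
apply: ge0_le_integral_nomeas => x _; first by rewrite lee_fin powR_ge0.
by rewrite -EFinD -EFinM lee_fin powRD_le.
Qed.

(** Read contrapositively, a small sum says two things: the jumps are summable, so the averages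
    converge at [x], and [x] avoids all fattened sets, so no ball around it carries too much of
    [h]. *)
Lemma lebesgue_pt_of_small_sum E x :
  (forall j y, (vball nu y (2 ^- j))%:E <=
        ((2 ^- j) `^ (p * theta))%:E * \int[nu]_(z in ball y (2 ^- j)) h z ->
      exists i, fatten (2 * 2 ^- i) (E i) y) ->
  (forall n, \sum_(0 <= j < n) (jump_from j x + fat_const E 2 j x) <= 1)%R ->
  Lq_lebesgue_pt nu q precise x.
Proof.
move=> HE Hsum.
have jf0 j : (0 <= jump_from j x)%R by rewrite /jump_from /jump; case: ifP.
have jsum n : (\sum_(0 <= j < n) jump_from j x <= 1)%R.
  apply: le_trans (Hsum n); apply: ler_sum => j _.
  by rewrite lerDl fat_const_ge0.
have cvg_c : cvgn (fun j => approximant j x).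
  (* The jumps before [kappa K], which the hypothesis does not bound, enter as a fixed finite
     sum. *)
  have : cvgn [normed series (telescope (fun j => approximant j x))].
    apply: nondecreasing_is_cvgn.
      by apply: nondecreasing_series => j _ _ /=.
    exists (\sum_(0 <= j < kappa K) jump j x + 1)%R => _ [n _ <-].
    rewrite /series/= (le_trans (_ : _ <= \sum_(0 <= j < n + kappa K) jump j x)%R)//.
      rewrite (@big_cat_nat _ _ _ n)//= ?leq_addr// lerDl; apply: sumr_ge0 => j _.
      by rewrite /jump.
    rewrite (@big_cat_nat _ _ _ (kappa K))//= ?leq_addl// lerD2l.
    apply: le_trans (jsum (n + kappa K)%N).
    rewrite [leRHS](@big_cat_nat _ _ _ (kappa K))//= ?leq_addl//.
    rewrite -[leLHS]add0r lerD//; first exact: sumr_ge0.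
    rewrite big_nat [leRHS]big_nat; apply: ler_sum => j /andP[kj _].
    by rewrite /jump_from kj.
  move=> /normed_cvg ct.
  have -> : (fun j => approximant j x) =
      (fun n => approximant 0 x + series (telescope (fun j => approximant j x)) n)%R.
    by apply/funext => n; exact: eq_sum_telescope.
  by apply: is_cvgD => //; exact: is_cvg_cst.
have not_covered j : ((2 ^- j) `^ (p * theta))%:E *
    \int[nu]_(z in ball x (2 ^- j)) h z < (vball nu x (2 ^- j))%:E.
  rewrite ltNge; apply/negP => /HE[i xi]; have := Hsum i.+1.
  rewrite leNgt => /negP; apply; rewrite big_nat_recr//=.
  rewrite /fat_const indicE mem_set// mulr1.
  have S0 : (0 <= \sum_(0 <= j < i) (jump_from j x + 2 * \1_(fatten (2 * 2 ^- j) (E j)) x))%R.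
    by apply: sumr_ge0 => k _; rewrite addr_ge0// mulr_ge0.
  by have := jf0 i; move: S0; lra.
apply: (precise_lebesgue hZ Cd1 hCd p1 theta0 Q0 pQ Clow1 hlow mu Lp besov_fin
  (l := limn (fun j => approximant j x))) => //.
move=> M M0; have [J HJ] := small_energy_h M; exists J => j Jj.
(* Here the bound on [h] becomes the little o: [h] dominates [M] times the oscillation sum. *)
apply: (@le_trans _ _ (\int[nu]_(y in ball x (2 ^- j)) h y)).
  rewrite -ge0_integralZl ?lee_fin//; last 3 first.
  - exact: (measurable_ballm hZ).
  - exact: measurable_funS (measurable_osc_sum hZ _ _ mu _).
  - by move=> y _; exact: osc_sum_ge0.
  apply: ge0_le_integral_nomeas => y _; last exact: HJ.
  by rewrite mule_ge0 ?lee_fin//; exact: osc_sum_ge0.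
by rewrite powRN EFinM lee_pdivlMl ?powR_gt0// ltW.
Qed.

(** The capacity constant is an argument so that the same [C] serves all [K]. *)
Lemma exceptional_capacity_le (C : R) : (0 < C)%R ->
  (forall (f A : nat -> Z -> R) (G : set Z),
    (forall j x, 0 <= f j x)%R -> (forall j, measurable_fun setT (A j)) ->
    (forall j x y, mdist x y < 2 * 2 ^- j -> f j y <= A j x)%R ->
    (forall x, G x -> exists n, 1 < \sum_(0 <= j < n) f j x)%R ->
    besov_capacity nu theta p G <= C%:E * scale_energy nu p theta A) ->
  besov_capacity nu theta p [set x | ~ Lq_lebesgue_pt nu q precise x] <=
  (C * (2 `^ p * (Kc * Cd ^+ 3 + 2 `^ p * (Cd ^+ 7 * 2))) * 2 ^- K)%:E.
Proof.
move=> C0 HC.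
have [E [HE1 HE2]] := greedy_cover hZ Cd1 hCd (p * theta) measurable_h h_ge0.
pose A j x := (jump_bound_from j x + fat_const E 4 j x)%R.
apply: (@le_trans _ _ (C%:E * scale_energy nu p theta A)).
  apply: (HC (fun j x => jump_from j x + fat_const E 2 j x)%R).
  - move=> j x; rewrite addr_ge0// /jump_from /jump; by case: ifP.
  - by move=> j; exact: measurable_funD.
  - move=> j x y xy; rewrite /A lerD//.
      by rewrite /jump_from /jump_bound_from; case: ifP => // _; exact: jump_le.
    rewrite /fat_const ler_wpM2l// !indicE.
    have [|_] := boolP (y \in _) => //; rewrite inE => -[z Ez /ball_mdist zy].
    rewrite (mem_set (_ : fatten (4 * 2 ^- j) (E j) x))//; exists z => //.
    apply/ball_mdist; rewrite (le_lt_trans (metric_triangle z y x))// (metric_sym y).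
    by move: zy xy; set a := mdist z y; set b := mdist x y; lra.
  - move=> x /= nx; apply: contrapT => /forallNP H; apply: nx.
    apply: (lebesgue_pt_of_small_sum HE1) => n.
    by rewrite leNgt; apply/negP; exact: H.
pose D := (Kc * Cd ^+ 3)%R; pose D' := (Cd ^+ 7 * (2 * 2 ^- K))%R.
have -> : (C * (2 `^ p * (Kc * Cd ^+ 3 + 2 `^ p * (Cd ^+ 7 * 2))) * 2 ^- K)%:E =
    C%:E * ((2 `^ p)%:E * ((D * 2 ^- K)%:E + (2 `^ p)%:E * D'%:E)).
  rewrite [RHS](_ : _ = (C * (2 `^ p * (D * 2 ^- K + 2 `^ p * D')))%:E)//.
  by rewrite -/D /D'; clearbody D; congr (_ %:E); ring.
apply: lee_wpmul2l; first by rewrite lee_fin ltW.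
apply: (le_trans (scale_energyD jump_bound_from_ge0 (fat_const_ge0 E 4)
  measurable_jump_bound_from (measurable_fat_const E 4))).
apply: lee_wpmul2l; first by rewrite lee_fin powR_ge0.
apply: leeD; first exact: scale_energy_jump.
rewrite scale_energy_fat; apply: lee_wpmul2l; first by rewrite lee_fin powR_ge0.
apply: (le_trans HE2); rewrite [leRHS](_ : _ = (Cd ^+ 7)%:E * (2 * 2 ^- K)%:E)//.
apply: lee_wpmul2l => //.
by rewrite lee_fin exprn_ge0 ?(ltW Cd0).
Qed.

End scale.

Lemma quasieverywhere_lebesgue :
  quasieverywhere nu theta p (Lq_lebesgue_pt nu q precise).
Proof.
have /choice[kappa kappaP] : forall m : nat, exists k : nat,
    \int[nu]_x osc_sum (2 ^- k) x <= (2 ^- m)%:E.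
  by move=> m; exact: integral_osc_sum_small.
have [C C0 HC] := besov_capacity_le hZ Cd1 hCd p1 theta0 theta1.
pose D := (C * (2 `^ p * (Kc * Cd ^+ 3 + 2 `^ p * (Cd ^+ 7 * 2))))%R.
rewrite /quasieverywhere; set cap := besov_capacity _ _ _ _.
(* [kappa] and [C] are fixed before [K], and the set in question involves neither, so [K] may tend
   to infinity. *)
have capK K : cap <= (D * 2 ^- K)%:E by exact: (exceptional_capacity_le K kappaP C0 HC).
have cap0 : 0 <= cap.
  by apply: le_ereal_inf_tmp => _ [v _ <-]; exact: poweR_ge0.
apply/eqP; rewrite eq_le cap0 andbT.
apply/lee_addgt0Pr => e e0; rewrite add0e.
have D0 : (0 <= D)%R.
  rewrite mulr_ge0 ?(ltW C0)// mulr_ge0 ?powR_ge0// addr_ge0//.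
    by rewrite mulr_ge0 ?(ltW Kc0) ?exprn_ge0 ?(ltW Cd0).
  by rewrite mulr_ge0 ?powR_ge0// mulr_ge0// exprn_ge0 ?(ltW Cd0).
have [n /andP[_ n2]] : exists n, (2 ^+ n <= D / e + 1 < 2 ^+ n.+1)%R.
  by apply: dyadic_between; rewrite lerDr divr_ge0// ltW.
apply: (le_trans (capK n.+1)); rewrite lee_fin ler_pdivrMr ?exprn_gt0//.
rewrite mulrC -ler_pdivrMr// ltW// (le_lt_trans _ n2)// lerDl//.
Qed.

End exceptional_set.

Theorem corollary1p4 (R : realType) (d : measure_display)
    (Z : completeMetricMeasurableType R d) (nu : {measure set Z -> \bar R})
    (p theta Q : R)
    (hZ : metric_measure_space nu) (hdoubling : doubling nu)
    (hp : 1 <= p) (htheta0 : 0 < theta) (htheta1 : theta < 1)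
    (hQ : 0 < Q) (hdecay : lower_volume_decay nu Q)
    (hreverse : reverse_doubling nu) (hpQ : p * theta < Q) :
  let Qstar := Q * p / (Q - p * theta) in
  forall u : Z -> R, besov_tilde nu theta p u ->
    Lloc nu Qstar u /\
    exists2 v : Z -> R, representative nu u v &
      quasieverywhere nu theta p (Lq_lebesgue_pt nu Qstar v).
Proof.
move=> Qstar u [[mu Lp] ufin].
(* The maximum gives [1 <= Cd] without a case distinction on whether [Z] is empty. *)
have [C0 hC0] := hdoubling; pose Cd := Num.max 1 C0.
have Cd1 : 1 <= Cd by rewrite le_max lexx.
have hCd (x : Z) r : 0 < r -> vball nu x (2 * r) <= Cd * vball nu x r.
  move=> r0; have := hC0 x r r0.
  rewrite !(nu_ballE hZ) ?mulr_gt0// -EFinM lee_fin => /le_trans; apply.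
  by rewrite ler_wpM2r ?vball_ge0// le_max lexx orbT.
have [Clow Clow1 hlow0] := hdecay.
have hlow (x : Z) s r : 0 < s -> s <= r ->
    vball nu x r * (s / r) `^ Q <= Clow * vball nu x s.
  move=> s0 sr; have r0 : 0 < r by exact: lt_le_trans sr.
  have Vr := vball_gt0 hZ x r0; have Cl0 : 0 < Clow by exact: lt_le_trans Clow1.
  have := hlow0 x s r s0 sr.
  rewrite !(nu_ballE hZ)// inver (gt_eqF Vr) -EFinM lee_fin.
  by rewrite ler_pdivlMr// -mulrA ler_pdivrMl// mulrC.
have p0 : 0 < p by exact: lt_le_trans hp.
have ufin' : (\int[nu]_y besov_slice nu p theta u y < +oo)%E.
  by apply: lty_poweRy ufin; rewrite gt_eqF// invr_gt0.
split.
  exact: (Lloc_sobolev hZ Cd1 hCd hp htheta0 hQ hpQ Clow1 hlow mu Lp ufin').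
exists (precise nu u); last first.
  exact: (quasieverywhere_lebesgue hZ Cd1 hCd hp htheta0 htheta1 hQ hpQ Clow1 hlow
    mu Lp ufin').
split; first exact: (measurable_precise hZ).
exact: (precise_ae hZ Cd1 hCd hp htheta0 mu Lp ufin').
Qed.
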